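(* Let $(M^{n+s},g)$ be a compact Riemannian manifold of dimension $n+s$ with a locally free isometric action of a connected abelian Lie group $G$ of dimension $s$, such that the collection $\{d\eta_1,\dots,d\eta_s\}$ has basic cohomological rank $k$, i.e. $\dim\langle [d\eta_1],\dots,[d\eta_s]\rangle=k$ in the basic cohomology $H^2(M/\mathcal{F})$. Then the spectral sequence $E^{p,q}_r$ of invariant forms degenerates at the latest at the $(k+2)$-th page, i.e. $d_r=0$ for all $r\ge k+2$.
   Context: A Lie group action is locally free if all its isotropy groups are discrete. Fix a basis of the Lie algebra of $G$ and let $\xi_1,\dots,\xi_s$ be the corresponding fundamental vector fields on $M$; they span an involutive subbundle $T\mathcal{F}\subset TM$ of rank $s$, tangent to the foliation $\mathcal{F}$ of $M$ by the orbits of $G$. Let $\eta_1,\dots,\eta_s$ be the $1$-forms defined by $\eta_i(\xi_j)=\delta_{ij}$ and $\eta_i|_{T\mathcal{F}^{\perp}}=0$, where $T\mathcal{F}^\perp$ is the $g$-orthogonal complement. Basic forms and basic cohomology: a smooth form $\omega$ on $M$ is transverse if $\iota_X\omega=0$ for all $X\in\Gamma(T\mathcal{F})$, and basic if both $\omega$ and $d\omega$ are transverse. Basic forms form a subcomplex $\Omega^\bullet(M/\mathcal{F})$ of the de Rham complex, with cohomology $H^\bullet(M/\mathcal{F})$. (The forms $d\eta_i$ are basic, so the classes $[d\eta_i]\in H^2(M/\mathcal{F})$ are defined.) Spectral sequence of invariant forms: identify $G$ with its image in $\mathrm{Diff}(M)$, let $\overline{G}$ be the closure of $G$ in $\mathrm{Diff}(M)$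 (contained in the isometry group), and let $\Omega^\bullet_{\overline{G}}(M)$ be the complex of $\overline{G}$-invariant smooth forms on $M$ with the exterior derivative. It is filtered by $$F^k_{\mathcal{F}}\Omega^r_{\overline{G}}(M)=\{\alpha\in\Omega^r_{\overline{G}}(M)\mid \iota_{X_{r-k+1}}\cdots\iota_{X_1}\alpha=0 \text{ for all } X_1,\dots,X_{r-k+1}\in\Gamma(T\mathcal{F})\}$$ (everything for $k\le 0$, zero for $k>r$). $E^{p,q}_r$ is the spectral sequence of this filtered complex: $E^{p,q}_0=F^p_{\mathcal{F}}\Omega^{p+q}_{\overline{G}}(M)/F^{p+1}_{\mathcal{F}}\Omega^{p+q}_{\overline{G}}(M)$, $d_r\colon E_r^{p,q}\to E_r^{p+r,q-r+1}$ is induced by $d$, and $E_{r+1}$ is the cohomology of $(E_r,d_r)$. *)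

(* Defs.v *)
From HB Require Import structures.
From mathcomp Require Import all_boot all_order all_algebra.
From mathcomp Require Import monoid.
From mathcomp Require Import all_classical all_reals.
From mathcomp Require Import topology normedtype derive.

Set Implicit Arguments.
Unset Strict Implicit.
Unset Printing Implicit Defensive.

Import Order.TTheory GRing.Theory Num.Theory.
Import numFieldNormedType.Exports.

Local Open Scope classical_set_scope.
Local Open Scope ring_scope.

Section SmoothEuclidean.
Variables (R : realType) (m : nat).
Implicit Types (f g : 'rV[R]_m -> R) (U : set 'rV[R]_m).

Definition partial (i : 'I_m) f : 'rV[R]_m -> R := 'D_(delta_mx 0 i) f.

Definition partials (l : seq 'I_m) f : 'rV[R]_m -> R := foldr partial f l.

Definition smooth_on U f := forall (l : seq 'I_m) x, U x ->
  {for x, continuous (partials l f)} /\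
  forall i, derivable (partials l f) x (delta_mx 0 i).

Let smoothN n U f := forall l : seq 'I_m, (size l <= n)%N -> forall x, U x ->
  {for x, continuous (partials l f)} /\
  forall i, derivable (partials l f) x (delta_mx 0 i).

Let smooth_onE U f : smooth_on U f <-> forall n, smoothN n U f.
Proof.
split=> [h n l _|h l]; first exact: h.
exact: (h (size l)).
Qed.

Let partials_rcons l i f : partials (rcons l i) f = partials l (partial i f).
Proof. by rewrite /partials foldr_rcons. Qed.

Let smoothN_partial n U f i : smoothN n.+1 U f -> smoothN n U (partial i f).
Proof.
by move=> h l sl x Ux; rewrite -partials_rcons; apply: h; rewrite ?size_rcons.
Qed.

Let smoothN0 n U f x : smoothN n U f -> U x ->
  {for x, continuous f} /\ forall i, derivable f x (delta_mx 0 i).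
Proof. by move=> h Ux; exact: (h [::] isT x Ux). Qed.

Let smoothNS n U f : smoothN 0 U f -> (forall i, smoothN n U (partial i f)) ->
  smoothN n.+1 U f.
Proof.
move=> h0 h l; case/lastP: l => [_|l i]; first exact: h0.
by rewrite size_rcons ltnS => sl x Ux; rewrite partials_rcons; apply: h.
Qed.

Let smoothN_le n n' U f : (n <= n')%N -> smoothN n' U f -> smoothN n U f.
Proof. by move=> nn' h l sl; apply: h; exact: leq_trans nn'. Qed.

Let smoothN_eq n U f g : open U -> (forall x, U x -> f x = g x) ->
  smoothN n U f -> smoothN n U g.
Proof.
move=> oU fg h l sl x Ux.
have nearU y : U y -> \forall z \near y, U z by move=> Uy; exact: (open_nbhs_nbhs (conj oU Uy)).
have E y : U y -> partials l f y = partials l g y.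
  elim: l {sl} y => [|i l IH] y Uy /=; first exact: fg.
  by apply: near_eq_derive; apply: filterS (nearU _ Uy) => z; exact: IH.
have nE : {near x, partials l f =1 partials l g}.
  by apply: filterS (nearU _ Ux) => z; exact: E.
have [hc hd] := h l sl x Ux; split=> [|i].
  rewrite /prop_for /continuous_at -(E x Ux).
  exact: cvg_trans (near_eq_cvg nE) hc.
exact: near_eq_derivable nE (hd i).
Qed.

Let smoothN_cst n U (a : R) : smoothN n U (cst a).
Proof.
have p0 (i : 'I_m) (b : R) : partial i (cst b) = cst 0.
  by apply/funext => x; rewrite /partial derive_cst.
have ps l : exists b : R, partials l (cst a) = cst b.
  elim: l => [|i l [b IH]]; first by exists a.
  by exists 0; rewrite /= IH p0.
move=> l _ x _; have [b ->] := ps l.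
by split=> [|i]; [exact: cst_continuous|exact: derivable_cst].
Qed.

Let smoothN_add n U f g : open U -> smoothN n U f -> smoothN n U g ->
  smoothN n U (f + g).
Proof.
move=> oU; elim: n f g => [|n IH] f g hf hg.
  move=> l; rewrite leqn0 => /nilP -> x Ux /=.
  have [fc fd] := smoothN0 hf Ux; have [gc gd] := smoothN0 hg Ux.
  by split=> [|i]; [exact: continuousD|exact: derivableD].
apply: smoothNS => [|i].
  move=> l; rewrite leqn0 => /nilP -> x Ux /=.
  have [fc fd] := smoothN0 hf Ux; have [gc gd] := smoothN0 hg Ux.
  by split=> [|i]; [exact: continuousD|exact: derivableD].
apply: (@smoothN_eq _ _ (partial i f + partial i g)) => //.
  move=> x Ux; rewrite /partial deriveD //.
  - by have [_ /(_ i)] := smoothN0 hf Ux.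
  - by have [_ /(_ i)] := smoothN0 hg Ux.
by apply: IH; exact: smoothN_partial.
Qed.

Let smoothN_mul n U f g : open U -> smoothN n U f -> smoothN n U g ->
  smoothN n U (f * g).
Proof.
move=> oU; elim: n f g => [|n IH] f g hf hg.
  move=> l; rewrite leqn0 => /nilP -> x Ux /=.
  have [fc fd] := smoothN0 hf Ux; have [gc gd] := smoothN0 hg Ux.
  by split=> [|i]; [exact: continuousM|exact: derivableM].
apply: smoothNS => [|i].
  move=> l; rewrite leqn0 => /nilP -> x Ux /=.
  have [fc fd] := smoothN0 hf Ux; have [gc gd] := smoothN0 hg Ux.
  by split=> [|i]; [exact: continuousM|exact: derivableM].
apply: (@smoothN_eq _ _ (f * partial i g + g * partial i f)) => //.
  move=> x Ux; rewrite /partial deriveM //.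
  - by have [_ /(_ i)] := smoothN0 hf Ux.
  - by have [_ /(_ i)] := smoothN0 hg Ux.
have hf' := smoothN_le (leqnSn n) hf; have hg' := smoothN_le (leqnSn n) hg.
exact: smoothN_add oU (IH _ _ hf' (smoothN_partial i hg))
  (IH _ _ hg' (smoothN_partial i hf)).
Qed.

Lemma smooth_on_cst U (a : R) : smooth_on U (cst a).
Proof. by apply/smooth_onE => n; exact: smoothN_cst. Qed.

Lemma smooth_onD U f g : open U -> smooth_on U f -> smooth_on U g ->
  smooth_on U (f + g).
Proof.
move=> oU /smooth_onE hf /smooth_onE hg; apply/smooth_onE => n.
exact: smoothN_add.
Qed.

Lemma smooth_onM U f g : open U -> smooth_on U f -> smooth_on U g ->
  smooth_on U (f * g).
Proof.
move=> oU /smooth_onE hf /smooth_onE hg; apply/smooth_onE => n.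
exact: smoothN_mul.
Qed.

End SmoothEuclidean.

Definition smooth_on_rV (R : realType) m k (U : set 'rV[R]_m)
  (F : 'rV[R]_m -> 'rV[R]_k) := forall j, smooth_on U (fun y => F y 0 j).

(* [chart_inv] is total because functions are; its values outside [chart_cod]
   are irrelevant. *)
Record chart (R : realType) (T : topologicalType) (m : nat) := Chart {
  chart_map :> T -> 'rV[R]_m;
  chart_inv : 'rV[R]_m -> T;
  chart_dom : set T;
  chart_cod : set 'rV[R]_m;
  chart_dom_open : open chart_dom;
  chart_cod_open : open chart_cod;
  chart_mapP : forall x, chart_dom x -> chart_cod (chart_map x);
  chart_invP : forall y, chart_cod y -> chart_dom (chart_inv y);
  chart_mapK : forall x, chart_dom x -> chart_inv (chart_map x) = x;
  chart_invK : forall y, chart_cod y -> chart_map (chart_inv y) = y;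
  chart_map_cont : forall x, chart_dom x -> {for x, continuous chart_map};
  chart_inv_cont : forall y, chart_cod y -> {for y, continuous chart_inv}
}.

Arguments chart_dom_open {R T m} _.
Arguments chart_cod_open {R T m} _.

HB.mixin Record isManifold (R : realType) (m : nat) T of Topological T := {
  atlas : set (chart R T m);
  manifold_hausdorff : hausdorff_space T;
  manifold_second_countable : @second_countable T;
  atlas_cover : forall x : T, exists2 c, atlas c & chart_dom c x;
  atlas_compatible : forall c c', atlas c -> atlas c' ->
    smooth_on_rV [set y | chart_cod c y /\ chart_dom c' (chart_inv c y)]
      (c' \o chart_inv c)
}.

#[short(type="manifoldType")]
HB.structure Definition Manifold (R : realType) (m : nat) :=
  {T of Topological T & isManifold R m T}.

Arguments atlas {R m} s.

Definition smooth_map_for (R : realType) (T N : topologicalType) m k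
    (A : set (chart R T m)) (B : set (chart R N k)) (F : T -> N) :=
  continuous F /\
  forall c c', A c -> B c' ->
    smooth_on_rV [set y | chart_cod c y /\ chart_dom c' (F (chart_inv c y))]
      (c' \o F \o chart_inv c).

Section ProductChart.
Variables (R : realType) (T N : topologicalType) (m k : nat).
Variables (c : chart R T m) (c' : chart R N k).

Let pmap (z : T * N) : 'rV[R]_(m + k) := row_mx (c z.1) (c' z.2).
Let pinv (v : 'rV[R]_(m + k)) : T * N :=
  (chart_inv c (lsubmx v), chart_inv c' (rsubmx v)).
Let pdom := [set z : T * N | chart_dom c z.1 /\ chart_dom c' z.2].
Let pcod := [set v : 'rV[R]_(m + k) |
  chart_cod c (lsubmx v) /\ chart_cod c' (rsubmx v)].

Let fst_cont : continuous (fst : T * N -> T).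
Proof. by move=> z; exact: cvg_fst. Qed.

Let snd_cont : continuous (snd : T * N -> N).
Proof. by move=> z; exact: cvg_snd. Qed.

Let pdom_open : open pdom.
Proof.
apply: openI.
- exact: ((continuousP _).1 fst_cont _ (chart_dom_open c)).
- exact: ((continuousP _).1 snd_cont _ (chart_dom_open c')).
Qed.

Let lsubmx_cont : continuous (lsubmx : 'rV[R]_(m + k) -> 'rV[R]_m).
Proof. by move=> v; exact: continuous_lsubmx. Qed.

Let rsubmx_cont : continuous (rsubmx : 'rV[R]_(m + k) -> 'rV[R]_k).
Proof. by move=> v; exact: continuous_rsubmx. Qed.

Let pcod_open : open pcod.
Proof.
apply: openI.
- exact: ((continuousP _).1 lsubmx_cont _ (chart_cod_open c)).
- exact: ((continuousP _).1 rsubmx_cont _ (chart_cod_open c')).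
Qed.

Let pmapP z : pdom z -> pcod (pmap z).
Proof.
by case=> h1 h2; rewrite /pcod /pmap /= row_mxKl row_mxKr; split;
  exact: chart_mapP.
Qed.

Let pinvP v : pcod v -> pdom (pinv v).
Proof. by case=> h1 h2; split; exact: chart_invP. Qed.

Let pmapK z : pdom z -> pinv (pmap z) = z.
Proof.
by case: z => x y [/= h1 h2]; rewrite /pinv /pmap row_mxKl row_mxKr !chart_mapK.
Qed.

Let pinvK v : pcod v -> pmap (pinv v) = v.
Proof. by case=> h1 h2; rewrite /pmap /pinv /= !chart_invK // hsubmxK. Qed.

Let pmap_cont z : pdom z -> {for z, continuous pmap}.
Proof.
case: z => x y [/= h1 h2].
have c1 : {for (x, y), continuous (c \o fst : T * N -> _)}.
  by apply: continuous_comp; [exact: fst_cont|exact: chart_map_cont].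
have c2 : {for (x, y), continuous (c' \o snd : T * N -> _)}.
  by apply: continuous_comp; [exact: snd_cont|exact: chart_map_cont].
apply/cvg_mx_entourageP => A entA.
have n1 : \forall w \near (x, y), forall i j, (c x i j, c w.1 i j) \in A.
  by move/cvg_mx_entourageP: c1 => /(_ A entA).
have n2 : \forall w \near (x, y), forall i j, (c' y i j, c' w.2 i j) \in A.
  by move/cvg_mx_entourageP: c2 => /(_ A entA).
suff : \forall w \near (x, y),
    forall i j, (pmap (x, y) i j, pmap w i j) \in A by [].
apply: filterS (filterI n1 n2) => w [{}n1 {}n2] i j.
by rewrite /pmap !mxE; case: splitP => j' _; [exact: n1|exact: n2].
Qed.

Let pinv_cont v : pcod v -> {for v, continuous pinv}.
Proof.
case=> h1 h2.
have c1 : {for v, continuous (chart_inv c \o lsubmx : 'rV[R]_(m + k) -> T)}.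
  by apply: continuous_comp; [exact: lsubmx_cont|exact: chart_inv_cont].
have c2 : {for v, continuous (chart_inv c' \o rsubmx : 'rV[R]_(m + k) -> N)}.
  by apply: continuous_comp; [exact: rsubmx_cont|exact: chart_inv_cont].
exact: (cvg_pair c1 c2).
Qed.

Definition prod_chart : chart R (T * N)%type (m + k) :=
  Chart pdom_open pcod_open pmapP pinvP pmapK pinvK pmap_cont pinv_cont.

End ProductChart.

Definition prod_atlas (R : realType) (T N : topologicalType) m k
    (A : set (chart R T m)) (B : set (chart R N k)) :=
  [set prod_chart c c' | c in A & c' in B].

HB.mixin Record isLieGroup (R : realType) (m : nat) G
    of Manifold R m G & Group G := {
  lie_mul_smooth : smooth_map_for (prod_atlas (atlas G) (atlas G)) (atlas G)
    (fun z : G * G => (z.1 * z.2)%g);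
  lie_inv_smooth : smooth_map_for (atlas G) (atlas G) (fun a : G => (a^-1)%g)
}.

#[short(type="lieGroupType")]
HB.structure Definition LieGroup (R : realType) (m : nat) :=
  {G of Manifold R m G & Group G & isLieGroup R m G}.

Section SmoothFunctions.
Variables (R : realType) (m : nat) (M : manifoldType R m).

Definition smooth_fun : {pred M -> R^o} := [pred f : M -> R^o |
  `[< forall c, atlas M c -> smooth_on (chart_cod c) (f \o chart_inv c) >]].

Record Cinf := MkCinf { cinf_fun :> M -> R^o; _ : cinf_fun \in smooth_fun }.

HB.instance Definition _ := [isSub for cinf_fun].
HB.instance Definition _ := [Choice of Cinf by <:].

Let smooth_funP (f : M -> R^o) : reflect
  (forall c, atlas M c -> smooth_on (chart_cod c) (f \o chart_inv c))
  (f \in smooth_fun).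
Proof. exact: asboolP. Qed.

Let smooth_funD : {in smooth_fun &, forall f g, f + g \in smooth_fun}.
Proof.
move=> f g /smooth_funP hf /smooth_funP hg; apply/smooth_funP => c ac.
by apply: (smooth_onD (chart_cod_open c)); [exact: hf|exact: hg].
Qed.

Let smooth_funM : {in smooth_fun &, forall f g, f * g \in smooth_fun}.
Proof.
move=> f g /smooth_funP hf /smooth_funP hg; apply/smooth_funP => c ac.
by apply: (smooth_onM (chart_cod_open c)); [exact: hf|exact: hg].
Qed.

Let smooth_fun_cst (a : R) : (cst a : M -> R^o) \in smooth_fun.
Proof. by apply/smooth_funP => c ac; exact: smooth_on_cst. Qed.

Fact smooth_fun_subring : subring_closed smooth_fun.
Proof.
split; [exact: (smooth_fun_cst 1)| |exact: smooth_funM].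
move=> f g hf hg; rewrite -mulN1r.
exact: smooth_funD hf (smooth_funM (smooth_fun_cst (-1)) hg).
Qed.

HB.instance Definition _ := GRing.SubChoice_isSubComPzRing.Build
  (M -> R^o)%type smooth_fun Cinf smooth_fun_subring.

Fact smooth_fun_submod : subsemimod_closed smooth_fun.
Proof.
split; first by split; [exact: (smooth_fun_cst 0)|exact: smooth_funD].
move=> a f hf; exact: (smooth_funM (smooth_fun_cst a) hf).
Qed.

HB.instance Definition _ := GRing.SubZmodule_isSubLmodule.Build
  R (M -> R^o)%type smooth_fun Cinf smooth_fun_submod.

End SmoothFunctions.

(* Vector fields are the derivations of the algebra of smooth functions, and
   differential forms (below) the alternating multilinear maps over that algebra
   on vector fields. *)
Section VectorFields.
Variables (R : realType) (m : nat) (M : manifoldType R m).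

Definition derivation : {pred Cinf M -> (Cinf M)^o} :=
  [pred X : Cinf M -> (Cinf M)^o |
    `[< (forall (a : R) (f g : Cinf M), X (a *: f + g) = a *: X f + X g) /\
        (forall f g : Cinf M, X (f * g) = X f * g + f * X g) >]].

Record vfield := MkVfield {
  vfield_fun :> Cinf M -> (Cinf M)^o; _ : vfield_fun \in derivation }.

HB.instance Definition _ := [isSub for vfield_fun].
HB.instance Definition _ := [Choice of vfield by <:].

Fact derivation_submod : subsemimod_closed derivation.
Proof.
split=> [|h X /asboolP[Xl Xm]]; last first.
  apply/asboolP; split=> [a f g|f g].
  - have E (u : Cinf M) : (h *: X) u = (h : Cinf M) * X u by [].
    rewrite !E Xl mulrDr; congr (_ + _).
    by apply: val_inj; apply/funext => x /=; exact: mulrCA.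
  - have E (u : Cinf M) : (h *: X) u = (h : Cinf M) * X u by [].
    by rewrite !E Xm mulrDr; congr (_ + _); [exact: mulrA|exact: mulrCA].
split.
  apply/asboolP; split=> [a f g|f g].
  - have E (u : Cinf M) : (0 : Cinf M -> (Cinf M)^o) u = 0 by [].
    by rewrite !E scaler0 addr0.
  - have E (u : Cinf M) : (0 : Cinf M -> (Cinf M)^o) u = 0 by [].
    by rewrite !E mul0r mulr0 addr0.
move=> X Y /asboolP[Xl Xm] /asboolP[Yl Ym]; apply/asboolP.
have E (u : Cinf M) : (X + Y) u = X u + Y u by [].
split=> [a f g|f g].
- by rewrite !E Xl Yl scalerDr addrACA.
- by rewrite !E Xm Ym mulrDl mulrDr addrACA.
Qed.

HB.instance Definition _ := GRing.SubChoice_isSubLmodule.Build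
  (Cinf M) (Cinf M -> (Cinf M)^o)%type derivation vfield derivation_submod.

Let vfieldP (X : vfield) :
  (forall (a : R) (f g : Cinf M), X (a *: f + g) = a *: X f + X g) /\
  (forall f g : Cinf M, X (f * g) = X f * g + f * X g).
Proof. by case: X => X /= /asboolP. Qed.

Fact lie_bracket_subproof (X Y : vfield) :
  (fun f : Cinf M => X (Y f) - Y (X f)) \in derivation.
Proof.
have [Xl Xm] := vfieldP X; have [Yl Ym] := vfieldP Y.
have XD f g : X (f + g) = X f + X g by rewrite -{1}(scale1r f) Xl scale1r.
have YD f g : Y (f + g) = Y f + Y g by rewrite -{1}(scale1r f) Yl scale1r.
apply/asboolP; split=> [a f g|f g].
- by rewrite Yl Xl Xl Yl scalerBr opprD addrACA.
- rewrite Ym Xm XD YD !Xm !Ym mulrBl mulrBr.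
  have E (V : zmodType) (a b c d a' d' : V) :
      (a + b) + (c + d) - ((a' + c) + (b + d')) = (a - a') + (d - d').
    rewrite (addrC a b) (addrACA b) (addrC a' c) (addrACA c) (addrC b c).
    by rewrite (opprD (c + b)) (addrACA (c + b)) subrr add0r opprD addrACA.
  exact: E.
Qed.

Definition lie_bracket (X Y : vfield) : vfield :=
  MkVfield (lie_bracket_subproof X Y).

End VectorFields.

(* Y at phi x is the image of X at x under the differential of phi; for a smooth
   phi the function h exists for every f, and for a diffeomorphism Y is the
   push-forward of X. *)
Definition related (R : realType) m k (M : manifoldType R m)
    (N : manifoldType R k) (phi : M -> N) (X : vfield M) (Y : vfield N) :=
  forall (f : Cinf N) (h : Cinf M), (forall x, h x = f (phi x)) ->
  forall x, X h x = Y f (phi x).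

Section DifferentialForms.
Variables (R : realType) (m : nat) (M : manifoldType R m).

Definition upd n (X : 'I_n -> vfield M) i Y : 'I_n -> vfield M :=
  fun j => if j == i then Y else X j.

Definition cochain n := ('I_n -> vfield M) -> Cinf M.

Definition dform n : set (cochain n) := [set w |
  (forall (X : 'I_n -> vfield M) i (f : Cinf M) (Y Z : vfield M),
     w (upd X i (f *: Y + Z)) =
       f * w (upd X i Y) + w (upd X i Z)) /\
  (forall (X : 'I_n -> vfield M) i j, i != j -> X i = X j -> w X = 0)].

(* Koszul's formula
     dw(X_0,..,X_n) = sum_j (-1)^j X_j(w(..,^X_j,..))
       + sum_(i<j) (-1)^(i+j) w([X_i,X_j],..,^X_i,..,^X_j,..),
   with the bracket moved to the place of X_i, which absorbs the sign (-1)^i. *)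
Definition ext_d n (w : cochain n) : cochain n.+1 := fun X =>
  \sum_(j < n.+1) (-1) ^+ j *
    (X j (w (X \o lift j)) +
     \sum_(i < n | (i < j)%N)
       w (upd (X \o lift j) i (lie_bracket (X (lift j i)) (X j)))).

Definition contract (X : vfield M) n : cochain n -> cochain n.-1 :=
  match n with
  | 0 => fun=> 0
  | _.+1 => fun w Y => w (fun i => oapp Y X (unlift ord0 i))
  end.

(* The contractions of w with any X_1, .., X_j in D, in this order, vanish. *)
Fixpoint contractions_vanish (D : set (vfield M)) j n : set (cochain n) :=
  match j with
  | 0 => [set 0]
  | j'.+1 => [set w | forall X, D X -> contractions_vanish D j' (contract X w)]
  end.

(* phi^* w = w, for a diffeomorphism phi. *)
Definition invariant_form (phi : M -> M) n : set (cochain n) := [set w |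
  forall X Y : 'I_n -> vfield M, (forall i, related phi (X i) (Y i)) ->
  forall x, w Y (phi x) = w X x].

End DifferentialForms.

Record diffeo (R : realType) m (M : manifoldType R m) := Diffeo {
  diffeo_fun :> M -> M;
  diffeo_inv : M -> M;
  diffeo_funK : cancel diffeo_fun diffeo_inv;
  diffeo_invK : cancel diffeo_inv diffeo_fun;
  diffeo_smooth : smooth_map_for (atlas M) (atlas M) diffeo_fun;
  diffeo_inv_smooth : smooth_map_for (atlas M) (atlas M) diffeo_inv
}.

(* The C^oo (weak Whitney) topology on Diff(M): a subbasic set consists of the
   maps whose partial derivatives of order <= r, read in two charts c and c',
   are e-close on a compact subset K of the domain of c to those of a given
   phi sending K into the domain of c'. *)
Section DiffeoTopology.
Variables (R : realType) (m : nat) (M : manifoldType R m).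

Definition local_expr (c c' : chart R M m) (psi : M -> M) (j : 'I_m) :
  'rV[R]_m -> R := fun y => c' (psi (chart_inv c y)) 0 j.

Definition diffeo_near (phi : diffeo M) c c' (K : set M) (r : nat) (e : R) :
  set (diffeo M) := [set psi |
    psi @` K `<=` chart_dom c' /\
    forall x, K x -> forall (l : seq 'I_m) j, (size l <= r)%N ->
      `|partials l (local_expr c c' psi j) (c x) -
        partials l (local_expr c c' phi j) (c x)| < e].

Definition diffeo_subbase : set (set (diffeo M)) := [set N |
  exists (phi : diffeo M) (c c' : chart R M m) (K : set M) (r : nat) (e : R),
    [/\ atlas M c /\ atlas M c', compact K, K `<=` chart_dom c,
        phi @` K `<=` chart_dom c' & 0 < e] /\
    N = diffeo_near phi c c' K r e].

HB.instance Definition _ := gen_eqMixin (diffeo M).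
HB.instance Definition _ := gen_choiceMixin (diffeo M).
HB.instance Definition _ :=
  isSubBaseTopological.Build (diffeo M) diffeo_subbase id.

End DiffeoTopology.

Section Riemannian.
Variables (R : realType) (m : nat) (M : manifoldType R m).
Implicit Types g : vfield M -> vfield M -> Cinf M.

Definition riemannian_metric g :=
  [/\ forall (f : Cinf M) (X Y Z : vfield M),
        g (f *: X + Y) Z = f * g X Z + g Y Z,
      forall X Y, g X Y = g Y X &
      forall (X : vfield M) (x : M),
        (exists f, X f x <> 0) -> 0 < g X X x].

Definition preserves_metric g (phi : M -> M) := forall X X' Y Y' : vfield M,
  related phi X X' -> related phi Y Y' ->
  forall x, g X' Y' (phi x) = g X Y x.

End Riemannian.

Section Actions.
Variables (R : realType) (k m : nat).
Variables (G : lieGroupType R k) (M : manifoldType R m).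

Definition lie_action (rho : G -> diffeo M) :=
  [/\ forall x, rho 1%g x = x,
      forall a b x, rho (a * b)%g x = rho a (rho b x) &
      smooth_map_for (prod_atlas (atlas G) (atlas M)) (atlas M)
        (fun z : G * M => rho z.1 z.2)].

Definition isotropy (rho : G -> diffeo M) (x : M) : set G :=
  [set a | rho a x = x].

Definition locally_free (rho : G -> diffeo M) :=
  forall x, isotropy rho x `<=` isolated (isotropy rho x).

Definition left_invariant (L : vfield G) :=
  forall a : G, related (fun b => (a * b)%g) L L.

Definition lie_algebra_basis s (L : 'I_s -> vfield G) :=
  (forall i, left_invariant (L i)) /\
  forall L', left_invariant L' -> exists! c : 'I_s -> R,
    forall f, L' f = \sum_(i < s) c i *: L i f.

(* The value at x of the fundamental field of L is the image of L(1) under the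
   differential at 1 of the orbit map a |-> rho a x. *)
Definition fundamental (rho : G -> diffeo M) (L : vfield G) (X : vfield M) :=
  forall (f : Cinf M) (x : M) (h : Cinf G),
    (forall a, h a = f (rho a x)) -> X f x = L h 1%g.

End Actions.

Section BasicForms.
Variables (R : realType) (m : nat) (M : manifoldType R m).
Variables (s : nat) (xi : 'I_s -> vfield M).

Definition tangent_fields : set (vfield M) := [set X : vfield M |
  forall x, exists c : 'I_s -> R, forall f, X f x = \sum_(i < s) c i * xi i f x].

Definition dual_coframe (g : vfield M -> vfield M -> Cinf M)
    (eta : 'I_s -> cochain M 1) := forall i,
  [/\ dform (eta i),
      forall j, eta i (fun=> xi j) = (i == j)%:R &
      forall (X : vfield M) x,
        (forall Y, tangent_fields Y -> g X Y x = 0) -> eta i (fun=> X) x = 0].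

Definition transverse n : set (cochain M n) :=
  @contractions_vanish _ _ M tangent_fields 1 n.

Definition basic n : set (cochain M n) :=
  [set w | [/\ dform w, transverse w & transverse (ext_d w)]].

Definition basic_exact n : set (cochain M n) :=
  match n with 0 => [set 0] | n'.+1 => @ext_d _ _ M n' @` basic (n := n') end.

End BasicForms.

(* The classes of the v_j modulo the subspace B span a space of dimension k:
   the classes of some w_1, ..., w_k form a basis of that span. *)
Definition rank_mod (R : realType) (V : lmodType R) (B : set V) s
    (v : 'I_s -> V) (k : nat) := exists w : 'I_k -> V,
  [/\ forall i, exists c : 'I_s -> R, B (w i - \sum_(j < s) c j *: v j),
      forall j, exists c : 'I_k -> R, B (v j - \sum_(i < k) c i *: w i) &
      forall c : 'I_k -> R, B (\sum_(i < k) c i *: w i) -> forall i, c i = 0].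

Definition basic_cohomological_rank (R : realType) m (M : manifoldType R m) s
    (xi : 'I_s -> vfield M) (eta : 'I_s -> cochain M 1) (k : nat) :=
  rank_mod (V := ('I_2 -> vfield M) -> Cinf M) (basic_exact xi (n:=2))
    (fun i => ext_d (eta i)) k.

(* The spectral sequence of a complex filtered by F, with the term of
   filtration degree p and complementary degree q indexed by p and n = p + q.
   E_r is Z_r / B_r, an element of which is a coset of B_r; the differential
   sends the coset of a to the coset of d a. *)
Unset Implicit Arguments.

Section SpectralSequence.
Variables (C : nat -> zmodType) (d : forall n, C n -> C n.+1).
Variable F : int -> forall n, set (C n).

Definition ssZ (r : nat) (p : int) n : set (C n) :=
  [set a | F p n a /\ F (p + r%:Z) n.+1 (d n a)].

Definition ssB (r : nat) (p : int) n : set (C n) :=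
  match r with
  | 0 => F (p + 1) n
  | r'.+1 => [set a + b | a in ssZ r' (p + 1) n & b in
      match n return set (C n) with
      | 0 => [set 0]
      | n'.+1 => d n' @` ssZ r' (p - r'%:Z) n'
      end]
  end.

Definition ssE (r : nat) (p : int) n : set (set (C n)) :=
  [set [set a + b | b in ssB r p n] | a in ssZ r p n].

Definition ssd (r : nat) (p : int) n (A : set (C n)) : set (C n.+1) :=
  [set d n a + b | a in A & b in ssB r (p + r%:Z) n.+1].

Definition degenerates_at (r0 : nat) := forall r, (r0 <= r)%N ->
  forall p n (A : set (C n)), ssE r p n A ->
    ssd r p n A = ssB r (p + r%:Z) n.+1.

End SpectralSequence.

Set Implicit Arguments.

Section InvariantForms.
Variables (R : realType) (m : nat) (M : manifoldType R m).

Definition invariant_forms (H : set (diffeo M)) n : set (cochain M n) :=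
  [set w | dform w /\ forall phi, H phi -> invariant_form phi w].

(* No condition for k <= 0; for k > r the truncated subtraction gives no
   contraction and the condition reads w = 0. *)
Definition fol_filtration s (xi : 'I_s -> vfield M) (H : set (diffeo M))
    (k : int) r : set (cochain M r) :=
  [set w | invariant_forms H w /\
    (0 < k -> contractions_vanish (tangent_fields xi) (r.+1 - `|k|)%N w)].

End InvariantForms.

(* Main.v *)
(* Let the classes w_1, .., w_k be a basis of the span of the [d eta_i]: modulo d
   of basic forms, d eta_i = sum_b C_ib w_b and w_b = sum_j E_bj d eta_j. Then, with
   phi_b = sum_j E_bj eta_j and basic 1-forms beta_i,
     theta_i = eta_i - sum_b C_ib phi_b - beta_i
   is closed. The operator N = sum_i theta_i /\ iota_(xi_i) on invariant forms
   commutes with d, since L_(xi_i) vanishes on them. On the quotient of F^p by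
   F^(p+1) in degree n it equals q - sum_b phi_b /\ iota_(zeta_b), where q = n - p,
   zeta_b = sum_i C_ib xi_i and phi_a(zeta_b) = delta_ab, so it is annihilated there
   by the product of the N - (q - j), 0 <= j <= k. If a is in F^p and da in F^(p+r)
   with r >= k + 2, then da is killed by a product of N - x whose roots x are all
   smaller than q - k, so a is congruent modulo F^(p+1) to a closed invariant form,
   and d_r vanishes on the class of a.

   An invariant form w has L_(xi_i) w = 0 because (L_(xi_i) w)(X) is the derivative
   along the i-th field of G of the locally constant function (rho_b^* w)(X).
   Conversely this derivative formula shows that theta_i, for which
   L_(xi_j) theta_i = 0 by Cartan's formula, is invariant under the connected group
   G, and then under its closure, by continuity in the C^1 topology. *)

Require Import Defs.
From HB Require Import structures.
From mathcomp Require Import all_boot all_order all_algebra.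
From mathcomp Require Import monoid.
From mathcomp Require Import all_classical all_reals.
From mathcomp Require Import topology normedtype derive.
From mathcomp Require Import sequences realfun exp measure lebesgue_measure.
From mathcomp Require Import lebesgue_integral ftc.
From mathcomp Require Import ring lra zify.

Set Implicit Arguments.
Unset Strict Implicit.
Unset Printing Implicit Defensive.

Import Order.TTheory GRing.Theory Num.Theory.
Import numFieldNormedType.Exports.

Local Open Scope classical_set_scope.
Local Open Scope ring_scope.

(* The library also has a [contract], on extended reals. *)
Local Notation contraction := Defs.contract.

(** * Exterior calculus on derivations *)

(** If all eta_i were closed, sum_i eta_i /\ iota_(xi_i), which is multiplication by the orbit
    degree q modulo the next filtration step, would commute with d on invariant forms, and no d_r
    that changes the orbit degree could survive. The classes [d eta_i] obstruct this. Correcting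
    eta_i to a closed theta_i replaces the single eigenvalue q by the window q - k, .., q; as d_r
    lowers the orbit degree by r - 1, page k + 2 is the first on which it jumps clear of the whole
    window. The rank enters because the correction uses k forms phi_b instead of s.

    The other obstacle is that fields are global derivations and forms are maps on such fields, so
    nothing is given pointwise. Bump functions and Hadamard's lemma recover the local picture:
    derivations at a point are combinations of partials, and forms are governed by local frames.
    Invariance is compared with Lie derivatives through scalar functions on G, whose smoothness
    comes from the smoothness of the action in product charts. *)

Section VectorFieldAlgebra.
Variables (R : realType) (m : nat) (M : manifoldType R m).
Implicit Types (X Y Z : vfield M) (f g h : Cinf M).

Lemma vfield_ext X Y : (forall f, X f = Y f) -> X = Y.
Proof. by move=> XY; apply: val_inj; apply/funext => f; exact: XY. Qed.

Lemma Cinf_ext f g : (forall x, f x = g x) -> f = g.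
Proof. by move=> fg; apply: val_inj; apply/funext. Qed.

Lemma CinfDE f g x : (f + g) x = f x + g x. Proof. by []. Qed.
Lemma CinfNE f x : (- f) x = - f x. Proof. by []. Qed.
Lemma CinfBE f g x : (f - g) x = f x - g x. Proof. by []. Qed.
Lemma CinfME f g x : (f * g) x = f x * g x. Proof. by []. Qed.
Lemma CinfZE (a : R) f x : (a *: f) x = a * f x. Proof. by []. Qed.
Lemma Cinf0E x : (0 : Cinf M) x = 0. Proof. by []. Qed.
Lemma Cinf1E x : (1 : Cinf M) x = 1. Proof. by []. Qed.
Lemma Cinf_sumE (I : Type) (r : seq I) (P : pred I) (F : I -> Cinf M) x :
  (\sum_(i <- r | P i) F i) x = \sum_(i <- r | P i) F i x.
Proof. by elim/big_rec2: _ => // i a b _ <-. Qed.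

Lemma CinfZAl (a : R) f g : a *: (f * g) = (a *: f) * g.
Proof. by apply: Cinf_ext => x; rewrite CinfZE !CinfME CinfZE mulrA. Qed.

Lemma CinfZAr (a : R) f g : a *: (f * g) = f * (a *: g).
Proof. by rewrite mulrC CinfZAl mulrC. Qed.

Lemma vfieldDE X Y f : (X + Y) f = X f + Y f. Proof. by []. Qed.
Lemma vfieldNE X f : (- X) f = - X f. Proof. by []. Qed.
Lemma vfieldBE X Y f : (X - Y) f = X f - Y f. Proof. by []. Qed.
Lemma vfieldZE g X f : (g *: X) f = g * X f. Proof. by []. Qed.
Lemma vfield0E f : (0 : vfield M) f = 0. Proof. by []. Qed.
Lemma vfield_sumE (I : Type) (r : seq I) (P : pred I) (F : I -> vfield M) f :
  (\sum_(i <- r | P i) F i) f = \sum_(i <- r | P i) F i f.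
Proof. by elim/big_rec2: _ => // i a b _ <-. Qed.

Lemma vfield_lin X (a : R) f g : X (a *: f + g) = a *: X f + X g.
Proof. by case: X => X /= /asboolP[]. Qed.

Lemma vfieldM X f g : X (f * g) = X f * g + f * X g.
Proof. by case: X => X /= /asboolP[]. Qed.

Lemma vfieldD X f g : X (f + g) = X f + X g.
Proof. by rewrite -{1}(scale1r f) vfield_lin scale1r. Qed.

Lemma vfield0 X : X 0 = 0.
Proof. by apply: (addrI (X 0)); rewrite -vfieldD !addr0. Qed.

Lemma vfieldZ X (a : R) f : X (a *: f) = a *: X f.
Proof. by rewrite -[a *: f]addr0 vfield_lin vfield0 addr0. Qed.

Lemma vfieldN X f : X (- f) = - X f.
Proof. by rewrite -scaleN1r vfieldZ scaleN1r. Qed.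

Lemma vfieldB X f g : X (f - g) = X f - X g.
Proof. by rewrite vfieldD vfieldN. Qed.

Lemma vfield1 X : X 1 = 0.
Proof.
by have := vfieldM X 1 1; rewrite !mulr1 !mul1r => /esym/(canRL (addrK _)); rewrite subrr.
Qed.

Lemma vfield_sum X (I : Type) (r : seq I) (P : pred I) (F : I -> Cinf M) :
  X (\sum_(i <- r | P i) F i) = \sum_(i <- r | P i) X (F i).
Proof.
by elim/big_rec2: _ => [|i a b _ <-]; [exact: vfield0|exact: vfieldD].
Qed.

Lemma bracketE X Y f : lie_bracket X Y f = X (Y f) - Y (X f).
Proof. by []. Qed.

Lemma bracketDr X Y Z : lie_bracket X (Y + Z) = lie_bracket X Y + lie_bracket X Z.
Proof.
apply: vfield_ext => f; rewrite vfieldDE !bracketE !vfieldDE vfieldD.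
by rewrite (opprD (Y (X f))) addrACA.
Qed.

Lemma bracketZr X f Y :
  lie_bracket X (f *: Y) = X f *: Y + f *: lie_bracket X Y.
Proof.
apply: vfield_ext => g; rewrite vfieldDE !vfieldZE !bracketE !vfieldZE vfieldM.
by rewrite mulrBr addrA.
Qed.

Lemma bracketC X Y : lie_bracket X Y = - lie_bracket Y X.
Proof. by apply: vfield_ext => f; rewrite vfieldNE !bracketE opprB. Qed.

Lemma bracket_jacobi X Y Z : lie_bracket (lie_bracket X Y) Z =
  lie_bracket X (lie_bracket Y Z) - lie_bracket Y (lie_bracket X Z).
Proof.
apply: vfield_ext => f; rewrite vfieldBE !bracketE !vfieldB.
move: (X _) (Y _) (X _) (Z (X _)) (Z (Y _)) (Y _) => a b c d e g.
rewrite ?opprB ?opprD ?opprK; ring.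
Qed.

End VectorFieldAlgebra.

Section Forms.
Variables (R : realType) (m : nat) (M : manifoldType R m).
Implicit Types (X Y Z : vfield M) (f g h : Cinf M).

Definition cscale n f (w : cochain M n) : cochain M n := fun T => f * w T.

Definition vcons n X (T : 'I_n -> vfield M) : 'I_n.+1 -> vfield M :=
  fun i => oapp T X (unlift ord0 i).

Lemma vcons0 n X (T : 'I_n -> vfield M) : vcons X T ord0 = X.
Proof. by rewrite /vcons unlift_none. Qed.

Lemma vconsS n X (T : 'I_n -> vfield M) i : vcons X T (lift ord0 i) = T i.
Proof. by rewrite /vcons liftK. Qed.

Lemma vcons_eta n (T : 'I_n.+1 -> vfield M) :
  vcons (T ord0) (T \o lift ord0) = T.
Proof.
by apply/funext => i; case: (unliftP ord0 i) => [j|] ->; rewrite ?vconsS ?vcons0.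
Qed.

Lemma vcons_lift0 n X (T : 'I_n -> vfield M) : vcons X T \o lift ord0 = T.
Proof. by apply/funext => i; rewrite /= vconsS. Qed.

Lemma vcons_liftS n X (T : 'I_n.+1 -> vfield M) j :
  vcons X T \o lift (lift ord0 j) = vcons X (T \o lift j).
Proof.
apply/funext => i /=; case: (unliftP ord0 i) => [i'|] ->.
  rewrite vconsS /=.
  have -> : lift (lift ord0 j) (lift ord0 i') = lift ord0 (lift j i').
    by apply/val_inj; rewrite /= /bump !leq0n !add1n ltnS addnS.
  by rewrite vconsS.
rewrite vcons0; have -> : lift (lift ord0 j) ord0 = ord0 by exact/val_inj.
by rewrite vcons0.
Qed.

Lemma upd_vcons0 n X (T : 'I_n -> vfield M) Y :
  upd (vcons X T) ord0 Y = vcons Y T.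
Proof.
apply/funext => i; rewrite /upd; case: (unliftP ord0 i) => [j|] ->.
  by rewrite !vconsS.
by rewrite eqxx vcons0.
Qed.

Lemma upd_vconsS n X (T : 'I_n -> vfield M) Y j :
  upd (vcons X T) (lift ord0 j) Y = vcons X (upd T j Y).
Proof.
apply/funext => i; rewrite /upd; case: (unliftP ord0 i) => [i'|] ->.
  by rewrite !vconsS (inj_eq lift_inj).
by rewrite (negbTE (neq_lift _ _)) !vcons0.
Qed.

Lemma contractE n X (w : cochain M n.+1) T : contraction X w T = w (vcons X T).
Proof. by []. Qed.

(** The induction principle of the exterior calculus: an identity in degree n + 1 is checked after
    one contraction, whose rules bring it down to degree n, so that sums over permutations never
    appear. *)
Lemma cochain_ext n (w w' : cochain M n.+1) :
  (forall X, contraction X w = contraction X w') -> w = w'.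
Proof.
by move=> ww'; apply/funext => T; rewrite -(vcons_eta T) -!contractE ww'.
Qed.

Lemma dform_contract n X (w : cochain M n.+1) : dform w -> dform (contraction X w).
Proof.
case=> wl wa; split=> [T i f Y Z|T i j ij Tij].
  by rewrite !contractE -!upd_vconsS wl.
rewrite contractE; apply: (wa _ (lift ord0 i) (lift ord0 j)).
  by rewrite (inj_eq lift_inj).
by rewrite !vconsS.
Qed.

Lemma dform_lin n (w : cochain M n.+1) f Y Z : dform w ->
  contraction (f *: Y + Z) w = cscale f (contraction Y w) + contraction Z w.
Proof.
case=> wl _; apply/funext => T; rewrite contractE.
by rewrite -(upd_vcons0 0 T (f *: Y + Z)) wl !upd_vcons0.
Qed.

Lemma dform_alt n (w : cochain M n.+2) X : dform w ->
  contraction X (contraction X w) = 0.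
Proof.
case=> _ wa; apply/funext => T; rewrite !contractE.
apply: (wa _ ord0 (lift ord0 ord0)) => //.
by rewrite vconsS !vcons0.
Qed.

Lemma contract_sumlin n (w : cochain M n.+1) (I : Type) (r : seq I) (P : pred I)
    (f : I -> Cinf M) (Y : I -> vfield M) T : dform w ->
  contraction (\sum_(i <- r | P i) f i *: Y i) w T =
  \sum_(i <- r | P i) f i * contraction (Y i) w T.
Proof.
move=> dw; have c0 : contraction 0 w = 0.
  have := dform_lin 1 0 0 dw; rewrite scale1r addr0 => E.
  apply/funext => T'.
  have : contraction 0 w T' = 1 * contraction 0 w T' + contraction 0 w T'.
    by rewrite [in LHS]E.
  by rewrite -{1}[contraction _ _ _]add0r mul1r => /addIr.
elim/big_rec2: _ => [|i a b _ IH]; first by rewrite c0.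
by rewrite (dform_lin _ _ _ dw) -IH.
Qed.

Lemma contract_vfieldD n (w : cochain M n.+1) Y Z : dform w ->
  contraction (Y + Z) w = contraction Y w + contraction Z w.
Proof.
move=> dw; rewrite -{1}(scale1r Y) (dform_lin _ _ _ dw).
by congr (_ + _); apply/funext => T; exact: mul1r.
Qed.

(** Polarisation of iota_(X+Y) iota_(X+Y) w = 0. *)
Lemma contract_anti n (w : cochain M n.+2) X Y : dform w ->
  contraction X (contraction Y w) = - contraction Y (contraction X w).
Proof.
move=> dw; have := dform_alt (X + Y) dw.
rewrite (contract_vfieldD _ _ dw).
have D (u v : cochain M n.+1) Z : contraction Z (u + v) = contraction Z u + contraction Z v.
  by [].
rewrite D !(contract_vfieldD _ _ (dform_contract _ dw)) !dform_alt // add0r addr0.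
by move/eqP; rewrite addrC addr_eq0 => /eqP.
Qed.

Lemma dform_slot n (w : cochain M n.+1) (T : 'I_n.+1 -> vfield M) (j : 'I_n.+1) :
  dform w ->
  w T = (-1) ^+ j * contraction (T j) w (T \o lift j).
Proof.
elim: n w T j => [|n IH] w T j dw.
  by rewrite ord1 expr0 mul1r contractE vcons_eta.
case: (unliftP ord0 j) => [i|] ->; last by rewrite expr0 mul1r contractE vcons_eta.
rewrite -{1}(vcons_eta T) -contractE (IH _ _ i (dform_contract _ dw)).
rewrite (contract_anti _ _ dw) lift0 exprS mulN1r.
have -> (u : cochain M n) S : (- u) S = - u S by [].
rewrite mulrN mulNr; congr (- (_ * _)).
rewrite !contractE; congr (w (vcons _ _)).
by rewrite -{3}(vcons_eta T) vcons_liftS.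
Qed.

(** Alternation in two later slots is contained in the contraction being a form. For the first slot
    and a later one, [dform_slot] moves the later argument forward and leaves a double contraction
    with one field. The match drops that condition in degree 1, where no double contraction
    exists. *)
Lemma dform_intro n (w : cochain M n.+1) :
  (forall X, dform (contraction X w)) ->
  (forall f Y Z,
     contraction (f *: Y + Z) w = cscale f (contraction Y w) + contraction Z w) ->
  (match n return cochain M n.+1 -> Prop with
   | 0 => fun=> True
   | _.+1 => fun w => forall X, contraction X (contraction X w) = 0
   end w) -> dform w.
Proof.
move=> dc lw aw; split=> [T i f Y Z|].
  rewrite -(vcons_eta T); case: (unliftP ord0 i) => [j|] ->.
    by rewrite !upd_vconsS -!contractE; case: (dc (T ord0)) => ->.
  by rewrite !upd_vcons0 -!contractE lw.
have alt0 (T : 'I_n.+1 -> vfield M) j : T ord0 = T (lift ord0 j) -> w T = 0.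
  case: n w dc lw aw T j => [|n] w dc lw aw T j; first by case: j.
  move=> E; rewrite -(vcons_eta T) -contractE.
  rewrite (dform_slot _ j (dc _)).
  have -> : (T \o lift ord0) j = T ord0 by rewrite E.
  by rewrite aw mulr0.
move=> T i j; case: (unliftP ord0 i) => [i'|] ->; case: (unliftP ord0 j) => [j'|] ->.
- rewrite (inj_eq lift_inj) => ij E; rewrite -(vcons_eta T) -contractE.
  by have [_ /(_ (T \o lift ord0) _ _ ij)] := dc (T ord0); apply.
- by move=> _ E; exact: (alt0 _ i').
- by move=> _ E; exact: (alt0 _ j').
- by rewrite eqxx.
Qed.

End Forms.

Section FormOperations.
Variables (R : realType) (m : nat) (M : manifoldType R m).
Implicit Types (X Y Z : vfield M) (f g h : Cinf M).

(** The recursion is the antiderivation rule iota_X (th /\ w) = th(X) w - th /\ iota_X w, which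
    avoids shuffles. The factor [th] is a bare function on fields, so that df can be written
    directly as X |-> X f. *)
Fixpoint wedge (th : vfield M -> Cinf M) n : cochain M n -> cochain M n.+1 :=
  match n return cochain M n -> cochain M n.+1 with
  | 0 => fun w T => th (T ord0) * w (T \o lift ord0)
  | n'.+1 => fun w T => th (T ord0) * w (T \o lift ord0) -
      @wedge th n' (contraction (T ord0) w) (T \o lift ord0)
  end.

Definition lie X n (w : cochain M n) : cochain M n := fun T =>
  X (w T) - \sum_(i < n) w (upd T i (lie_bracket X (T i))).

Definition Cinf_linear (th : vfield M -> Cinf M) :=
  forall f X Y, th (f *: X + Y) = f * th X + th Y.

Definition closed1 (th : vfield M -> Cinf M) :=
  forall X Y, X (th Y) - Y (th X) = th (lie_bracket X Y).

Lemma cochain_addE n (w w' : cochain M n) T : (w + w') T = w T + w' T.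
Proof. by []. Qed.
Lemma cochain_oppE n (w : cochain M n) T : (- w) T = - w T.
Proof. by []. Qed.
Lemma cochain_subE n (w w' : cochain M n) T : (w - w') T = w T - w' T.
Proof. by []. Qed.
Lemma cochain_scaleE n a (w : cochain M n) T : (a *: w) T = a *: w T.
Proof. by []. Qed.
Lemma cochain_sumE n (I : Type) (r : seq I) (P : pred I) (F : I -> cochain M n) T :
  (\sum_(i <- r | P i) F i) T = \sum_(i <- r | P i) F i T.
Proof. by elim/big_rec2: _ => // i a b _ <-. Qed.

Lemma cscaleD n f (w w' : cochain M n) : cscale f (w + w') = cscale f w + cscale f w'.
Proof. by apply/funext => T; exact: mulrDr. Qed.

Lemma cscaleN n f (w : cochain M n) : cscale f (- w) = - cscale f w.
Proof. by apply/funext => T; exact: mulrN. Qed.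

Lemma cscaleDl n f g (w : cochain M n) : cscale (f + g) w = cscale f w + cscale g w.
Proof. by apply/funext => T; exact: mulrDl. Qed.

Lemma cscaleA n f g (w : cochain M n) : cscale f (cscale g w) = cscale (f * g) w.
Proof. by apply/funext => T; exact: mulrA. Qed.

Lemma scale_cscale n (a : R) (w : cochain M n) : a *: w = cscale (a *: (1 : Cinf M)) w.
Proof. by apply/funext => T; rewrite /cscale -CinfZAl mul1r. Qed.

Lemma contract_add X n (w w' : cochain M n.+1) :
  contraction X (w + w') = contraction X w + contraction X w'.
Proof. by []. Qed.

Lemma contract_opp X n (w : cochain M n.+1) : contraction X (- w) = - contraction X w.
Proof. by []. Qed.

Lemma contract_cscale X n f (w : cochain M n.+1) :
  contraction X (cscale f w) = cscale f (contraction X w).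
Proof. by []. Qed.

Lemma contract_sum X n (I : Type) (r : seq I) (P : pred I) (F : I -> cochain M n.+1) :
  contraction X (\sum_(i <- r | P i) F i) = \sum_(i <- r | P i) contraction X (F i).
Proof. by elim/big_rec2: _ => // i a b _ <-. Qed.

Lemma contract_wedge0 th X (w : cochain M 0) :
  contraction X (wedge th w) = cscale (th X) w.
Proof.
by apply/funext => T; rewrite contractE /= vcons0 vcons_lift0.
Qed.

Lemma contract_wedge th X n (w : cochain M n.+1) :
  contraction X (wedge th w) = cscale (th X) w - wedge th (contraction X w).
Proof.
by apply/funext => T; rewrite contractE /= vcons0 vcons_lift0.
Qed.

Lemma wedgeD th n (w w' : cochain M n) : wedge th (w + w') = wedge th w + wedge th w'.
Proof.
elim: n w w' => [|n IH] w w'; apply: cochain_ext => X.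
  by rewrite contract_add !contract_wedge0 cscaleD.
rewrite contract_add !contract_wedge cscaleD contract_add IH opprD.
exact: addrACA.
Qed.

Lemma wedge_cscale th n f (w : cochain M n) : wedge th (cscale f w) = cscale f (wedge th w).
Proof.
elim: n w => [|n IH] w; apply: cochain_ext => X.
  by rewrite contract_cscale !contract_wedge0 !cscaleA mulrC.
rewrite contract_cscale !contract_wedge cscaleD cscaleN !cscaleA mulrC.
by rewrite contract_cscale IH.
Qed.

Lemma wedge0 th n : wedge th (0 : cochain M n) = 0.
Proof. by apply: (addrI (wedge th 0)); rewrite -wedgeD !addr0. Qed.

Lemma wedgeN th n (w : cochain M n) : wedge th (- w) = - wedge th w.
Proof. by apply/eqP; rewrite -addr_eq0 -wedgeD addNr wedge0. Qed.

Lemma wedge_linl th th' f n (w : cochain M n) :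
  wedge (fun X => f * th X + th' X) w = cscale f (wedge th w) + wedge th' w.
Proof.
elim: n w => [|n IH] w; apply: cochain_ext => X.
  by rewrite contract_add contract_cscale !contract_wedge0 cscaleA cscaleDl.
rewrite contract_add contract_cscale !contract_wedge IH cscaleD cscaleN cscaleA.
by rewrite cscaleDl opprD addrACA.
Qed.

Lemma wedge0l n (w : cochain M n) : wedge (fun=> 0) w = 0.
Proof.
elim: n w => [|n IH] w; apply: cochain_ext => X.
  by rewrite contract_wedge0; apply/funext => T; exact: mul0r.
rewrite contract_wedge IH subr0; apply/funext => T; exact: mul0r.
Qed.

Lemma wedge_suml (I : Type) (r : seq I) (f : I -> Cinf M)
    (th : I -> vfield M -> Cinf M) n (w : cochain M n) :
  wedge (fun X => \sum_(i <- r) f i * th i X) w =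
  \sum_(i <- r) cscale (f i) (wedge (th i) w).
Proof.
elim: r => [|i r IH].
  rewrite big_nil -[RHS](wedge0l w); congr (wedge _ w).
  by apply/funext => X; rewrite big_nil.
rewrite big_cons -IH -wedge_linl; congr (wedge _ w).
by apply/funext => X; rewrite big_cons.
Qed.

Lemma Cinf_linear_sum (La : vfield M -> Cinf M) (I : Type) (r : seq I)
    (f : I -> Cinf M) (Z : I -> vfield M) : Cinf_linear La ->
  La (\sum_(i <- r) f i *: Z i) = \sum_(i <- r) f i * La (Z i).
Proof.
move=> lLa; have La0 : La 0 = 0.
  have := lLa 1 0 0; rewrite scale1r addr0 mul1r => h.
  by apply: (addrI (La 0)); rewrite -h addr0.
by elim/big_rec2: _ => [//|i a b _ IH]; rewrite lLa -IH.
Qed.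

Lemma dform_0 n : dform (0 : cochain M n).
Proof. by split=> // T i f Y Z; rewrite mulr0 addr0. Qed.

Lemma dformD n (w w' : cochain M n) : dform w -> dform w' -> dform (w + w').
Proof.
case=> wl wa [wl' wa']; split=> [T i f Y Z|T i j ij E].
  by rewrite !cochain_addE wl wl' mulrDr addrACA.
by rewrite cochain_addE (wa _ _ _ ij E) (wa' _ _ _ ij E) addr0.
Qed.

Lemma dform_cscale n f (w : cochain M n) : dform w -> dform (cscale f w).
Proof.
case=> wl wa; split=> [T i g Y Z|T i j ij E].
  by rewrite /cscale wl mulrDr mulrCA.
by rewrite /cscale (wa _ _ _ ij E) mulr0.
Qed.

Lemma dformN n (w : cochain M n) : dform w -> dform (- w).
Proof.
move=> /(dform_cscale (-1)); congr (dform _).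
by apply/funext => T; exact: mulN1r.
Qed.

Lemma dformB n (w w' : cochain M n) : dform w -> dform w' -> dform (w - w').
Proof. by move=> dw dw'; apply: dformD => //; exact: dformN. Qed.

Lemma dformZ n (a : R) (w : cochain M n) : dform w -> dform (a *: w).
Proof. by move=> dw; rewrite scale_cscale; exact: dform_cscale. Qed.

Lemma dform_sum n (I : Type) (r : seq I) (P : pred I) (F : I -> cochain M n) :
  (forall i, P i -> dform (F i)) -> dform (\sum_(i <- r | P i) F i).
Proof.
by move=> dF; elim/big_ind: _ => //; [exact: dform_0|exact: dformD].
Qed.

Lemma dform_cochain0 (w : cochain M 0) : dform w.
Proof. by split=> [T|T] []. Qed.

Lemma dform_wedge th n (w : cochain M n) : Cinf_linear th -> dform w ->
  dform (wedge th w).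
Proof.
move=> lth; elim: n w => [|n IH] w dw; apply: dform_intro => //.
- by move=> X; exact: dform_cochain0.
- by move=> f Y Z; rewrite !contract_wedge0 lth cscaleDl -cscaleA.
- move=> X; rewrite contract_wedge; apply: dformB; first exact: dform_cscale.
  by apply: IH; exact: dform_contract.
- move=> f Y Z; rewrite !contract_wedge lth (dform_lin _ _ _ dw).
  rewrite wedgeD wedge_cscale cscaleDl -cscaleA opprD addrACA; congr (_ + _).
  by rewrite -cscaleN -cscaleD.
- move=> X; rewrite contract_wedge contract_add contract_opp contract_cscale.
  case: n {IH} w dw => [|n] w dw; first by rewrite contract_wedge0 subrr.
  by rewrite contract_wedge dform_alt // wedge0 subr0 subrr.
Qed.

Lemma lie0E X (w : cochain M 0) T : lie X w T = X (w T).
Proof. by rewrite /lie big_ord0 subr0. Qed.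

Lemma contract_lie X Y n (w : cochain M n.+1) :
  contraction Y (lie X w) = lie X (contraction Y w) - contraction (lie_bracket X Y) w.
Proof.
apply/funext => T; rewrite contractE cochain_subE /lie big_ord_recl opprD.
rewrite upd_vcons0 vcons0 !contractE addrA addrAC; congr (_ - _ - _).
by apply: eq_bigr => i _; rewrite upd_vconsS vconsS.
Qed.

Lemma lieD X n (w w' : cochain M n) : lie X (w + w') = lie X w + lie X w'.
Proof.
apply/funext => T; rewrite /lie !cochain_addE vfieldD addrACA -opprD; congr (_ - _).
by rewrite -big_split.
Qed.

Lemma lie_cscale X n f (w : cochain M n) :
  lie X (cscale f w) = cscale (X f) w + cscale f (lie X w).
Proof.
apply/funext => T; rewrite cochain_addE /lie /cscale vfieldM mulrBr mulr_sumr.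
by rewrite addrA.
Qed.

Lemma lie_zero X n : lie X (0 : cochain M n) = 0.
Proof. by apply: (addrI (lie X 0)); rewrite -lieD !addr0. Qed.

Lemma lieN X n (w : cochain M n) : lie X (- w) = - lie X w.
Proof. by apply/eqP; rewrite -addr_eq0 -lieD addNr lie_zero. Qed.

Lemma dform_lie X n (w : cochain M n) : dform w -> dform (lie X w).
Proof.
elim: n w => [|n IH] w dw; first exact: dform_cochain0.
have dc Y := dform_contract Y dw.
apply: dform_intro.
- by move=> Y; rewrite contract_lie; apply: dformB => //; exact: IH.
- move=> f Y Z; rewrite !contract_lie (dform_lin _ _ _ dw) lieD lie_cscale.
  have -> : lie_bracket X (f *: Y + Z) =
      X f *: Y + (f *: lie_bracket X Y + lie_bracket X Z).
    by rewrite bracketDr bracketZr addrA.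
  rewrite !(dform_lin _ _ _ dw) -/(cscale f _) cscaleD cscaleN.
  by rewrite -(addrA (cscale (X f) _)) opprD addrACA subrr add0r opprD addrACA.
- case: n IH w dw dc => // n IH w dw dc Y.
  rewrite contract_lie contract_add contract_opp contract_lie.
  rewrite dform_alt // lie_zero sub0r (contract_anti _ (lie_bracket X Y) dw).
  by rewrite opprK addNr.
Qed.

Lemma contract_ext_d0 X (w : cochain M 0) : contraction X (ext_d w) = lie X w.
Proof.
apply/funext => T; rewrite contractE /ext_d big_ord_recl big_ord0 addr0 expr0 mul1r.
by rewrite big_ord0 addr0 lie0E vcons0 vcons_lift0.
Qed.

(* Cartan's formula; [contract_ext_d0] is the case of functions. *)
Lemma contract_ext_d X n (w : cochain M n.+1) : dform w ->
  contraction X (ext_d w) = lie X w - ext_d (contraction X w).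
Proof.
move=> dw; apply/funext => T; rewrite contractE /ext_d big_ord_recl expr0 mul1r.
rewrite vcons0 vcons_lift0 big_pred0 // addr0 cochain_subE /lie -addrA.
congr (_ + _); rewrite -!sumrN -big_split; apply: eq_bigr => j _ /=.
rewrite vcons_liftS vconsS /bump leq0n add1n exprS mulN1r mulNr mulrDr opprD.
rewrite [X in _ = _ - X]mulrDr [X in _ = _ + X]opprD.
have E i : vcons X T (lift (lift ord0 j) i) = vcons X (T \o lift j) i.
  by rewrite -[LHS]/((vcons X T \o lift (lift ord0 j)) i) vcons_liftS.
rewrite big_mkcond big_ord_recl /= E vcons0 upd_vcons0 mulrDr opprD addrCA.
congr (_ + _).
  rewrite [in RHS](dform_slot (upd T j _) j dw); congr (- (_ * w (vcons _ _))).
    by rewrite /upd eqxx.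
  by apply/funext => i; rewrite /= /upd eq_sym (negbTE (neq_lift _ _)).
congr (_ - (_ * _)).
rewrite [RHS]big_mkcond; apply: eq_bigr => i _.
by rewrite E vconsS upd_vconsS /bump /= !add1n ltnS.
Qed.

End FormOperations.

Ltac cochain_ring :=
  apply/funext => ?;
  rewrite /cscale ?(cochain_addE, cochain_oppE); ring.

Section Cartan.
Variables (R : realType) (m : nat) (M : manifoldType R m).
Implicit Types (X Y Z : vfield M) (f g h : Cinf M).

Lemma ext_dD n (w w' : cochain M n) : ext_d (w + w') = ext_d w + ext_d w'.
Proof.
apply/funext => T; rewrite cochain_addE /ext_d -big_split; apply: eq_bigr => j _ /=.
rewrite -mulrDr; congr (_ * _); rewrite cochain_addE vfieldD addrACA; congr (_ + _).
by rewrite -big_split.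
Qed.

Lemma ext_dZ n (a : R) (w : cochain M n) : ext_d (a *: w) = a *: ext_d w.
Proof.
apply/funext => T; rewrite cochain_scaleE /ext_d scaler_sumr; apply: eq_bigr => j _.
rewrite CinfZAr; congr (_ * _).
by rewrite cochain_scaleE vfieldZ scalerDr; congr (_ + _); rewrite scaler_sumr.
Qed.

Lemma ext_d0 n : ext_d (0 : cochain M n) = 0.
Proof. by rewrite -(scale0r 0) ext_dZ scale0r. Qed.

Lemma ext_dN n (w : cochain M n) : ext_d (- w) = - ext_d w.
Proof. by rewrite -scaleN1r ext_dZ scaleN1r. Qed.

Lemma ext_dB n (w w' : cochain M n) : ext_d (w - w') = ext_d w - ext_d w'.
Proof. by rewrite ext_dD ext_dN. Qed.

Lemma ext_d_sum n (I : Type) (r : seq I) (P : pred I) (F : I -> cochain M n) :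
  ext_d (\sum_(i <- r | P i) F i) = \sum_(i <- r | P i) ext_d (F i).
Proof.
by elim/big_rec2: _ => [|i a b _ <-]; [exact: ext_d0|exact: ext_dD].
Qed.

Lemma ext_d_cscale f n (w : cochain M n) : dform w ->
  ext_d (cscale f w) = wedge (fun X => X f) w + cscale f (ext_d w).
Proof.
elim: n w => [|n IH] w dw; apply: cochain_ext => X.
  by rewrite contract_add contract_cscale !contract_ext_d0 contract_wedge0 lie_cscale.
have dfw := dform_cscale f dw; have dc := dform_contract X dw.
rewrite contract_add contract_cscale !contract_ext_d // contract_wedge lie_cscale.
rewrite contract_cscale IH //.
cochain_ring.
Qed.

Lemma contract_vfield0 n (w : cochain M n.+1) : dform w -> contraction 0 w = 0.
Proof.
move=> dw; apply: (addrI (contraction 0 w)).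
by rewrite -contract_vfieldD // !addr0.
Qed.

Lemma contract_vfieldN X n (w : cochain M n.+1) : dform w ->
  contraction (- X) w = - contraction X w.
Proof.
by move=> dw; apply/eqP; rewrite -addr_eq0 -contract_vfieldD // addNr contract_vfield0.
Qed.

Lemma lie_linl0 f X Y (w : cochain M 0) :
  lie (f *: X + Y) w = cscale f (lie X w) + lie Y w.
Proof. by apply/funext => T; rewrite cochain_addE /cscale !lie0E. Qed.

(** The Lie derivative is not linear over functions in the field. The extra term df /\ iota_X w is
    the one that cancels the Leibniz term of d (f iota_X w) when Cartan's formula is used to show
    that dw is linear. *)
Lemma lie_linl f X Y n (w : cochain M n.+1) : dform w ->
  lie (f *: X + Y) w =
  cscale f (lie X w) + wedge (fun Z => Z f) (contraction X w) + lie Y w.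
Proof.
have brE Z : lie_bracket (f *: X + Y) Z =
    f *: lie_bracket X Z + ((- Z f) *: X + lie_bracket Y Z).
  rewrite bracketC bracketDr bracketZr (bracketC Z X) (bracketC Z Y) scalerN.
  by rewrite scaleNr !opprD !opprK addrA (addrC (f *: _)).
elim: n w => [|n IH] w dw; apply: cochain_ext => Z.
all: rewrite contract_lie 2!contract_add contract_cscale !contract_lie brE.
- rewrite !dform_lin // contract_wedge0 lie_linl0; cochain_ring.
- rewrite !dform_lin // contract_wedge IH; last exact: dform_contract.
  rewrite (contract_anti X Z dw) wedgeN; cochain_ring.
Qed.

Lemma bracketXX X : lie_bracket X X = 0.
Proof. by apply: vfield_ext => f; rewrite bracketE subrr. Qed.

(** Everything goes through Cartan's formula instead of Koszul's sum. For alternation, both terms of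
    iota_X (L_X w - d iota_X w) equal L_X iota_X w, because [X, X] = 0 and iota_X iota_X w = 0. *)
Lemma dform_ext_d n (w : cochain M n) : dform w -> dform (ext_d w).
Proof.
elim: n w => [|n IH] w dw; apply: dform_intro.
- by move=> X; exact: dform_cochain0.
- by move=> f Y Z; rewrite !contract_ext_d0; exact: lie_linl0.
- by [].
- move=> X; rewrite contract_ext_d //; apply: dformB; first exact: dform_lie.
  by apply: IH; exact: dform_contract.
- move=> f Y Z; rewrite !contract_ext_d // lie_linl // dform_lin //.
  rewrite ext_dD ext_d_cscale; last exact: dform_contract.
  cochain_ring.
- move=> X; rewrite contract_ext_d // contract_add contract_opp contract_lie.
  rewrite bracketXX contract_vfield0 // subr0.
  case: n {IH} w dw => [|n] w dw; first by rewrite contract_ext_d0 subrr.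
  rewrite contract_ext_d; last exact: dform_contract.
  by rewrite dform_alt // ext_d0 subr0 subrr.
Qed.

Lemma lie_lie_bracket X Y n (w : cochain M n) : dform w ->
  lie (lie_bracket X Y) w = lie X (lie Y w) - lie Y (lie X w).
Proof.
elim: n w => [|n IH] w dw.
  by apply/funext => T; rewrite cochain_subE !lie0E.
have dc Z := dform_contract Z dw.
apply: cochain_ext => Z; rewrite contract_add contract_opp !contract_lie IH //.
rewrite bracket_jacobi contract_vfieldD // contract_vfieldN // !lieD !lieN.
cochain_ring.
Qed.

Lemma lie_ext_d X n (w : cochain M n) : dform w -> lie X (ext_d w) = ext_d (lie X w).
Proof.
elim: n w => [|n IH] w dw; apply: cochain_ext => Y.
  rewrite contract_lie !contract_ext_d0 lie_lie_bracket // opprB addrC subrK //.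
have dc Z := dform_contract Z dw; have dl := dform_lie X dw.
rewrite contract_lie !contract_ext_d // lieD lieN IH // lie_lie_bracket //.
rewrite contract_lie ext_dB.
cochain_ring.
Qed.

(** Cartan's formula used twice, with d commuting with L_X, gives iota_X d d w = d d iota_X w, and
    the degree has dropped by one. *)
Lemma ext_d_ext_d n (w : cochain M n) : dform w -> ext_d (ext_d w) = 0.
Proof.
elim: n w => [|n IH] w dw; have dd := dform_ext_d dw; apply: cochain_ext => X.
  by rewrite contract_ext_d // contract_ext_d0 lie_ext_d // subrr.
rewrite !contract_ext_d // ext_dB IH ?subr0 ?lie_ext_d ?subrr //.
exact: dform_contract.
Qed.

Lemma lie_wedge X th n (w : cochain M n) :
  lie X (wedge th w) =
  wedge (fun Y => X (th Y) - th (lie_bracket X Y)) w + wedge th (lie X w).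
Proof.
elim: n w => [|n IH] w; apply: cochain_ext => Y.
  rewrite contract_lie contract_add !contract_wedge0 lie_cscale; cochain_ring.
rewrite contract_lie contract_add !contract_wedge lieD lieN lie_cscale IH.
rewrite contract_lie wedgeD wedgeN; cochain_ring.
Qed.

Lemma ext_d_wedge th n (w : cochain M n) : Cinf_linear th -> closed1 th -> dform w ->
  ext_d (wedge th w) = - wedge th (ext_d w).
Proof.
(* Closedness in the form L_X th = d (th X). *)
move=> lth cth; have E X : (fun Y => X (th Y) - th (lie_bracket X Y)) =
    (fun Y => Y (th X)).
  by apply/funext => Y; rewrite -cth opprB addrC subrK.
elim: n w => [|n IH] w dw; apply: cochain_ext => X.
  have dt := dform_wedge lth dw.
  rewrite contract_opp contract_ext_d // contract_wedge contract_wedge0 lie_wedge E.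
  rewrite ext_d_cscale // contract_ext_d0; cochain_ring.
have dt := dform_wedge lth dw; have dc := dform_contract X dw.
rewrite contract_opp contract_ext_d // !contract_wedge lie_wedge E.
rewrite ext_dB ext_d_cscale // IH // contract_ext_d // (wedgeD _ (lie X w)) wedgeN.
cochain_ring.
Qed.

End Cartan.

(** * Degeneration from closed connection forms *)

Section Roots.
Variables (R : fieldType) (V : lmodType R) (N : V -> V).
Hypothesis N_lin : forall a u v, N (a *: u + v) = a *: N u + N v.

Fixpoint kill (rs : seq R) (u : V) : V :=
  if rs is r :: rs' then kill rs' (N u - r *: u) else u.

Lemma linear_op0 : N 0 = 0.
Proof.
by have := N_lin 1 0 0; rewrite !scale1r addr0 => /esym/(canRL (addrK _)); rewrite subrr.
Qed.

Lemma linear_opB u r v : N (u - r *: v) = N u - r *: N v.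
Proof. by have := N_lin (- r) v u; rewrite !scaleNr ![- _ + _]addrC. Qed.

Lemma killC rs r u : kill rs (N u - r *: u) = N (kill rs u) - r *: kill rs u.
Proof.
elim: rs u => //= r' rs IH u; rewrite -IH; congr kill.
rewrite !linear_opB !scalerBr !scalerA (mulrC r') !opprB addrACA [RHS]addrACA.
by congr (_ + _); exact: addrC.
Qed.

Lemma kill_cat rs rs' u : kill (rs ++ rs') u = kill rs' (kill rs u).
Proof. by elim: rs u => //= r rs IH u; rewrite IH. Qed.

Lemma kill_stable (P : set V) rs u : (forall v, P v -> P (N v)) ->
  (forall a v w, P v -> P w -> P (a *: v + w)) -> P u -> P (kill rs u).
Proof.
move=> PN Pl; elim: rs u => //= r rs IH u Pu; apply: IH.
by rewrite addrC -scaleNr; apply: Pl => //; exact: PN.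
Qed.

End Roots.

(* The induction is on the number of roots, splitting off from each list a root x
   (resp. y): a = ((N a - y a) - (N a - x a)) / (x - y). *)
Lemma split_roots (R : fieldType) (V W : lmodType R) (N : V -> V) (N' : W -> W)
    (d : V -> W) (good F' : set V) (As Bs : seq R) (a : V) :
  (forall a u v, N (a *: u + v) = a *: N u + N v) ->
  (forall a u v, N' (a *: u + v) = a *: N' u + N' v) ->
  (forall a u v, d (a *: u + v) = a *: d u + d v) ->
  good 0 -> F' 0 ->
  (forall a v w, good v -> good w -> good (a *: v + w)) ->
  (forall a v w, F' v -> F' w -> F' (a *: v + w)) ->
  (forall v, good v -> good (N v)) -> (forall v, good v -> F' v -> F' (N v)) ->
  (forall v, good v -> d (N v) = N' (d v)) ->
  {in As & Bs, forall x y, x != y} ->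
  good a -> kill N' As (d a) = 0 -> F' (kill N Bs a) ->
  exists a', [/\ good a', d a' = 0 & F' (a - a')].
Proof.
move=> Nl N'l dl g0 F0 gl Fl gN FN dN.
have dB u r v : d (u - r *: v) = d u - r *: d v.
  by have := dl (- r) v u; rewrite !scaleNr ![- _ + _]addrC.
have d0 : d 0 = 0.
  by have := dl (-1) 0 0; rewrite scaler0 addr0 scaleN1r addNr.
have gB r u v : good u -> good v -> good (u - r *: v).
  by move=> gu gv; rewrite addrC -scaleNr; exact: gl.
(* Base cases: if [As] is empty, a is closed and a' = a; if [Bs] is empty, a already lies in F' and
   a' = 0. *)
elim: As Bs a => [|x As IHA] Bs a.
  by move=> _ ga /= da _; exists a; rewrite subrr.
elim: Bs a => [|y Bs IHB] a AB ga kA kB.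
  by exists 0; rewrite subr0.
have xy : x != y by apply: AB; rewrite mem_head.
(* N a - x a needs one root fewer in [As] and keeps [Bs] because F' is stable under N; N a - y a
   needs one root fewer in [Bs] and keeps the other list. *)
have [a1 [g1 d1 F1]] : exists a', [/\ good a', d a' = 0 & F' (N a - x *: a - a')].
  apply: (IHA (y :: Bs)).
  - by move=> u v uA vB; apply: AB => //; rewrite inE uA orbT.
  - by apply: gB => //; exact: gN.
  - by rewrite dB dN.
  - rewrite killC // addrC -scaleNr; apply: Fl => //; apply: FN => //.
    exact: kill_stable.
have [a2 [g2 d2 F2]] : exists a', [/\ good a', d a' = 0 & F' (N a - y *: a - a')].
  apply: IHB.
  - by move=> u v uA vB; apply: AB => //; rewrite inE vB orbT.
  - by apply: gB => //; exact: gN.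
  - by rewrite dB dN // killC // kA linear_op0 // scaler0 subr0.
  - exact: kB.
have xy0 : x - y != 0 by rewrite subr_eq0.
exists ((x - y)^-1 *: (- 1 *: a1 + a2)); split.
- by rewrite -[X in good X]addr0; apply: (gl) => //; exact: (gl).
- by rewrite -[X in d X]addr0 dl dl d1 d2 d0 !(scaler0, addr0).
have -> : a - (x - y)^-1 *: (- 1 *: a1 + a2) =
    (x - y)^-1 *: (- 1 *: (N a - x *: a - a1) + (N a - y *: a - a2)) + 0.
  have E : a = (x - y)^-1 *: ((x - y) *: a) by rewrite scalerA mulVf // scale1r.
  rewrite addr0 {1}E -scalerBr; congr (_ *: _).
  rewrite scalerBl !scaleN1r !opprB opprD opprK.
  move: (N a) (x *: a) (y *: a) => u v w.
  rewrite !addrA; congr (_ - a2).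
  by rewrite subrK addrC addrA.
by apply: (Fl) => //; exact: (Fl).
Qed.

#[local] Arguments Defs.contract : simpl never.
#[local] Arguments wedge : simpl never.
#[local] Arguments lie : simpl never.

(** * Number operators and their eigenvalues on the filtration *)

Section NumberOperators.
Variables (R : realType) (m : nat) (M : manifoldType R m).
Implicit Types (X Y Z : vfield M) (f g h : Cinf M).

(** The derivation of the exterior algebra induced by the endomorphism X |-> sum_i th_i(X) z_i; for
    dual th and z it counts the degree along the z_i. In degree 0 there is nothing to contract. *)
Definition numop (I : finType) (th : I -> vfield M -> Cinf M) (z : I -> vfield M)
    n : cochain M n -> cochain M n :=
  match n return cochain M n -> cochain M n with
  | 0 => fun=> 0
  | n'.+1 => fun w => \sum_i wedge (th i) (contraction (z i) w)
  end.

Section Family.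
Variables (I : finType) (th : I -> vfield M -> Cinf M) (z : I -> vfield M).
Hypothesis th_lin : forall i, Cinf_linear (th i).
Local Notation N := (numop th z).

Lemma numop_lin n (a : R) (u v : cochain M n) : N (a *: u + v) = a *: N u + N v.
Proof.
case: n u v => [|n] u v /=; first by rewrite scaler0 addr0.
rewrite scaler_sumr -big_split; apply: eq_bigr => i _ /=.
by rewrite !scale_cscale contract_add contract_cscale wedgeD wedge_cscale.
Qed.

Lemma numopD n (u v : cochain M n) : N (u + v) = N u + N v.
Proof. by have := numop_lin 1 u v; rewrite !scale1r. Qed.

Lemma numop0 n : N (0 : cochain M n) = 0.
Proof. exact: (linear_op0 (@numop_lin n)). Qed.

Lemma dform_numop n (w : cochain M n) : dform w -> dform (N w).
Proof.
case: n w => [|n] w dw /=; first exact: dform_0.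
by apply: dform_sum => i _; apply: dform_wedge => //; exact: dform_contract.
Qed.

(** Moving iota_X past th_i and past iota_(z_i) gives two signs that cancel, so only the contraction
    with sum_i th_i(X) z_i remains as commutator. All eigenvalues below are read off from it. *)
Lemma contract_numop X n (w : cochain M n.+1) : dform w ->
  contraction X (N w) =
  contraction (\sum_i th i X *: z i) w + N (contraction X w).
Proof.
move=> dw; have -> : contraction (\sum_i th i X *: z i) w =
    \sum_i cscale (th i X) (contraction (z i) w).
  apply/funext => T; rewrite contract_sumlin // cochain_sumE.
  by apply: eq_bigr.
rewrite /= contract_sum; case: n w dw => [|n] w dw /=.
  by rewrite addr0; apply: eq_bigr => i _; rewrite contract_wedge0.
rewrite -big_split; apply: eq_bigr => i _ /=.
by rewrite contract_wedge (contract_anti X _ dw) wedgeN opprK.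
Qed.

(** Passing d through th_i costs a sign because th_i is closed; passing it through iota_(z_i) costs
    another because L_(z_i) w = 0. *)
Lemma ext_d_numop n (w : cochain M n) :
  (forall i, closed1 (th i)) -> (forall i, lie (z i) w = 0) -> dform w ->
  ext_d (N w) = N (ext_d w).
Proof.
move=> cth lw dw; case: n w lw dw => [|n] w lw dw /=.
  rewrite ext_d0 big1 // => i _.
  by rewrite contract_ext_d0 lw wedge0.
rewrite ext_d_sum; apply: eq_bigr => i _.
rewrite ext_d_wedge //; last exact: dform_contract.
by rewrite contract_ext_d // lw sub0r wedgeN.
Qed.

End Family.

Section Vanishing.
Variable D : set (vfield M).
Local Notation cv := (contractions_vanish D).

(** After n contractions a function is left, and contracting a function gives 0 by definition. *)
Lemma cv_all n (w : cochain M n) : cv n.+1 w.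
Proof. by elim: n w => [|n IH] w X DX //=; exact: IH. Qed.

Lemma cv0 j n : cv j (0 : cochain M n).
Proof. by elim: j n => [|j IH] n //= X _; case: n => [|n]; exact: IH. Qed.

Lemma cv_S j n (w : cochain M n) : cv j w -> cv j.+1 w.
Proof.
elim: j n w => [|j IH] n w; first by move=> /= -> X _; case: n {w}.
by move=> h X DX; apply: IH; exact: h.
Qed.

Lemma cvD j n (u v : cochain M n) : cv j u -> cv j v -> cv j (u + v).
Proof.
elim: j n u v => [|j IH] n u v; first by move=> /= -> ->; rewrite addr0.
move=> hu hv X DX; case: n u v hu hv => [|n] u v hu hv; first exact: cv0.
by rewrite contract_add; apply: IH; [exact: hu|exact: hv].
Qed.

Lemma cv_cscale j n f (u : cochain M n) : cv j u -> cv j (cscale f u).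
Proof.
elim: j n u => [|j IH] n u.
  by move=> /= ->; apply/funext => T; exact: mulr0.
move=> hu X DX; case: n u hu => [|n] u hu; first exact: cv0.
by rewrite contract_cscale; apply: IH; exact: hu.
Qed.

Lemma cvZ j n (a : R) (u : cochain M n) : cv j u -> cv j (a *: u).
Proof. by rewrite scale_cscale; exact: cv_cscale. Qed.

Lemma cvN j n (u : cochain M n) : cv j u -> cv j (- u).
Proof. by move=> /(cvZ (-1)); rewrite scaleN1r. Qed.

Lemma cvB j n (u v : cochain M n) : cv j u -> cv j v -> cv j (u - v).
Proof. by move=> hu hv; apply: cvD => //; exact: cvN. Qed.

Section VanishingFamily.
Variables (I : finType) (th : I -> vfield M -> Cinf M) (z : I -> vfield M).
Hypothesis th_lin : forall i, Cinf_linear (th i).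
Hypothesis Dz : forall i, D (z i).
Local Notation N := (numop th z).

Lemma cv_numop j n (w : cochain M n) :
  (forall X, D X -> D (\sum_i th i X *: z i)) -> dform w -> cv j w -> cv j (N w).
Proof.
move=> DP; elim: j n w => [|j IH] n w dw.
  by move=> /= ->; exact: numop0.
case: n w dw => [|n] w dw hw X DX; first exact: cv0.
rewrite contract_numop //; apply: cvD; first by apply: hw; exact: DP.
by apply: IH; [exact: dform_contract|exact: hw].
Qed.

(** For X in [D] the commutator of iota_X and N vanishes, so j contractions move past N and leave
    th_i /\ iota_(z_i) of a form that one contraction kills. Such an N raises the filtration; this
    disposes of the basic corrections beta_i. *)
Lemma cv_numop_null j n (w : cochain M n) :
  (forall i X, D X -> th i X = 0) -> dform w -> cv j.+1 w -> cv j (N w).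
Proof.
move=> th0; elim: j n w => [|j IH] n w dw hw.
  case: n w dw hw => [|n] w dw hw //=.
  by rewrite big1 // => i _; rewrite (hw _ (Dz i)) wedge0.
case: n w dw hw => [|n] w dw hw X DX; first exact: cv0.
rewrite contract_numop // (_ : \sum_i th i X *: z i = 0); last first.
  by rewrite big1 // => i _; rewrite th0 // scale0r.
rewrite contract_vfield0 // add0r; apply: IH; first exact: dform_contract.
exact: hw.
Qed.

(** For X in [D] one has iota_X (N - (j + 1)) = (N - j) iota_X: each contraction lowers the
    eigenvalue by one, down to 0 on forms annihilated by [D]. *)
Lemma cv_numop_full j n (w : cochain M n) :
  (forall X, D X -> \sum_i th i X *: z i = X) -> dform w -> cv j.+1 w ->
  cv j (N w - j%:R *: w).
Proof.
move=> DP; elim: j n w => [|j IH] n w dw hw.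
  rewrite scale0r subr0; case: n w dw hw => [|n] w dw hw //=.
  by rewrite big1 // => i _; rewrite (hw _ (Dz i)) wedge0.
case: n w dw hw => [|n] w dw hw X DX; first exact: cv0.
have -> : contraction X (N w - j.+1%:R *: w) =
    N (contraction X w) - j%:R *: contraction X w.
  rewrite contract_add contract_opp contract_numop // DP //.
  have -> : contraction X (j.+1%:R *: w) = j.+1%:R *: contraction X w by [].
  rewrite -[j.+1]addn1 natrD scalerDl scale1r opprD addrACA addrC.
  by rewrite addrA subrK.
by apply: IH; [exact: dform_contract|exact: hw].
Qed.

End VanishingFamily.
End Vanishing.

Section Falling.
Variables (k : nat) (th : 'I_k -> vfield M -> Cinf M) (z : 'I_k -> vfield M).
Hypothesis th_lin : forall i, Cinf_linear (th i).
Hypothesis th_z : forall i j, th i (z j) = (i == j)%:R.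
Local Notation N := (numop th z).

(** The factors are r - N', with the sign opposite to [kill]: modulo the next filtration degree, N -
    (q - j) will become j - [N2]. *)
Fixpoint killr n (N' : cochain M n -> cochain M n) (rs : seq R) (u : cochain M n) :=
  if rs is r :: rs' then killr N' rs' (r *: u - N' u) else u.

Fixpoint falls n : seq R := if n is n'.+1 then n'%:R :: falls n' else [::].

Lemma killr_rcons n (N' : cochain M n -> cochain M n) rs r u :
  killr N' (rcons rs r) u = r *: killr N' rs u - N' (killr N' rs u).
Proof. by elim: rs u => //= s rs IH u; rewrite IH. Qed.

(** The list n, .., 0 opened at its end: the factor with root 0 is to act last, and the shift by 1
    matches the effect of a contraction on the other roots. *)
Lemma fallsS n : falls n.+1 = rcons [seq r + 1 | r <- falls n] 0.
Proof. by elim: n => //= n ->; rewrite -addn1 natrD. Qed.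

(** By duality iota_(z_i) N = (N + 1) iota_(z_i), so a factor (r + 1) - N turns into r - N. *)
Lemma contract_killr n rs i (w : cochain M n.+1) : dform w ->
  contraction (z i) (killr (@N n.+1) [seq r + 1 | r <- rs] w) =
  killr (@N n) rs (contraction (z i) w).
Proof.
elim: rs w => //= r rs IH w dw; rewrite IH; last first.
  by apply: dformB; [exact: dformZ|exact: (@dform_numop _ th z th_lin n.+1 w)].
congr killr; rewrite contract_add contract_opp.
have := contract_numop th z (z i) dw => /= ->.
have -> : \sum_j th j (z i) *: z j = z i.
  rewrite (bigD1 i) //= th_z eqxx scale1r big1 ?addr0 // => j ji.
  by rewrite th_z (negbTE ji) scale0r.
have -> : contraction (z i) ((r + 1) *: w) = r *: contraction (z i) w + contraction (z i) w.
  by rewrite -[X in _ = _ + X]scale1r -scalerDl.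
by rewrite opprD addrA addrK.
Qed.

(** The last factor is -N, each term of which starts with some iota_(z_i). This contraction slides
    through the other factors, lowers their roots by one, and leaves the same claim for j - 1. *)
Lemma killr_falls j n (w : cochain M n) : dform w ->
  contractions_vanish [set z i | i in setT] j w -> killr (@N n) (falls j) w = 0.
Proof.
elim: j n w => [|j IH] n w dw; first by [].
move=> hw; rewrite fallsS killr_rcons scale0r sub0r.
case: n w dw hw => [|n] w dw hw; first exact: oppr0.
rewrite /= big1 ?oppr0 // => i _; rewrite contract_killr // IH ?wedge0 //.
- exact: dform_contract.
- by apply: hw; exists i.
Qed.

(* Contractions anticommute, so k + 1 of them along k fields vanish. *)
Lemma cv_range n (w : cochain M n) : dform w ->
  contractions_vanish [set z i | i in setT] k.+1 w.
Proof.
(* [S] collects indices whose contractions already kill w. A further index either lies in [S] and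
   gives 0, or enlarges [S]. *)
suff : forall j n (w : cochain M n) (S : {set 'I_k}), (k - #|S| <= j)%N ->
    dform w -> (forall i, i \in S -> contraction (z i) w = 0) ->
    contractions_vanish [set z i | i in setT] j.+1 w.
  move=> H dw; apply: (H k _ w finset.set0 _ dw); first by rewrite cards0 subn0.
  by move=> i; rewrite finset.in_set0.
elim=> [|j IH] {}n {}w S; last first.
  move=> kS dw Sw _ [i _ <-].
  have [iS|iS] := boolP (i \in S); first by rewrite Sw //; exact: (cv0 _ j.+1).
  case: n w dw Sw => [|n] w dw Sw; first exact: (cv0 _ j.+1).
  apply: (IH _ _ (i |: S)%SET).
  - by move: kS; rewrite cardsU1 iS add1n !leq_subLR addSn addnS.
  - exact: dform_contract.
  - move=> i'; case: n w dw Sw => [|n] w dw Sw //.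
    rewrite finset.in_setU1 => /orP[/eqP ->|i'S]; first exact: dform_alt.
    by rewrite contract_anti // Sw //; exact: oppr0.
move=> kS dw Sw _ [i _ <-]; apply: Sw.
have -> : S = [set: 'I_k]%SET.
  apply/eqP; rewrite eqEcard finset.subsetT cardsT card_ord /=.
  by rewrite -subn_eq0 -leqn0.
by rewrite finset.in_setT.
Qed.

End Falling.
End NumberOperators.

Section RelatedForms.
Variables (R : realType) (m : nat) (M : manifoldType R m) (phi : M -> M).

(** A pair of forms is needed because contracting one invariant form with related fields X and Y
    leaves two different forms. *)
Definition related_forms n (w w' : cochain M n) :=
  forall X Y : 'I_n -> vfield M, (forall i, related phi (X i) (Y i)) ->
  forall x, w' Y (phi x) = w X x.

Lemma related_contract n (w w' : cochain M n.+1) X Y : related phi X Y ->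
  related_forms w w' -> related_forms (contraction X w) (contraction Y w').
Proof.
move=> XY ww' S T ST x; rewrite !contractE; apply: ww' => i.
by case: (unliftP ord0 i) => [j|] ->; rewrite ?vconsS ?vcons0.
Qed.

Lemma related_wedge (th : vfield M -> Cinf M) n (w w' : cochain M n) :
  (forall X Y, related phi X Y -> forall x, th Y (phi x) = th X x) ->
  related_forms w w' -> related_forms (wedge th w) (wedge th w').
Proof.
move=> thr; elim: n w w' => [|n IH] w w' ww' X Y XY x.
  have E (u : cochain M 0) T : wedge th u T = th (T ord0) * u (T \o lift ord0) by [].
  by rewrite !E !CinfME (thr _ _ (XY _)); congr (_ * _); apply: ww' => i; exact: XY.
have E (u : cochain M n.+1) T : wedge th u T = th (T ord0) * u (T \o lift ord0) -
  wedge th (contraction (T ord0) u) (T \o lift ord0) by [].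
rewrite !E !CinfBE !CinfME (thr _ _ (XY _)); congr (_ * _ - _).
  by apply: ww' => i; exact: XY.
by apply: IH => [|i]; [exact: related_contract|exact: XY].
Qed.

Lemma related_formsD n (u u' v v' : cochain M n) :
  related_forms u u' -> related_forms v v' -> related_forms (u + v) (u' + v').
Proof.
by move=> hu hv X Y XY x; rewrite !cochain_addE !CinfDE (hu _ _ XY) (hv _ _ XY).
Qed.

Lemma related_formsZ a n (u u' : cochain M n) :
  related_forms u u' -> related_forms (a *: u) (a *: u').
Proof. by move=> hu X Y XY x; rewrite !cochain_scaleE !CinfZE (hu _ _ XY). Qed.

Lemma related_numop (I : finType) (th : I -> vfield M -> Cinf M)
    (z : I -> vfield M) n (w w' : cochain M n) :
  (forall i X Y, related phi X Y -> forall x, th i Y (phi x) = th i X x) ->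
  (forall i, related phi (z i) (z i)) ->
  related_forms w w' -> related_forms (numop th z w) (numop th z w').
Proof.
case: n w w' => [|n] w w' thr zr ww' //=.
elim/big_ind2: _ => // [u u' v v'|i _]; first exact: related_formsD.
by apply: related_wedge; [exact: thr|exact: related_contract].
Qed.

End RelatedForms.

(** * The operator N of the closed forms theta_i, and the vanishing of d_r *)

Section Degeneration.
Variables (R : realType) (m : nat) (M : manifoldType R m).
Variables (s k : nat) (xi : 'I_s -> vfield M) (H : set (diffeo M)).
Variables (eta beta : 'I_s -> vfield M -> Cinf M).
Variables (C : 'M[R]_(s, k)) (E : 'M[R]_(k, s)).

Local Notation cst1 a := (a *: (1 : Cinf M)).
Local Notation D := (tangent_fields xi).
Local Notation cv := (contractions_vanish D).

Let phi b X := \sum_(j < s) cst1 (E b j) * eta j X.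
Let zeta b := \sum_(i < s) cst1 (C i b) *: xi i.
Let theta i X := eta i X - \sum_(b < k) cst1 (C i b) * phi b X - beta i X.

Hypothesis eta_lin : forall i, Cinf_linear (eta i).
Hypothesis beta_lin : forall i, Cinf_linear (beta i).
Hypothesis eta_xi : forall i j, eta i (xi j) = (i == j)%:R.
Hypothesis tangentE : forall X, D X -> \sum_i eta i X *: xi i = X.
Hypothesis beta_tangent : forall i X, D X -> beta i X = 0.
Hypothesis EC : E *m C = 1%:M.
Hypothesis theta_closed : forall i, closed1 (theta i).
Hypothesis theta_inv : forall i (f : diffeo M), H f -> forall X Y, related f X Y ->
  forall x, theta i Y (f x) = theta i X x.
Hypothesis xi_inv : forall i (f : diffeo M), H f -> related f (xi i) (xi i).
Hypothesis inv_lie : forall n (w : cochain M n) i, invariant_forms H w ->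
  lie (xi i) w = 0.

Lemma tangent_comb (I : finType) (f : I -> Cinf M) (z : I -> vfield M) :
  (forall i, D (z i)) -> D (\sum_i f i *: z i).
Proof.
move=> Dz x; have /choice[c hc] : forall i, exists c : 'I_s -> R,
  forall f, z i f x = \sum_(j < s) c j * xi j f x by move=> i; exact: Dz.
exists (fun j => \sum_i f i x * c i j) => g; rewrite vfield_sumE Cinf_sumE.
under eq_bigr do rewrite vfieldZE CinfME hc mulr_sumr.
rewrite exchange_big; apply: eq_bigr => j _ /=; rewrite mulr_suml.
by apply: eq_bigr => i _; rewrite mulrA.
Qed.

Lemma tangent_xi i : D (xi i).
Proof.
move=> x; exists (fun j => (i == j)%:R) => f.
rewrite (bigD1 i) //= eqxx mul1r big1 ?addr0 // => j ji.
by rewrite eq_sym (negbTE ji) mul0r.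
Qed.

Lemma sum_lin (I : finType) (f : I -> Cinf M) (th : I -> vfield M -> Cinf M) :
  (forall i, Cinf_linear (th i)) -> Cinf_linear (fun X => \sum_i f i * th i X).
Proof.
move=> lth g X Y; rewrite mulr_sumr -big_split; apply: eq_bigr => i _ /=.
by rewrite lth mulrDr mulrCA.
Qed.

Lemma phi_lin b : Cinf_linear (phi b).
Proof. exact: sum_lin. Qed.

Lemma theta_lin i : Cinf_linear (theta i).
Proof.
have sl := sum_lin (fun b => cst1 (C i b)) phi_lin.
by move=> f X Y; rewrite /theta eta_lin beta_lin sl; ring.
Qed.

Lemma cst1M a b : cst1 a * cst1 b = cst1 (a * b).
Proof. by rewrite -CinfZAl mul1r scalerA. Qed.

Lemma phi_zeta a b : phi a (zeta b) = (a == b)%:R.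
Proof.
have -> : (a == b)%:R = cst1 ((E *m C) a b).
  by rewrite EC mxE; case: eqP => _; rewrite ?scale1r ?scale0r.
rewrite /phi mxE scaler_suml; apply: eq_bigr => j _.
rewrite Cinf_linear_sum // (bigD1 j) //= eta_xi eqxx mulr1 big1 ?addr0 ?cst1M // => i ij.
by rewrite eta_xi eq_sym (negbTE ij) mulr0.
Qed.

Local Notation N := (numop theta xi).
Local Notation N2 := (numop phi zeta).

(** The coefficients C_ib may sit on the forms or on the fields. Moving them to the fields turns the
    s correction terms into the k-term operator [N2], so that k, and not s, bounds the number of
    roots. *)
Lemma numop_theta n (w : cochain M n) : dform w ->
  N w = numop eta xi w - N2 w - numop beta xi w.
Proof.
case: n w => [|n] w dw /=; first by rewrite !subr0.
have -> : \sum_(b < k) wedge (phi b) (contraction (zeta b) w) =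
    \sum_(i < s) \sum_(b < k) cscale (cst1 (C i b)) (wedge (phi b) (contraction (xi i) w)).
  rewrite exchange_big; apply: eq_bigr => b _ /=.
  have -> : contraction (zeta b) w = \sum_(i < s) cscale (cst1 (C i b)) (contraction (xi i) w).
    by apply/funext => T; rewrite contract_sumlin // cochain_sumE.
  elim/big_rec2: _ => [|i u v _ <-]; first exact: wedge0.
  by rewrite wedgeD wedge_cscale.
rewrite -!sumrB; apply: eq_bigr => i _; rewrite -wedge_suml.
have -> : theta i = fun X => (-1) * (fun X => 1 * beta i X +
     \sum_(b < k) cst1 (C i b) * phi b X) X + eta i X.
  by apply/funext => X; rewrite /theta; ring.
rewrite !wedge_linl; apply/funext => T.
rewrite /cscale ?(cochain_addE, cochain_oppE); ring.
Qed.

(* On [cv q.+1], which is the filtration degree n - q, the operator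
   sum_i eta_i /\ iota_(xi_i) is multiplication by q modulo the next degree, and
   [N2] has the eigenvalues 0, .., k by duality of [phi] and [zeta]. *)
Lemma N_step q j n (u : cochain M n) : dform u -> cv q.+1 u ->
  exists e, [/\ cv q e, dform e & N u - (q%:R - j) *: u = (j *: u - N2 u) + e].
Proof.
move=> du hu.
have dnu (th : 'I_s -> vfield M -> Cinf M) (lth : forall i, Cinf_linear (th i)) :
  dform (numop th xi u) by exact: dform_numop.
exists ((numop eta xi u - q%:R *: u) - numop beta xi u); split.
- apply: cvB; last by apply: cv_numop_null => //; exact: tangent_xi.
  by apply: cv_numop_full => //; exact: tangent_xi.
- by apply: dformB; [apply: dformB => //; [exact: dnu|exact: dformZ]|exact: dnu].
- rewrite numop_theta //; apply/funext => T.
  rewrite ?(cochain_addE, cochain_oppE, cochain_scaleE) scalerBl; ring.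
Qed.

Lemma tangent_zeta b : D (zeta b).
Proof. by apply: tangent_comb => i; exact: tangent_xi. Qed.

Lemma dform_N2 n (u : cochain M n) : dform u -> dform (N2 u).
Proof. by apply: dform_numop => b; exact: phi_lin. Qed.

Lemma cv_N2 j n (u : cochain M n) : dform u -> cv j u -> cv j (N2 u).
Proof.
move=> du; apply: cv_numop => // X _; exact: tangent_comb tangent_zeta.
Qed.

Lemma cv_killr q n rs (u : cochain M n) : dform u -> cv q u -> cv q (killr (@N2 n) rs u).
Proof.
elim: rs u => //= r rs IH u du hu; apply: IH.
  by apply: dformB; [exact: dformZ|exact: dform_N2].
by apply: cvB; [exact: cvZ|exact: cv_N2].
Qed.

Lemma N_lin n (a : R) (u v : cochain M n) : N (a *: u + v) = a *: N u + N v.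
Proof. exact: numop_lin. Qed.

Lemma killrD n rs (u v : cochain M n) :
  killr (@N2 n) rs (u + v) = killr (@N2 n) rs u + killr (@N2 n) rs v.
Proof.
elim: rs u v => //= r rs IH u v; rewrite -IH; congr killr.
by rewrite numopD scalerDr opprD addrACA.
Qed.

Lemma dform_N n (u : cochain M n) : dform u -> dform (N u).
Proof. by apply: dform_numop => i; exact: theta_lin. Qed.

Lemma cv_N j n (u : cochain M n) : dform u -> cv j u -> cv j (N u).
Proof.
move=> du; apply: cv_numop => // X _; exact: tangent_comb tangent_xi.
Qed.

(** Each factor agrees with its model up to an error already in the next filtration degree; the
    later factors preserve that degree, so the errors stay there. *)
Lemma kill_killr q n rs (u : cochain M n) : dform u -> cv q.+1 u ->
  cv q (kill (@N n) [seq q%:R - j | j <- rs] u - killr (@N2 n) rs u).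
Proof.
elim: rs u => [|r rs IH] u du hu /=; first by rewrite subrr; exact: cv0.
have [e [he de E1]] := N_step r du hu.
have du1 : dform (r *: u - N2 u).
  by apply: dformB; [exact: dformZ|exact: dform_N2].
have hu1 : cv q.+1 (r *: u - N2 u).
  by apply: cvB; [exact: cvZ|exact: cv_N2].
rewrite E1.
have : cv q (kill (@N n) [seq q%:R - j | j <- rs] (r *: u - N2 u + e) -
    killr (@N2 n) rs (r *: u - N2 u + e)).
  by apply: IH; [exact: dformD|apply: cvD => //; exact: cv_S].
move=> /cvD/(_ (cv_killr rs de he)); rewrite killrD opprD addrA subrK.
by [].
Qed.

Definition roots q : seq R := [seq q%:R - j | j <- falls R k.+1].
Arguments roots : simpl never.

Lemma kill_roots q n (u : cochain M n) : dform u -> cv q.+1 u ->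
  cv q (kill (@N n) (roots q) u).
Proof.
move=> du hu; have := kill_killr (falls R k.+1) du hu.
rewrite [killr _ _ u]killr_falls ?subr0 //.
- exact: phi_lin.
- exact: phi_zeta.
- exact: cv_range.
Qed.

Fixpoint all_roots q : seq R := if q is q'.+1 then roots q' ++ all_roots q' else [::].

(** Each block of roots moves the form one step up the filtration, lowering by one the number of
    contractions needed to kill it; at 0 the form itself vanishes. *)
Lemma kill_all_roots q n (u : cochain M n) : dform u -> cv q u ->
  kill (@N n) (all_roots q) u = 0.
Proof.
elim: q u => [|q IH] u du hu; first exact: hu.
have -> : all_roots q.+1 = roots q ++ all_roots q by [].
rewrite kill_cat.
apply: IH; last exact: kill_roots.
apply: (kill_stable (P := @dform _ _ _ n)) => //; first exact: dform_N.
- by move=> a v w dv dw; apply: dformD => //; exact: dformZ.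
Qed.

Lemma mem_falls x q : x \in falls R q -> exists2 j, (j < q)%N & x = j%:R.
Proof.
elim: q => //= q IH; rewrite inE => /orP[/eqP ->|/IH[j jq ->]]; first by exists q.
by exists j => //; exact: ltnW.
Qed.

Lemma mem_roots x q : x \in roots q ->
  exists2 j, (j <= k)%N & x = q%:R - j%:R.
Proof. by case/mapP => y /mem_falls[j jk ->] ->; exists j. Qed.

Lemma mem_all_roots x t : x \in all_roots t ->
  exists q j, [/\ (q < t)%N, (j <= k)%N & x = q%:R - j%:R].
Proof.
elim: t => // t IH.
have -> : all_roots t.+1 = roots t ++ all_roots t by [].
rewrite mem_cat => /orP[/mem_roots[j jk ->]|/IH[q [j [qt jk ->]]]].
  by exists t, j.
by exists q, j; split=> //; exact: ltnW.
Qed.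

Lemma inv_N n (w : cochain M n) : invariant_forms H w -> invariant_forms H (N w).
Proof.
case=> dw iw; split; first exact: dform_N.
move=> f Hf; apply: (@related_numop _ _ _ f) => [i X Y XY x|i|].
- exact: theta_inv.
- exact: xi_inv.
- exact: iw.
Qed.

Lemma inv_lin a n (u v : cochain M n) : invariant_forms H u ->
  invariant_forms H v -> invariant_forms H (a *: u + v).
Proof.
case=> du iu [dv iv]; split; first by apply: dformD => //; exact: dformZ.
move=> f Hf; apply: (@related_formsD _ _ _ f); last exact: iv.
by apply: related_formsZ; exact: iu.
Qed.

Lemma inv_0 n : invariant_forms H (0 : cochain M n).
Proof. by split; first exact: dform_0. Qed.

Local Notation F p n := (@fol_filtration R m M s xi H p n).
Local Notation Fil := (@fol_filtration R m M s xi H).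

(** At p = 0, where the filtration imposes nothing, the uniform count n + 1 - p is harmless: n + 1
    contractions kill every n-form. *)
Lemma filtrationP (p n : nat) (w : cochain M n) :
  F p%:Z n w <-> invariant_forms H w /\ cv (n.+1 - p) w.
Proof.
split=> [[iw hw]|[iw hw]]; split=> //.
by case: p hw => [|p] hw; [exact: cv_all|exact: hw].
Qed.

Lemma filtration_neg (p : int) n (w : cochain M n) : p <= 0 ->
  F p n w <-> invariant_forms H w.
Proof.
move=> p0; split=> [[]//|iw]; split=> // p1.
by have := lt_le_trans p1 p0; rewrite ltxx.
Qed.

Lemma filtration_lin a p n (u v : cochain M n) : F p n u -> F p n v ->
  F p n (a *: u + v).
Proof.
move=> [iu hu] [iv hv]; split; first exact: inv_lin.
by move=> p0; apply: cvD; [apply: cvZ; exact: hu|exact: hv].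
Qed.

Lemma filtrationD p n (u v : cochain M n) : F p n u -> F p n v -> F p n (u + v).
Proof. by move=> hu hv; have := filtration_lin 1 hu hv; rewrite scale1r. Qed.

Lemma filtrationB p n (u v : cochain M n) : F p n u -> F p n v -> F p n (u - v).
Proof.
by move=> hu hv; have := filtration_lin (-1) hv hu; rewrite scaleN1r addrC.
Qed.

Lemma filtration_0 p n : F p n (0 : cochain M n).
Proof. by split=> [|_]; [exact: inv_0|exact: cv0]. Qed.

Local Notation Cx := (fun r => ('I_r -> vfield M) -> Cinf M).
Local Notation d := (@ext_d R m M).

(* The roots of [N] on [a] modulo the next degree lie in [n - p - k, n - p], those
   on [ext_d a] are at most [n - p - r + 1]: for [k + 2 <= r] they are disjoint. *)
Lemma boundary_descends r p n (a : cochain M n) : (k + 2 <= r)%N ->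
  ssZ Cx d Fil r p n a -> exists2 b, F (p + 1) n b & ext_d b = ext_d a.
Proof.
move=> kr [Fa Fda].
(* For p < 0 both F^p and F^(p+1) contain every invariant form, so a itself serves as b. *)
case: (lerP 0 p) => p0; last first.
  exists a => //; apply/filtration_neg; last by case: Fa.
  by rewrite -ltzD1 ltrD2r.
case: p p0 Fa Fda => // p _ Fa Fda.
(* For p > n the filtration condition on a reads a = 0. *)
have [np|pn] := ltnP n p.
  have [_] := (filtrationP p a).1 Fa.
  have -> : (n.+1 - p = 0)%N by apply/eqP; rewrite subn_eq0.
  by move=> /= ->; exists 0 => //; exact: filtration_0.
have [ia ha] := (filtrationP p a).1 Fa.
have [[dda _] hda] := (filtrationP (p + r) (ext_d a)).1 Fda.
have FP (w : cochain M n) :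
    F (p%:Z + 1) n w <-> invariant_forms H w /\ cv (n - p) w.
  have -> : (p%:Z + 1) = (p + 1)%N%:Z by rewrite PoszD.
  by rewrite (_ : n - p = n.+1 - (p + 1))%N ?addn1 ?subSS //; exact: filtrationP.
have [a' [ia' da' Fa']] : exists a' : cochain M n,
    [/\ invariant_forms H a', ext_d a' = 0 & F (p%:Z + 1) n (a - a')].
  (* Having degree n + 1 and filtration p + r, [ext_d a] is killed by n + 2 - (p + r) contractions,
     hence by the roots of all orbit degrees below that number. For a itself a single block
     suffices, since reaching F^(p+1) is enough. *)
  apply: (@split_roots R _ _ (@N n) (@N n.+1) (@ext_d R m M n)
    (invariant_forms H (n := n)) (F (p%:Z + 1) n)
    (all_roots (n.+2 - (p + r))) (roots (n - p))) => //.
  - exact: N_lin.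
  - exact: N_lin.
  - by move=> c u v; rewrite ext_dD ext_dZ.
  - exact: inv_0.
  - exact: filtration_0.
  - by move=> c u v; exact: (@inv_lin c n u v).
  - by move=> c u v; exact: (@filtration_lin c (p%:Z + 1) n u v).
  - exact: inv_N.
  - move=> v iv /FP[_ hv]; apply/FP; split; first exact: inv_N.
    by apply: cv_N => //; case: iv.
  - move=> v iv; apply: ext_d_numop => //; last by case: iv.
    + by move=> i; exact: theta_lin.
    + by move=> i; exact: inv_lie.
  - move=> x y /mem_all_roots[q [j [qt jk ->]]] /mem_roots[j' j'k ->].
    apply/eqP => /(congr1 (fun t => t + j%:R + j'%:R)) /=.
    rewrite subrK [in RHS]addrAC subrK -!natrD => /eqP; rewrite eqr_nat => /eqP e.
    by move: qt jk kr pn e; lia.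
  - exact: kill_all_roots.
  - apply/FP; split; last by apply: kill_roots; [case: ia|rewrite -subSn].
    apply: (kill_stable (P := @invariant_forms R m M H n)) => //; first exact: inv_N.
    by move=> c u v; exact: (@inv_lin c n u v).
by exists (a - a') => //; rewrite ext_dB da' subr0.
Qed.

(** Since da = db with b in Z_(r-1) at filtration p + 1, and d of that group is a summand of B_r at
    filtration p + r, the class of da is zero. The rest is bookkeeping with cosets. *)
Theorem degeneration : degenerates_at Cx d Fil (k + 2).
Proof.
move=> [|r]; first by rewrite addn2.
move=> kr p n A [a Za AE].
have Zlin p' n' (u v : cochain M n') : ssZ Cx d Fil r p' n' u -> ssZ Cx d Fil r p' n' v ->
    ssZ Cx d Fil r p' n' (u + v).
  move=> [Fu Fdu] [Fv Fdv]; split; first exact: filtrationD.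
  by rewrite ext_dD; exact: filtrationD.
have [b Fb db] := boundary_descends kr Za.
have Zb : ssZ Cx d Fil r (p + 1) n b.
  split=> //; rewrite db; case: Za => _.
  by rewrite -addrA (_ : 1 + r%:Z = r.+1%:Z) // -PoszD add1n.
have ZbN : ssZ Cx d Fil r (p + 1) n (- b).
  have [F1 F2] := Zb; split; first by rewrite -[- b]add0r; exact: filtrationB (filtration_0 _ _) _.
  by rewrite ext_dN -[- ext_d b]add0r; exact: filtrationB (filtration_0 _ _) _.
(* The exact part of B_(r+1) at filtration p + r + 1 comes from filtration p + 1, which is where b
   lives. *)
have pr : p + r.+1%:Z - r%:Z = p + 1.
  by rewrite -addn1 PoszD (addrC r%:Z) addrA addrK.
have Z0 p' n' : ssZ Cx d Fil r p' n' 0.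
  by split; [exact: filtration_0|rewrite ext_d0; exact: filtration_0].
have B0 n' : ssB Cx d Fil r.+1 p n' 0.
  case: n' => [|n'].
    by exists 0 => //; exists 0 => //; exact: addr0.
  exists 0 => //; exists 0; last exact: addr0.
  by exists 0 => //; exact: ext_d0.
have dd (u : cochain M n) p' : F p' n u -> ext_d (ext_d u) = 0.
  by case=> -[du _] _; exact: ext_d_ext_d.
(* [ssd] runs over the whole coset of a. The exact part of an element of B_(r+1) dies under d, so
   its differential again comes from filtration p + 1. *)
have ddB (e : cochain M n) : ssB Cx d Fil r.+1 p n e ->
    exists2 e', ssZ Cx d Fil r (p + 1) n e' & ext_d e = ext_d e'.
  case: n {a Za AE b Fb db Zb ZbN} A e dd => [|n] A e dd [x Zx [y hy <-]].
    by exists x => //; rewrite hy addr0.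
  case: hy => z [[[dz _] _] _] <-; exists x => //.
  by rewrite ext_dD ext_d_ext_d ?addr0.
apply/seteqP; split=> [_ [a0 + [_ [x Zx [_ [y Zy <-]] <-] <-]]|e [x Zx [_ [y Zy <-]] <-]].
  rewrite -AE => -[e He <-].
  have [e' Ze' ->] : exists2 e', ssZ Cx d Fil r (p + 1) n e' & ext_d (a + e) = ext_d e'.
    have [e' Ze' ee'] := ddB _ He; exists (b + e'); first exact: Zlin.
    by rewrite !ext_dD db ee'.
  exists x => //; exists (ext_d (e' + y)); last by rewrite ext_dD addrCA.
  by exists (e' + y) => //; rewrite pr; apply: Zlin => //; rewrite -pr.
exists a.
  rewrite -AE; exists 0; last exact: addr0.
  exact: B0.
exists (x + ext_d (y - b)).
  exists x => //; exists (ext_d (y - b)) => //.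
  by exists (y - b) => //; rewrite pr; apply: Zlin => //; rewrite -pr.
by rewrite ext_dB db addrC -addrA subrK.
Qed.

End Degeneration.

(** * Smooth functions on row vectors *)

Section MeanValue.
Variables (R : realType) (V : normedModType R).
Implicit Types (f : V -> R) (x v : V).

Lemma line_quotient f x v (s h : R) :
  h^-1 *: (((fun t => f (x + t *: v)) \o shift s) (h *: 1) - f (x + s *: v)) =
  h^-1 *: ((f \o shift (x + s *: v)) (h *: v) - f (x + s *: v)).
Proof.
congr (_ *: (f _ - _)) => /=.
have -> : h *: (1 : R) = h by rewrite /GRing.scale /= mulr1.
by rewrite scalerDl addrCA.
Qed.

Lemma derivable_line f x v s : derivable f (x + s *: v) v ->
  is_derive s 1 (fun t => f (x + t *: v)) ('D_v f (x + s *: v)).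
Proof.
have E : (fun h : R => h^-1 *: (((fun t => f (x + t *: v)) \o shift s) (h *: 1) -
    f (x + s *: v))) =
  (fun h => h^-1 *: ((f \o shift (x + s *: v)) (h *: v) - f (x + s *: v))).
  by apply/funext => h; exact: line_quotient.
by move=> df; split; rewrite /derivable /derive E.
Qed.

Lemma mvt_line f x v (a : R) :
  (forall t, `|t| <= `|a| -> derivable f (x + t *: v) v) ->
  exists2 c, `|c| <= `|a| & f (x + a *: v) - f x = a * 'D_v f (x + c *: v).
Proof.
move=> df; pose phi t := f (x + t *: v).
have f0 : phi 0 = f x by rewrite /phi scale0r addr0.
case: (lerP 0 a) => a0.
  have tin (t : R) : t \in `[0, a] -> `|t| <= `|a|.
    by rewrite in_itv /= => /andP[t0 ta]; rewrite !ger0_norm.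
  have dt (t : R) : t \in `]0, a[ -> is_derive t 1 phi ('D_v f (x + t *: v)).
    move=> ti; apply: derivable_line; apply: df; apply: tin.
    by apply: subset_itv_oo_cc ti.
  have [|c ci E] := MVT_segment a0 dt.
    apply: derivable_within_continuous => t /tin ti.
    by have [] := derivable_line (df t ti).
  exists c; first exact: tin.
  by rewrite -f0 E subr0 mulrC.
have tin (t : R) : t \in `[a, 0] -> `|t| <= `|a|.
  rewrite in_itv /= => /andP[ta t0].
  by rewrite !ler0_norm ?(ltW a0) // lerN2.
have dt (t : R) : t \in `]a, 0[ -> is_derive t 1 phi ('D_v f (x + t *: v)).
  move=> ti; apply: derivable_line; apply: df; apply: tin.
  by apply: subset_itv_oo_cc ti.
have [|c ci E] := MVT_segment (ltW a0) dt.
  apply: derivable_within_continuous => t /tin ti.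
  by have [] := derivable_line (df t ti).
exists c; first exact: tin.
by apply/eqP; rewrite -eqr_opp opprB -f0 E sub0r mulrN mulrC.
Qed.

End MeanValue.

Section RowVectors.
Variables (R : realType) (m : nat).
Implicit Types (f : 'rV[R]_m -> R) (x y : 'rV[R]_m) (U : set 'rV[R]_m).

Lemma rV_norm_le x e : 0 <= e -> (forall j, `|x 0 j| <= e) -> `|x| <= e.
Proof.
move=> e0 xe; rewrite [leLHS]mx_normrE; apply/bigmax_leP; split=> // -[i j] _ /=.
by rewrite ord1.
Qed.

Lemma rV_norm_coord x j : `|x 0 j| <= `|x|.
Proof. by rewrite [leRHS]mx_normrE; apply: (le_bigmax _ _ (0, j)). Qed.

Definition rv_part (h : 'rV[R]_m) (i : nat) : 'rV[R]_m := \row_j (if (j < i)%N then h 0 j else 0).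

(** The segment from x to x + h is replaced by a path along coordinate edges, with the mean value
    theorem on each edge, since only partial derivatives are assumed to exist. *)
Lemma telescoped_mvt f x (h : 'rV[R]_m) :
  (forall y, (forall j, `|(y - x) 0 j| <= `|h 0 j|) ->
    forall i, derivable f y (delta_mx 0 i)) ->
  exists p : 'I_m -> 'rV[R]_m, (forall i, `|p i - x| <= `|h|) /\
    f (x + h) - f x = \sum_i h 0 i * partial i f (p i).
Proof.
move=> df.
have partS (i : 'I_m) : rv_part h i.+1 = rv_part h i + h 0 i *: delta_mx 0 i.
  apply/rowP => j; rewrite !mxE eqxx /= ltnS leq_eqVlt.
  have [->|ij] := eqVneq j i; first by rewrite eqxx ltnn /= mulr1 add0r.
  by rewrite (negbTE (ij : nat_of_ord j != i)) /= mulr0 addr0.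
have step (i : 'I_m) : exists p, `|p - x| <= `|h| /\
    f (x + rv_part h i.+1) - f (x + rv_part h i) = h 0 i * partial i f p.
  have box t : `|t| <= `|h 0 i| -> forall j,
      `|(x + rv_part h i + t *: delta_mx 0 i - x) 0 j| <= `|h 0 j|.
    move=> th j; rewrite -(addrA x) (addrC x) addrK !mxE eqxx /=.
    have [->|ij] := eqVneq j i; first by rewrite ltnn add0r mulr1.
    by rewrite mulr0 addr0; case: ifP; rewrite ?normr0.
  have [t th|c ch E] := @mvt_line R _ f (x + rv_part h i) (delta_mx 0 i) (h 0 i).
    by apply: df; exact: box.
  exists (x + rv_part h i + c *: delta_mx 0 i); split; last by rewrite partS addrA.
  apply: rV_norm_le => // j; apply: le_trans (box _ ch j) _.
  exact: rV_norm_coord.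
have /choice[p hp] := step.
exists p; split=> [i|]; first by case: (hp i).
have <- : \sum_(i < m) (f (x + rv_part h i.+1) - f (x + rv_part h i)) = f (x + h) - f x.
  rewrite -(big_mkord xpredT (fun i => f (x + rv_part h i.+1) - f (x + rv_part h i))).
  rewrite telescope_sumr //; congr (f _ - f _).
    by congr (_ + _); apply/rowP => j; rewrite mxE ltn_ord.
  by rewrite -[RHS]addr0; congr (_ + _); apply/rowP => j; rewrite !mxE.
by apply: eq_bigr => i _; case: (hp i).
Qed.

Lemma cvg_sum_fct (T : Type) (F : set_system T) {FF : Filter F} (I : Type) (r : seq I)
    (u : I -> T -> R) (l : I -> R) : (forall i, u i @ F --> l i) ->
  (fun t => \sum_(i <- r) u i t) @ F --> \sum_(i <- r) l i.
Proof.
move=> ul; elim: r => [|i r IH].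
  by rewrite big_nil (_ : (fun _ => _) = cst 0);
    [exact: cvg_cst|apply/funext => t; rewrite big_nil].
rewrite big_cons (_ : (fun _ => _) = u i \+ (fun t => \sum_(i <- r) u i t)).
  exact: cvgD.
by apply/funext => t; rewrite big_cons.
Qed.

(** The increment of F is fed to [telescoped_mvt]; the intermediate points tend to F x, where the
    partials of f are continuous. *)
Lemma chain_rule (W : normedModType R) f (F : W -> 'rV[R]_m) (x v : W) U :
  open U -> U (F x) ->
  (forall y, U y -> forall i, derivable f y (delta_mx 0 i)) ->
  (forall i, {for F x, continuous (partial i f)}) ->
  (forall j, derivable (fun y : W => F y 0 j) x v) ->
  derivable (f \o F) x v /\
  'D_v (f \o F) x = \sum_j partial j f (F x) * 'D_v (fun y : W => F y 0 j) x.
Proof.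
move=> oU UFx df cf dF.
have [r r0 rU] : exists2 r, 0 < r & ball (F x) r `<=` U.
  by have /nbhs_ballP[r r0 rU] : nbhs (F x) U by [exact: open_nbhs_nbhs]; exists r.
pose dl (h : R) : 'rV[R]_m := F (h *: v + x) - F x.
(* For large increments the point F x is a placeholder that keeps [p] total. *)
have : forall h : R, exists p : 'I_m -> 'rV[R]_m, (forall i, `|p i - F x| <= `|dl h|) /\
    (`|dl h| < r -> f (F x + dl h) - f (F x) = \sum_i dl h 0 i * partial i f (p i)).
  move=> h; have [dlr|dlr] := ltP `|dl h| r; last first.
    by exists (fun=> F x); split=> // i; rewrite subrr normr0.
  have [y yx i|p [p1 p2]] := @telescoped_mvt f (F x) (dl h); last by exists p; split.
  apply: df; apply: rU; rewrite -ball_normE /= -normrN opprB.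
  apply: le_lt_trans dlr; apply: rV_norm_le => // j.
  exact: le_trans (yx j) (rV_norm_coord _ _).
move=> /choice[p hp].
have dlj j : (fun h => h^-1 * dl h 0 j) @ 0^' --> 'D_v (fun y : W => F y 0 j) x.
  have := dF j; rewrite /derivable /derive => dFj.
  apply: cvg_trans dFj; apply: near_eq_cvg; near=> h.
  by rewrite /dl /= !mxE.
have dl0 j : (fun h => dl h 0 j) @ 0^' --> (0 : R).
  rewrite -[X in _ --> X](mul0r ('D_v (fun y : W => F y 0 j) x)).
  have id0 : (fun h : R => h) @ 0^' --> (0 : R) by exact: nbhs_dnbhs.
  apply: cvg_trans (cvgM id0 (dlj j)); apply: near_eq_cvg; near=> h.
  have h0 : h != 0 by near: h; exact: nbhs_dnbhs_neq.
  by rewrite /= mulrA divff // mul1r.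
have dlc e : 0 < e -> \forall h \near 0^', `|dl h| <= e.
  move=> e0; have : \forall h \near 0^', forall j, `|dl h 0 j| <= e.
    by apply: filter_forall => j; move/cvgr0_norm_le: (dl0 j); apply.
  by apply: filterS => h; apply: rV_norm_le; exact: ltW.
have pc i : (fun h => p h i) @ 0^' --> F x.
  apply/cvgrPdist_le => e e0; apply: filterS (dlc e e0) => h; apply: le_trans.
  by rewrite distrC; case: (hp h) => ->.
have main : (fun h => h^-1 *: ((f \o F \o shift x) (h *: v) - (f \o F) x)) @ 0^' -->
   \sum_j partial j f (F x) * 'D_v (fun y : W => F y 0 j) x.
  have lim_sum : (fun h => \sum_j partial j f (p h j) * (h^-1 * dl h 0 j)) @ 0^' -->
     \sum_j partial j f (F x) * 'D_v (fun y : W => F y 0 j) x.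
    apply: cvg_sum_fct => j; apply: cvgM => //.
    exact: (cvg_comp (fun h => p h j) (partial j f) (pc j) (cf j)).
  apply: cvg_trans lim_sum; apply: near_eq_cvg; near=> h.
  have dlr : `|dl h| < r.
    near: h; have r2 : 0 < r / 2 by rewrite divr_gt0.
    apply: filterS (dlc _ r2) => h /le_lt_trans; apply.
    by rewrite ltr_pdivrMr // ltr_pMr // ltr1n.
  have [_ /(_ dlr)] := hp h.
  have -> : F x + dl h = F (h *: v + x) by rewrite /dl addrC subrK.
  move=> /= ->; rewrite scaler_sumr; apply: eq_bigr => j _.
  by rewrite -[RHS]/(h^-1 * (dl h 0 j * _)) [RHS]mulrA [LHS]mulrC.
by split; [apply/cvg_ex; eexists; exact: main|exact/cvg_lim].
Unshelve. all: by end_near. Qed.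

Lemma open_norm_ball x (r : R) : open [set y | `|y - x| < r].
Proof.
rewrite (_ : [set y | _] = ball x r); first exact: ball_open.
by apply/seteqP; split=> y /=; rewrite -ball_normE /= distrC.
Qed.

End RowVectors.

Section SmoothOn.
Variables (R : realType) (m : nat).
Implicit Types (f g : 'rV[R]_m -> R) (U V : set 'rV[R]_m).

Lemma partials_rcons_eq l i f : partials (rcons l i) f = partials l (partial i f).
Proof. by rewrite /partials foldr_rcons. Qed.

Lemma smooth_on_partial U f i : smooth_on U f -> smooth_on U (partial i f).
Proof. by move=> h l x Ux; rewrite -partials_rcons_eq; exact: h. Qed.

Lemma smooth_on_cont U f x : smooth_on U f -> U x -> {for x, continuous f}.
Proof. by move=> h Ux; case: (h [::] x Ux). Qed.

Lemma smooth_on_derivable U f x i : smooth_on U f -> U x ->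
  derivable f x (delta_mx 0 i).
Proof. by move=> h Ux; case: (h [::] x Ux). Qed.

Lemma smooth_on_subset U V f : V `<=` U -> smooth_on U f -> smooth_on V f.
Proof. by move=> VU h l x Vx; apply: h; exact: VU. Qed.

(** A class closed under partial derivatives supplies all iterated partials by induction on the list
    of directions. Equality on U is enough because U is open. *)
Lemma smooth_on_class (P : set ('rV[R]_m -> R)) U : open U ->
  (forall h, P h -> forall x, U x -> {for x, continuous h} /\
    forall i, derivable h x (delta_mx 0 i)) ->
  (forall h i, P h -> exists2 h', P h' & forall x, U x -> partial i h x = h' x) ->
  forall h, P h -> smooth_on U h.
Proof.
move=> oU hc hp h Ph l.
have nearU x : U x -> \forall z \near x, U z.
  by move=> Ux; exact: (open_nbhs_nbhs (conj oU Ux)).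
have [h' Ph' hh'] : exists2 h', P h' & forall x, U x -> partials l h x = h' x.
  elim: l => [|i l [h1 Ph1 hh1]]; first by exists h.
  have [h2 Ph2 hh2] := hp h1 i Ph1; exists h2 => // x Ux; rewrite -hh2 //=.
  by apply: near_eq_derive; apply: filterS (nearU _ Ux) => z; exact: hh1.
move=> x Ux; have [ch dh] := hc _ Ph' x Ux.
have nE : {near x, h' =1 partials l h}.
  by apply: filterS (nearU _ Ux) => z /hh' ->.
split=> [|i]; last exact: near_eq_derivable nE (dh i).
rewrite /prop_for /continuous_at hh' //.
exact: cvg_trans (near_eq_cvg nE) ch.
Qed.

Lemma smooth_on_eq U f g : open U -> (forall x, U x -> f x = g x) ->
  smooth_on U f -> smooth_on U g.
Proof.
move=> oU fg sf.
have nearU x : U x -> \forall z \near x, U z.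
  by move=> Ux; exact: (open_nbhs_nbhs (conj oU Ux)).
apply: (@smooth_on_class [set h | exists2 f', smooth_on U f' & forall x, U x -> f' x = h x])
    => //; last by exists f.
  move=> h [f' sf' f'h] x Ux; have nE : {near x, f' =1 h}.
    by apply: filterS (nearU _ Ux) => z; exact: f'h.
  split=> [|i]; last first.
    by apply: (near_eq_derivable nE); exact: (smooth_on_derivable sf' Ux).
  rewrite /prop_for /continuous_at -f'h //.
  exact: cvg_trans (near_eq_cvg nE) (smooth_on_cont sf' Ux).
move=> h i [f' sf' f'h]; exists (partial i f').
  by exists (partial i f') => //; exact: smooth_on_partial.
move=> x Ux; apply/esym; apply: near_eq_derive.
by apply: filterS (nearU _ Ux) => z; exact: f'h.
Qed.

Lemma smooth_on_local U f :
  (forall x, U x -> exists V g, [/\ open V, V x, smooth_on V g &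
     forall y, V y -> g y = f y]) -> smooth_on U f.
Proof.
by move=> h l x /h[V [g [oV Vx sg gf]]]; exact: (smooth_on_eq oV gf sg).
Qed.

Lemma smooth_on_sum U (I : Type) (r : seq I) (f : I -> 'rV[R]_m -> R) : open U ->
  (forall i, smooth_on U (f i)) -> smooth_on U (fun y => \sum_(i <- r) f i y).
Proof.
move=> oU sf; elim: r => [|i r IH].
  by rewrite (_ : (fun _ => _) = cst 0); [exact: smooth_on_cst|
    apply/funext => y; rewrite big_nil].
rewrite (_ : (fun _ => _) = f i + (fun y => \sum_(i <- r) f i y)).
  exact: smooth_onD.
by apply/funext => y; rewrite big_cons.
Qed.

Lemma is_derive_coord (x v : 'rV[R]_m) j : is_derive x v (fun y => y 0 j) (v 0 j).
Proof.
have E : \forall h \near (0 : R)^', v 0 j =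
    h^-1 *: (((fun y : 'rV[R]_m => y 0 j) \o shift x) (h *: v) - x 0 j).
  near=> h; have h0 : h != 0 by near: h; exact: nbhs_dnbhs_neq.
  by rewrite /= !mxE addrK /GRing.scale /= mulrA mulVf // mul1r.
have L : (fun h : R => h^-1 *: (((fun y : 'rV[R]_m => y 0 j) \o shift x) (h *: v)
    - x 0 j)) @ 0^' --> v 0 j.
  exact: cvg_trans (near_eq_cvg E) (cvg_cst _).
by split; [apply/cvg_ex; exists (v 0 j)|exact/cvg_lim].
Unshelve. all: by end_near. Qed.

Lemma smooth_on_coord U j : open U -> smooth_on U (fun y => y 0 j).
Proof.
move=> oU; apply: (@smooth_on_class [set h : 'rV[R]_m -> R | h = (fun y => y 0 j) \/
    exists a, h = cst a] U) => //; last by left.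
  move=> h [->|[a ->]] x Ux; split=> [|i].
  - exact: coord_continuous.
  - by have [] := is_derive_coord x (delta_mx 0 i) j.
  - exact: cst_continuous.
  - exact: derivable_cst.
move=> h i [->|[a ->]].
  exists (cst ((delta_mx 0 i : 'rV[R]_m) 0 j)).
    by right; exists ((delta_mx 0 i : 'rV[R]_m) 0 j).
  by move=> x _; have [_] := is_derive_coord x (delta_mx 0 i) j.
by exists (cst 0); [right; exists 0|move=> x _; exact: derive_cst].
Qed.

Lemma cvg_rV (T : Type) (G : set_system T) {FG : Filter G} (F : T -> 'rV[R]_m)
    (l : 'rV[R]_m) :
  (forall j, (fun t => F t 0 j) @ G --> l 0 j) -> F @ G --> l.
Proof.
move=> Fl; apply/cvgrPdist_le => e e0.
have : \forall t \near G, forall j, `|l 0 j - F t 0 j| <= e.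
  by apply: filter_forall => j; move/cvgrPdist_le: (Fl j); apply.
apply: filterS => t h; apply: rV_norm_le; first exact: ltW.
by move=> j; rewrite !mxE.
Qed.

Lemma norm_delta i : `|delta_mx 0 i : 'rV[R]_m| <= 1.
Proof.
by apply: rV_norm_le => // j; rewrite mxE eqxx /=; case: (_ == _); rewrite ?normr1 ?normr0.
Qed.

Lemma derivable_shift f (x w v : 'rV[R]_m) : derivable f (x + w) v ->
  derivable (f \o shift w) x v /\ 'D_v (f \o shift w) x = 'D_v f (x + w).
Proof.
have E : (fun h : R => h^-1 *: (((f \o shift w) \o shift x) (h *: v) - (f \o shift w) x)) =
   (fun h => h^-1 *: ((f \o shift (x + w)) (h *: v) - f (x + w))).
  by apply/funext => h /=; rewrite addrA.
by move=> df; rewrite /derivable /derive E.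
Qed.

Lemma second_difference f (x : 'rV[R]_m) (r : R) i j :
  (forall y, `|y - x| < r -> derivable f y (delta_mx 0 i) /\
     derivable (partial i f) y (delta_mx 0 j)) ->
  forall t : R, `|t| + `|t| < r -> exists2 p, `|p - x| <= `|t| + `|t| &
    f (x + t *: delta_mx 0 i + t *: delta_mx 0 j) - f (x + t *: delta_mx 0 i)
    - (f (x + t *: delta_mx 0 j) - f x) = t * (t * partial j (partial i f) p).
Proof.
move=> df t tr; set ei : 'rV[R]_m := delta_mx 0 i; set ej : 'rV[R]_m := delta_mx 0 j.
have close (c c' : R) : `|c| <= `|t| -> `|c'| <= `|t| ->
    `|x + c *: ei + c' *: ej - x| <= `|t| + `|t|.
  move=> ct c't; rewrite -(addrA x) (addrC x) addrK.
  apply: le_trans (ler_normD _ _) _; apply: lerD; rewrite normrZ.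
    by apply: le_trans ct; rewrite ler_piMr // norm_delta.
  by apply: le_trans c't; rewrite ler_piMr // norm_delta.
have close' (c : R) : `|c| <= `|t| -> `|x + c *: ei - x| <= `|t| + `|t|.
  by move=> ct; have := close c 0 ct; rewrite normr0 scale0r addr0; exact.
have dpsi (c : R) : `|c| <= `|t| ->
    derivable (f \o shift (t *: ej) - f) (x + c *: ei) ei /\
    'D_ei (f \o shift (t *: ej) - f) (x + c *: ei) =
     partial i f (x + c *: ei + t *: ej) - partial i f (x + c *: ei).
  move=> ct; have [d1 _] := df _ (le_lt_trans (close' c ct) tr).
  have [d2 _] := df _ (le_lt_trans (close c t ct (lexx _)) tr).
  have [d3 d4] := derivable_shift d2.
  by split; [exact: (derivableB d3 d1)|rewrite (deriveB d3 d1) d4].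
have [s st|c ct E] := @mvt_line R _ (f \o shift (t *: ej) - f) x ei t.
  by case: (dpsi s st).
have [s st|c' c't E'] := @mvt_line R _ (partial i f) (x + c *: ei) ej t.
  by have [_] := df _ (le_lt_trans (close c s ct st) tr).
exists (x + c *: ei + c' *: ej); first exact: close.
by rewrite -E' -(dpsi c ct).2 -E.
Qed.

(** The second difference is symmetric in i and j, so the two mixed partials agree at two points as
    close to x as desired, and both are continuous at x. *)
Lemma partialC U f (x : 'rV[R]_m) i j : open U -> smooth_on U f -> U x ->
  partial i (partial j f) x = partial j (partial i f) x.
Proof.
move=> oU sf Ux; apply/eqP; rewrite -subr_eq0 -normr_le0; apply/ler_addgt0Pl => e e0; rewrite addr0.
have sij a b : smooth_on U (partial a (partial b f)).
  by apply: smooth_on_partial; exact: smooth_on_partial.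
have near_cont a b : \forall y \near x,
    `|partial a (partial b f) x - partial a (partial b f) y| <= e / 2.
  have /cvgrPdist_le := smooth_on_cont (sij a b) Ux; apply.
  by rewrite divr_gt0.
have : \forall y \near x, [/\ U y,
    `|partial i (partial j f) x - partial i (partial j f) y| <= e / 2 &
    `|partial j (partial i f) x - partial j (partial i f) y| <= e / 2].
  have nU := open_nbhs_nbhs (conj oU Ux).
  apply: filterS (filterI nU (filterI (near_cont i j) (near_cont j i))) => y.
  by case=> Uy [h1 h2]; split.
move=> /nbhs_ballP[r /= r0 hr].
have rP y : `|y - x| < r -> ball x r y by rewrite -ball_normE /= distrC.
have df a b y : `|y - x| < r -> derivable f y (delta_mx 0 a) /\
     derivable (partial a f) y (delta_mx 0 b).
  move=> /rP /hr[Uy _ _]; split; first exact: smooth_on_derivable sf Uy.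
  exact: smooth_on_derivable (smooth_on_partial _ sf) Uy.
pose t := r / 4.
have t0 : 0 < t by rewrite divr_gt0.
have tr : `|t| + `|t| < r by rewrite gtr0_norm // /t; lra.
have [p px Ep] := second_difference (df i j) tr.
have [q qx Eq] := second_difference (df j i) tr.
have pq : partial j (partial i f) p = partial i (partial j f) q.
  apply: (mulfI (lt0r_neq0 t0)); apply: (mulfI (lt0r_neq0 t0)).
  rewrite -Ep -Eq !opprB (addrAC x); ring.
have [_ _ hp] := hr _ (rP _ (le_lt_trans px tr)).
have [_ hq _] := hr _ (rP _ (le_lt_trans qx tr)).
have -> : partial i (partial j f) x - partial j (partial i f) x =
    (partial i (partial j f) x - partial i (partial j f) q) -
    (partial j (partial i f) x - partial j (partial i f) p).
  by rewrite pq opprB addrA subrK.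
apply: le_trans (ler_normB _ _) _; have -> : e = e / 2 + e / 2 by exact: splitr.
exact: lerD hq hp.
Qed.

Lemma locally_constant f (x : 'rV[R]_m) (r : R) :
  (forall y, `|y - x| < r -> forall i, derivable f y (delta_mx 0 i) /\
    partial i f y = 0) ->
  forall y, `|y - x| < r -> f y = f x.
Proof.
move=> df y yx.
have [z zx i|p [px E]] := @telescoped_mvt _ _ f x (y - x).
  have [] := df z _ i => //; apply: le_lt_trans yx; apply: rV_norm_le => // j.
  exact: le_trans (zx j) (rV_norm_coord _ _).
apply/eqP; rewrite -subr_eq0 -{1}(subrK x y) (addrC _ x) E big1 // => i _.
by have [_ ->] := df _ (le_lt_trans (px i) yx) i; rewrite mulr0.
Qed.

End SmoothOn.

(** * Smoothness of composites *)

Section Composition.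
Variables (R : realType) (m n : nat).
Variables (U : set 'rV[R]_n) (V : set 'rV[R]_m) (F : 'rV[R]_n -> 'rV[R]_m).
Hypotheses (oU : open U) (oV : open V) (sF : smooth_on_rV U F).
Hypothesis UV : forall x, U x -> V (F x).

Lemma smooth_map_cont x : U x -> {for x, continuous F}.
Proof.
move=> Ux; apply: (@cvg_rV _ _ _ (nbhs x) _) => j.
exact: (smooth_on_cont (sF j) Ux).
Qed.

Lemma partial_comp f x i : smooth_on V f -> U x ->
  derivable (f \o F) x (delta_mx 0 i) /\
  partial i (f \o F) x = \sum_j partial j f (F x) * partial i (fun y => F y 0 j) x.
Proof.
move=> sf Ux; apply: (chain_rule (U := V)) => //; first exact: UV.
- by move=> y Vy j; exact: smooth_on_derivable sf Vy.
- by move=> j; exact: (smooth_on_cont (smooth_on_partial j sf) (UV Ux)).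
- by move=> j; exact: (smooth_on_derivable (sF j) Ux).
Qed.

Lemma sum_fctE (I : Type) (r : seq I) (h : I -> 'rV[R]_n -> R) x :
  (\sum_(i <- r) h i) x = \sum_(i <- r) h i x.
Proof. by elim/big_rec2: _ => // i a b _ <-. Qed.

(** Composites alone are not closed under partials: the chain rule multiplies them by partials of F.
    Sums of such products are closed, as [smooth_on_class] requires. *)
Inductive comp_class : ('rV[R]_n -> R) -> Prop :=
| CompMul f g : smooth_on V f -> smooth_on U g -> comp_class ((f \o F) * g)
| CompAdd h1 h2 : comp_class h1 -> comp_class h2 -> comp_class (h1 + h2).

Lemma comp_class_sum (I : Type) (r : seq I) (h : I -> 'rV[R]_n -> R) :
  (forall i, comp_class (h i)) -> comp_class (\sum_(i <- r) h i).
Proof.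
move=> ch; elim/big_ind: _ => // [|h1 h2]; last exact: CompAdd.
have -> : (0 : 'rV[R]_n -> R) = (cst 0 \o F) * cst 0.
  by apply/funext => y; rewrite /= mulr0.
by apply: CompMul; exact: smooth_on_cst.
Qed.

Lemma comp_class_smooth h : comp_class h -> forall x, U x ->
  {for x, continuous h} /\ forall i, derivable h x (delta_mx 0 i).
Proof.
elim=> [f g sf sg|h1 h2 _ IH1 _ IH2] x Ux.
  split=> [|i].
    apply: continuousM; last exact: smooth_on_cont sg Ux.
    apply: continuous_comp; first exact: smooth_map_cont.
    exact: smooth_on_cont sf (UV Ux).
  by apply: derivableM; [exact: (partial_comp i sf Ux).1|exact: smooth_on_derivable sg Ux].
have [c1 d1] := IH1 x Ux; have [c2 d2] := IH2 x Ux.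
by split=> [|i]; [exact: continuousD|exact: derivableD].
Qed.

Lemma comp_class_partial h i : comp_class h ->
  exists2 h', comp_class h' & forall x, U x -> partial i h x = h' x.
Proof.
elim=> [f g sf sg|h1 h2 C1 [g1 G1 E1] C2 [g2 G2 E2]].
  exists ((f \o F) * partial i g +
      \sum_j (partial j f \o F) * (partial i (fun y => F y 0 j) * g)).
    apply: CompAdd; first by apply: CompMul => //; exact: smooth_on_partial.
    apply: comp_class_sum => j; apply: CompMul; first exact: smooth_on_partial.
    by apply: smooth_onM => //; apply: smooth_on_partial; exact: sF.
  move=> x Ux; have [d1 E1] := partial_comp i sf Ux.
  rewrite /partial deriveM //; last exact: smooth_on_derivable sg Ux.
  rewrite /partial in E1; rewrite E1.
  rewrite -[RHS]/(f (F x) * 'D_(delta_mx 0 i) g x + (\sum_j _) x) sum_fctE.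
  congr (_ + _); rewrite scaler_sumr; apply: eq_bigr => j _.
  by rewrite -[RHS]/(_ * (_ * g x)) /GRing.scale /= mulrC mulrA.
exists (g1 + g2); first exact: CompAdd.
move=> x Ux; have [_ d1] := comp_class_smooth C1 Ux.
have [_ d2] := comp_class_smooth C2 Ux.
by rewrite /partial deriveD // -!/(partial i _ _) E1 // E2.
Qed.

Lemma smooth_on_comp f : smooth_on V f -> smooth_on U (f \o F).
Proof.
move=> sf; apply: (smooth_on_class oU comp_class_smooth) => [h i|].
  exact: comp_class_partial.
have -> : f \o F = (f \o F) * cst 1.
  by apply/funext => y; exact: esym (mulr1 _).
by apply: CompMul => //; exact: smooth_on_cst.
Qed.

End Composition.

(** * Flat functions and bump functions *)

Section Flat.
Variable R : realType.
Implicit Types (p : {poly R}) (t : R).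

(* The derivatives of t |-> exp (- 1 / t), extended by 0, are all of this form. *)
Definition flat p t : R := if 0 < t then p.[t^-1] * expR (- t^-1) else 0.

(** With u = 1/t, the derivative d/dt is -u^2 d/du, applied to p(u) exp(-u). *)
Definition flat_deriv p : {poly R} := 'X^2 * (p - p^`()).

Lemma expRN_bound n (y : R) : 0 < y -> y ^+ n * expR (- y) <= n.+2`!%:R * y^-1 ^+ 2.
Proof.
move=> y0; have y00 := lt0r_neq0 y0.
rewrite expRN ler_pdivrMr ?expR_gt0 // exprVn mulrAC ler_pdivlMr ?exprn_gt0 //.
rewrite -exprD addn2 mulrC -ler_pdivrMr ?mulr1 ?ltr0n ?fact_gt0 //.
apply: le_trans (expR_ge1Dxn n.+1 (ltW y0)); by rewrite lerDr.
Qed.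

(** Termwise from exp(y) >= y^(i+2) / (i+2)! at y = 1/t. The exponent 2 makes the difference
    quotient at 0 tend to 0. *)
Lemma flat_bound p : exists C, 0 <= C /\ forall t, `|flat p t| <= C * t ^+ 2.
Proof.
exists (\sum_(i < size p) `|p`_i| * i.+2`!%:R); split=> [|t].
  by apply: sumr_ge0 => i _; rewrite mulr_ge0.
rewrite /flat; case: ifP => t0; last first.
  by rewrite normr0 mulr_ge0 ?sqr_ge0 //; apply: sumr_ge0 => i _; rewrite mulr_ge0.
rewrite horner_coef mulr_suml mulr_suml.
apply: le_trans (ler_norm_sum _ _ _) _; apply: ler_sum => i _.
have ti : 0 < t^-1 by rewrite invr_gt0.
rewrite -mulrA normrM -mulrA; apply: ler_wpM2l => //.
rewrite ger0_norm; last by rewrite mulr_ge0 ?expR_ge0 // exprn_ge0 // ltW.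
by have := expRN_bound i ti; rewrite invrK.
Qed.

Lemma flat_is_derive p t : is_derive t 1 (flat p) (flat (flat_deriv p) t).
Proof.
have [t0|t0|->] := ltgtP t 0.
- have nE : {near t, cst 0 =1 flat p}.
    have : \forall z \near t, z < 0 by exact: lt_nbhsl.
    by apply: filterS => z z0; rewrite /flat ltNge (ltW z0).
  rewrite {2}/flat ltNge (ltW t0) /=.
  apply: (@near_eq_is_derive _ _ _ (cst 0) (flat p)); first exact: nE.
- have nE : {near t, (fun z : R => p.[z^-1] * expR (- z^-1)) =1 flat p}.
    have : \forall z \near t, 0 < z by exact: lt_nbhsr.
    by apply: filterS => z z0; rewrite /flat z0.
  apply: (@near_eq_is_derive _ _ _ _ (flat p) _ _ _ nE).
  have t00 : t != 0 by rewrite gt_eqF.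
  have dinv : is_derive t 1 (fun z : R => z^-1) (- t ^- 2).
    have di : derivable (id : R -> R) t 1 by exact: derivable_id.
    split; first exact: (derivableV t00 di).
    have := deriveV t00 di; rewrite derive_id => e.
    by apply: etrans e _; rewrite /GRing.scale /= mulr1.
  have dp : is_derive t 1 (fun z : R => p.[z^-1]) (p^`().[t^-1] * (- t ^- 2)).
    exact: (@is_derive1_comp _ (horner p) (fun z : R => z^-1)).
  have dNinv : is_derive t 1 (fun z : R => - z^-1) (t ^- 2).
    by rewrite -[t ^- 2]opprK; exact: is_deriveN.
  have de : is_derive t 1 (fun z : R => expR (- z^-1)) (expR (- t^-1) * t ^- 2).
    exact: (@is_derive1_comp _ expR (fun z : R => - z^-1)).
  apply: (is_derive_eq (is_deriveM dp de)).
  rewrite /flat t0 /flat_deriv !hornerE /GRing.scale /= -!exprVn; ring.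
- have [C [C0 hC]] := flat_bound p.
  rewrite {2}/flat ltxx.
  have L : (fun h : R => h^-1 *: ((flat p \o shift 0) (h *: 1) - flat p 0)) @ 0^' --> (0 : R).
    apply/cvgr0Pnorm_le => e e0.
    near=> h; have h0 : h != 0 by near: h; exact: nbhs_dnbhs_neq.
    rewrite /= addr0 {2}/flat ltxx subr0 /GRing.scale /= mulr1 normrM normfV.
    rewrite mulrC ler_pdivrMr ?normr_gt0 //.
    apply: le_trans (hC h) _; rewrite -real_normK ?num_real // expr2 mulrA.
    apply: ler_wpM2r => //.
    (* [C + 1] instead of [C] keeps the denominator positive. *)
    have : `|h| <= e / (C + 1).
      by near: h; apply: dnbhs0_le; rewrite divr_gt0 // ltr_wpDl.
    rewrite ler_pdivlMr ?ltr_wpDl // => /(le_trans _); apply.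
    by rewrite mulrC; apply: ler_wpM2l => //; rewrite lerDl.
  by split; [apply/cvg_ex; exists 0|exact/cvg_lim].
Unshelve. all: by end_near. Qed.

Lemma flat_gt0 t : 0 < t -> 0 < flat 1 t.
Proof. by move=> t0; rewrite /flat t0 hornerE mul1r expR_gt0. Qed.

Lemma flat_le0 p t : t <= 0 -> flat p t = 0.
Proof. by move=> t0; rewrite /flat ltNge t0. Qed.

Lemma smooth_flat p : smooth_on setT (fun v : 'rV[R]_1 => flat p (v 0 0)).
Proof.
have D q (v : 'rV[R]_1) i : is_derive v (delta_mx 0 i) (fun v => flat q (v 0 0))
    (flat (flat_deriv q) (v 0 0)).
  have [d1 d2] := flat_is_derive q (v 0 0).
  have E : (fun h : R => h^-1 *: (((fun v : 'rV[R]_1 => flat q (v 0 0)) \o shift v)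
      (h *: delta_mx 0 i) - flat q (v 0 0))) =
    (fun h => h^-1 *: ((flat q \o shift (v 0 0)) (h *: 1) - flat q (v 0 0))).
    by apply/funext => h /=; rewrite !mxE ord1 eqxx.
  by split; rewrite /derivable /derive E.
apply: (@smooth_on_class _ _ [set h : 'rV[R]_1 -> R | exists q, h = fun v => flat q (v 0 0)]);
   [exact: openT| | |by exists p].
  move=> h [q ->] x _; split=> [|i]; last by have [] := D q x i.
  have c1 : {for x, continuous (fun v : 'rV[R]_1 => v 0 0)} by exact: coord_continuous.
  apply: (continuous_comp c1); apply: differentiable_continuous.
  by apply/derivable1_diffP; have [] := flat_is_derive q (x 0 0).
move=> h i [q ->]; exists (fun v => flat (flat_deriv q) (v 0 0)).
  by exists (flat_deriv q).
by move=> x _; have [] := D q x i.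
Qed.

Lemma smooth_on_flat_comp m (U : set 'rV[R]_m) f p : open U -> smooth_on U f ->
  smooth_on U (fun y => flat p (f y)).
Proof.
move=> oU sf.
have sF : smooth_on_rV U (fun y => \row_(j < 1) f y).
  by move=> j; rewrite (_ : (fun _ => _) = f) //; apply/funext => y; rewrite mxE.
have := smooth_on_comp oU openT sF (fun _ _ => I) (smooth_flat p).
by congr (smooth_on U _); apply/funext => y; rewrite /= mxE.
Qed.

Lemma smooth_on_opp m (U : set 'rV[R]_m) f : open U -> smooth_on U f ->
  smooth_on U (- f).
Proof.
move=> oU sf; have -> : - f = cst (-1) * f by apply/funext => y; exact: esym (mulN1r _).
by apply: smooth_onM => //; exact: smooth_on_cst.
Qed.

Lemma smooth_on_sub m (U : set 'rV[R]_m) f g : open U -> smooth_on U f ->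
  smooth_on U g -> smooth_on U (f - g).
Proof. by move=> oU sf sg; apply: smooth_onD => //; exact: smooth_on_opp. Qed.

(** Applying [flat] to r^2 minus the squared Euclidean distance gives [phi], positive at x and zero
    from distance r on. A second application, to phi(x)/2 - phi(y), creates the plateau: it is 0
    where phi(y) > phi(x)/2 and equals the normalising constant where phi(y) = 0. *)
Lemma bump_exists m (x : 'rV[R]_m) (r : R) : 0 < r ->
  exists chi : 'rV[R]_m -> R, exists2 e : R, 0 < e & [/\ smooth_on setT chi,
    forall y, `|y - x| < e -> chi y = 1 & forall y, r <= `|y - x| -> chi y = 0].
Proof.
move=> r0.
pose q (y : 'rV[R]_m) : R := r ^+ 2 - \sum_j (y 0 j - x 0 j) * (y 0 j - x 0 j).
have sq : smooth_on setT q.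
  apply: (@smooth_on_sub m setT (cst (r ^+ 2))); [exact: openT|exact: smooth_on_cst|].
  apply: smooth_on_sum => [|j]; first exact: openT.
  have s1 : smooth_on setT (fun y : 'rV[R]_m => y 0 j - x 0 j).
    apply: (@smooth_on_sub m setT (fun y => y 0 j) (cst (x 0 j))); first exact: openT.
      by apply: smooth_on_coord; exact: openT.
    exact: smooth_on_cst.
  by apply: smooth_onM => //; exact: openT.
pose phi y := flat 1 (q y).
have sphi : smooth_on setT phi by apply: smooth_on_flat_comp => //; exact: openT.
have q0 : q x = r ^+ 2 by rewrite /q big1 ?subr0 // => j _; rewrite subrr mul0r.
have A0 : 0 < phi x by rewrite /phi q0 flat_gt0 // exprn_gt0.
have B0 : 0 < flat 1 (phi x / 2) by rewrite flat_gt0 // divr_gt0.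
pose chi (y : 'rV[R]_m) : R := 1 - flat 1 (phi x / 2 - phi y) / flat 1 (phi x / 2).
have : \forall y \near x, phi x / 2 < phi y.
  have /cvgr_gt := smooth_on_cont sphi (I : setT x); apply.
  by rewrite ltr_pdivrMr // ltr_pMr // ltr1n.
move=> /nbhs_ballP[e /= e0 he].
exists chi, e => //; split.
- apply: (@smooth_on_sub m setT (cst 1)); [exact: openT|exact: smooth_on_cst|].
  apply: (@smooth_onM _ m setT (fun y => flat 1 (phi x / 2 - phi y))
    (cst (flat 1 (phi x / 2))^-1)); [exact: openT| |exact: smooth_on_cst].
  apply: smooth_on_flat_comp; first exact: openT.
  apply: (@smooth_on_sub m setT (cst (phi x / 2))) => //; first exact: openT.
  exact: smooth_on_cst.
- move=> y yx; have /he h : ball x e y by rewrite -ball_normE /= distrC.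
  by rewrite /chi flat_le0 ?mul0r ?subr0 // subr_le0 ltW.
- move=> y ryx; have -> : chi y = 1 - flat 1 (phi x / 2 - phi y) / flat 1 (phi x / 2) by [].
  suff -> : phi y = 0 by rewrite subr0 divff ?subrr // gt_eqF.
  apply: flat_le0; rewrite subr_le0.
  (* The norm is the maximum norm: the coordinate that attains it already contributes at least r^2
     to the sum of squares. *)
  have [[i0 j]] : exists i, mx_norm (y - x) = `|(y - x) i.1 i.2|.
    apply: mx_norm_neq0; have := lt_le_trans r0 ryx => h; rewrite gt_eqF //.
  rewrite ord1 /= !mxE => nE; rewrite (bigD1 j) //= -[leLHS]addr0.
  apply: lerD; last by apply: sumr_ge0 => i _; rewrite -expr2 sqr_ge0.
  rewrite -expr2 -[X in _ <= X]real_normK ?num_real //.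
  by rewrite ler_sqr ?nnegrE ?(ltW r0) // -nE.
Qed.

End Flat.

(** * Hadamard's lemma *)

Section Hadamard.
Variables (R : realType) (m : nat).
Implicit Types (h f : 'rV[R]_m -> R) (x y : 'rV[R]_m).
Local Notation mu := (@lebesgue_measure R).

Lemma is_deriveE (V W : normedModType R) (a v : V) (F : V -> W) dF :
  is_derive a v F dF -> 'D_v F a = dF.
Proof. by case. Qed.

Lemma continuous_scale y : continuous (fun t : R => t *: y).
Proof.
move=> t; apply: (@cvg_rV _ _ _ (nbhs t) _) => j; rewrite mxE.
rewrite (_ : (fun _ => _) = (fun u : R => u * y 0 j)).
  exact: cvgMr_tmp.
by apply/funext => u; rewrite mxE.
Qed.

Lemma continuous_integrable (u : R -> R) : continuous u ->
  mu.-integrable `[0%R, 1%R] (EFin \o u).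
Proof.
move=> cu; apply: continuous_compact_integrable; first exact: segment_compact.
exact: continuous_subspaceT.
Qed.

Lemma smooth_continuous h : smooth_on setT h -> continuous h.
Proof. by move=> sh y; exact: (smooth_on_cont sh I). Qed.

Lemma bounded_on_ball h (rho : R) : continuous h -> 0 <= rho ->
  exists2 C, 0 <= C & forall y, `|y| <= rho -> `|h y| <= C.
Proof.
move=> ch rho0; pose A : set 'rV[R]_m := [set y | `|y| <= rho].
have cA : compact A.
  apply: bounded_closed_compact.
    by exists rho; split; [exact: num_real|move=> t rt y; exact: (fun p => le_trans p (ltW rt))].
  have cn : continuous (fun y : 'rV[R]_m => `|y|) by exact: norm_continuous.
  exact: (preimage_closed (fun y _ => cn y) (@closed_le R rho)).
have A0 : A !=set0 by exists 0; rewrite /A /= normr0.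
have [|c _ hc] := @EVT_max_rV R m (fun y => `|h y|) A A0 cA.
  apply: continuous_subspaceT => y; apply: continuous_comp; first exact: ch.
  exact: norm_continuous.
exists `|h c| => // y yA; apply: hc.
by rewrite inE.
Qed.

(** The weight t^k closes the family under differentiation: the i-th partial of [hint k h] is
    [hint k.+1 (partial i h)]. *)
Definition hint k h y : R := \int[mu]_(t in `[0%R, 1%R]) (t ^+ k * h (t *: y)).

Lemma hint_cont k h y : continuous h -> continuous (fun t : R => t ^+ k * h (t *: y)).
Proof.
move=> ch t; apply: cvgM; first exact: exprn_continuous.
by apply: continuous_comp; [exact: continuous_scale|exact: ch].
Qed.

Lemma mu01 : mu `[0%R, 1%R] = 1%E.
Proof. by rewrite lebesgue_measure_itv /= lte_fin ltr01 oppr0 adde0. Qed.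

Lemma cst_integrable (C : R) : mu.-integrable `[0%R, 1%R] (EFin \o cst C).
Proof. by apply: continuous_integrable => t; exact: cst_continuous. Qed.

Lemma hint_bound k h y C : continuous h -> (forall z, `|z| <= `|y| -> `|h z| <= C) ->
  `|hint k h y| <= C.
Proof.
move=> ch hC; have ci := continuous_integrable (hint_cont (k := k) (y := y) ch).
apply: (le_trans (le_normr_Rintegral _ ci)) => //.
have -> : C = \int[mu]_(t in `[0%R, 1%R]) C.
  by rewrite Rintegral_cst //= mu01 mulr1.
apply: le_Rintegral => //.
- have cn : continuous (fun t : R => `|t ^+ k * h (t *: y)|).
    by move=> t; apply: cvg_norm; exact: hint_cont.
  exact: continuous_integrable cn.
- exact: cst_integrable.
move=> t /=; rewrite in_itv /= => /andP[t0 t1].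
rewrite normrM ger0_norm ?exprn_ge0 // -[leRHS]mul1r; apply: ler_pM => //.
- exact: exprn_ge0.
- exact: exprn_ile1.
apply: hC; rewrite normrZ ger0_norm //.
by rewrite ler_piMl.
Qed.

Lemma is_derive_hint k h y i : smooth_on setT h ->
  is_derive y (delta_mx 0 i) (hint k h) (hint k.+1 (partial i h) y).
Proof.
move=> sh; set e : 'rV[R]_m := delta_mx 0 i.
pose f (s t : R) := t ^+ k * h (t *: (y + s *: e)).
have df (s t : R) : is_derive s 1 (f ^~ t) (t ^+ k.+1 * partial i h (t *: (y + s *: e))).
  have dh : derivable h (t *: y + (t * s) *: e) e by exact: (smooth_on_derivable sh I).
  have dl := derivable_line dh.
  have dt : is_derive s 1 (fun s : R => t * s) t.
    have [d1 d2] := @is_deriveZ _ _ _ id t s 1 1 (is_derive_id _ _).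
    by split; [exact: d1|apply: etrans d2 _; rewrite /GRing.scale /= mulr1].
  have dc := @is_derive1_comp _ (fun u => h (t *: y + u *: e)) (fun s : R => t * s) s _ _ dl dt.
  have [d1 d2] := @is_deriveZ _ _ _ _ (t ^+ k) s 1 _ dc.
  have E : (t ^+ k \*: ((fun u => h (t *: y + u *: e)) \o *%R t)) = f ^~ t.
    by apply/funext => u; rewrite /f /= scalerDr scalerA.
  rewrite E in d1 d2; split => //; rewrite d2.
  rewrite scalerDr scalerA exprSr -mulrA (mulrC t (partial _ _ _)).
  by [].
have sp := smooth_continuous (smooth_on_partial i sh).
(* For |s| < 1 and t in [0, 1] the points t (y + s e) stay in the ball of radius |y| + 1, so a
   constant dominates the differentiated integrand. *)
have [C C0 hC] := bounded_on_ball sp (addr_ge0 (normr_ge0 y) ler01).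
have ch := smooth_continuous sh.
have I0 : `](-1)%R, 1%R[%classic (0 : R) by rewrite /= in_itv /= ltrN10 ltr01.
have intf (s : R) : `](-1)%R, 1%R[%classic s -> mu.-integrable `[0%R, 1%R] (EFin \o f s).
  by move=> _; apply: continuous_integrable; exact: hint_cont.
have derf1 (s t : R) : `](-1)%R, 1%R[%classic s -> `[0%R, 1%R]%classic t -> derivable (f ^~ t) s 1.
  by move=> _ _; have [] := df s t.
have ub (s t : R) : `](-1)%R, 1%R[%classic s -> `[0%R, 1%R]%classic t ->
    `|partial1of2 f s t| <= cst C t.
  rewrite /= !in_itv /= => /andP[s1 s2] /andP[t0 t1].
  rewrite partial1of2E (is_deriveE (df s t)) normrM -[leRHS]mul1r; apply: ler_pM => //.
    by rewrite ger0_norm ?exprn_ge0 // exprn_ile1.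
  apply: hC; rewrite normrZ ger0_norm //.
  apply: (@le_trans _ _ `|y + s *: e|); first by rewrite ler_piMl.
  apply: le_trans (ler_normD _ _) _; rewrite lerD2l normrZ.
  by rewrite mulr_ile1 ?norm_delta // ler_norml !ltW.
have cint := cst_integrable C.
have L := @cvg_differentiation_under_integral R _ _ mu f `[0%R, 1%R] _ 0 (-1) 1 I0
  intf derf1 (cst C) (fun _ => C0) cint ub.
have {}L : (fun u : R => u^-1 *: ((hint k h \o shift y) (u *: e) - hint k h y)) @ 0^' -->
    hint k.+1 (partial i h) y.
  have := L (measurable_itv _).
  have -> : \int[mu]_(t in `[0%R, 1%R]) partial1of2 f 0 t = hint k.+1 (partial i h) y.
    apply: eq_Rintegral => t _; rewrite partial1of2E (is_deriveE (df 0 t)).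
    by rewrite scale0r addr0.
  apply: cvg_trans; apply: near_eq_cvg; near=> u.
  rewrite /f /hint /= addr0 scale0r addr0; congr (_ *: (_ - _)).
  by apply: eq_Rintegral => t _; rewrite (addrC y).
by split; [apply/cvg_ex; eexists; exact: L|exact/cvg_lim].
Unshelve. all: by end_near. Qed.

(** The partials are bounded near y, so the mean value estimate gives a Lipschitz bound there. *)
Lemma hint_continuous k h y : smooth_on setT h -> {for y, continuous (hint k h)}.
Proof.
move=> sh.
have /choice[C hC] : forall i, exists C : R, 0 <= C /\
    forall z, `|z| <= `|y| + 1 -> `|partial i h z| <= C.
  move=> i; have sp := smooth_continuous (smooth_on_partial i sh).
  have [C C0 hC] := bounded_on_ball sp (addr_ge0 (normr_ge0 y) ler01).
  by exists C.
pose K := \sum_i C i.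
have K0 : 0 <= K by apply: sumr_ge0 => i _; case: (hC i).
apply/(@cvgrPdist_le _ _ _ (nbhs y) _) => e e0.
have d0 : 0 < Num.min 1 (e / (K + 1)).
  by rewrite lt_min ltr01 divr_gt0 // ltr_wpDl.
have : \forall z \near y, `|y - z| < Num.min 1 (e / (K + 1)).
  by have /cvgr_dist_lt := (@cvg_id _ (nbhs y)); apply.
apply: filterS => z; rewrite lt_min => /andP[yz1 yz2].
have [|p [pz E]] := @telescoped_mvt R m (hint k h) y (z - y).
  by move=> u _ i; have [] := is_derive_hint k u i sh.
have Ez : y + (z - y) = z by rewrite addrC subrK.
rewrite Ez in E; rewrite distrC E.
apply: (@le_trans _ _ (\sum_i `|y - z| * C i)).
  apply: le_trans (ler_norm_sum _ _ _) _; apply: ler_sum => i _.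
  rewrite normrM; apply: ler_pM => //.
    by rewrite (distrC y); exact: rV_norm_coord.
  rewrite -/(partial i (hint k h) (p i)) [partial _ _ _](is_deriveE (is_derive_hint k (p i) i sh)).
  apply: hint_bound; first exact: smooth_continuous (smooth_on_partial i sh).
  move=> u up; apply: (hC i).2; apply: (le_trans up).
  rewrite -[p i](subrK y) addrC; apply: le_trans (ler_normD _ _) _; rewrite lerD2l.
  by apply: le_trans (pz i) _; rewrite distrC ltW.
rewrite -mulr_sumr -/K; move: yz2; rewrite ltr_pdivlMr ?ltr_wpDl // => /ltW yz2.
apply: le_trans yz2; apply: ler_wpM2l => //.
by rewrite lerDl.
Qed.

Lemma smooth_hint k h : smooth_on setT h -> smooth_on setT (hint k h).
Proof.
move=> sh; apply: (@smooth_on_class R m [set g | exists k h,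
    smooth_on setT h /\ g = hint k h] setT); [exact: openT| | |by exists k, h].
  move=> _ [k' [h' [sh' ->]]] x _; split; first exact: hint_continuous.
  by move=> i; have [] := is_derive_hint k' x i sh'.
move=> _ i [k' [h' [sh' ->]]]; exists (hint k'.+1 (partial i h')).
  by exists k'.+1, (partial i h'); split=> //; exact: smooth_on_partial.
by move=> x _; have [] := is_derive_hint k' x i sh'.
Qed.

Lemma hint_at0 h : hint 0 h 0 = h 0.
Proof.
rewrite /hint -[RHS]mulr1 -[X in _ * X]/(fine 1%E) -mu01 -Rintegral_cst //.
by apply: eq_Rintegral => t _; rewrite expr0 mul1r scaler0.
Qed.

(** The fundamental theorem of calculus for t |-> f (t y) on [0, 1]. *)
Lemma hadamard0 f y : smooth_on setT f ->
  f y - f 0 = \sum_i y 0 i * hint 0 (partial i f) y.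
Proof.
move=> sf.
have ct i (c : R) : continuous (fun t : R => c * (t ^+ 0 * partial i f (t *: y))).
  move=> t; apply: cvgM; first exact: cvg_cst.
  exact: hint_cont (smooth_continuous (smooth_on_partial i sf)) _.
pose F (t : R) := f (t *: y).
pose F' (t : R) := \sum_i y 0 i * (t ^+ 0 * partial i f (t *: y)).
have dF (t : R) : is_derive t 1 F (F' t).
  have dj j : is_derive t 1 (fun t : R => (t *: y) 0 j) (y 0 j).
    have [d1 d2] := @is_deriveZ _ _ _ id (y 0 j) t 1 1 (is_derive_id _ _).
    have E : (y 0 j \*: id) = (fun t : R => (t *: y) 0 j).
      by apply/funext => u; rewrite mxE mulrC.
    rewrite E in d1 d2.
    by split; [exact: d1|rewrite d2 /GRing.scale /= mulr1].
  have [|||d1 d2] := @chain_rule R m R f (fun t => t *: y) t 1 setT openT I.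
  - by move=> z _ i; exact: (smooth_on_derivable sf I).
  - by move=> i; exact: (smooth_on_cont (smooth_on_partial i sf) I).
  - by move=> j; have [] := dj j.
  split; first exact: d1.
  rewrite d2 /F'; apply: eq_bigr => j _; rewrite (is_deriveE (dj j)) expr0 mul1r.
  exact: mulrC.
have cF (t : R) : {for t, continuous F}.
  apply: differentiable_continuous; apply/derivable1_diffP.
  by have [] := dF t.
have cF' : continuous F'.
  by move=> t; apply: cvg_sum_fct => i; exact: ct.
have F2 := @continuous_FTC2 R F' F 0 1 ltr01 (continuous_subspaceT cF').
have : \int[mu]_(t in `[0%R, 1%R]) F' t = F 1 - F 0.
  rewrite /Rintegral F2 //.
    split; first by move=> t _; have [] := dF t.
    - by apply: cvg_at_right_filter; exact: cF.
    - by apply: cvg_at_left_filter; exact: cF.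
  by move=> t _; rewrite derive1E (is_deriveE (dF t)).
rewrite /F scale1r scale0r => <-.
have intsum (r : seq 'I_m) : \int[mu]_(t in `[0%R, 1%R])
    (\sum_(i <- r) y 0 i * (t ^+ 0 * partial i f (t *: y))) =
    \sum_(i <- r) y 0 i * hint 0 (partial i f) y.
  elim: r => [|i r IH].
    rewrite big_nil -[RHS](mul0r (fine (mu `[0%R, 1%R]))) -Rintegral_cst //.
    by apply: eq_Rintegral => t _; rewrite big_nil.
  rewrite big_cons -IH -RintegralZl //; last first.
    apply: continuous_integrable.
    exact: hint_cont (smooth_continuous (smooth_on_partial i sf)).
  rewrite -RintegralD //; last 2 first.
  - exact: continuous_integrable.
  - by apply: continuous_integrable => t; apply: cvg_sum_fct => j; exact: ct.
  by apply: eq_Rintegral => t _; rewrite big_cons.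
exact: intsum.
Qed.

Lemma hadamard f x : smooth_on setT f -> exists g : 'I_m -> 'rV[R]_m -> R,
  [/\ forall i, smooth_on setT (g i), forall i, g i x = partial i f x &
   forall y, f y - f x = \sum_i (y 0 i - x 0 i) * g i y].
Proof.
move=> sf; pose f' := f \o shift x.
have sshift (w : 'rV[R]_m) : smooth_on_rV setT (shift w).
  move=> j; have -> : (fun y => shift w y 0 j) = (fun y => y 0 j) + cst (w 0 j).
    by apply/funext => y; rewrite /= mxE.
  apply: smooth_onD; [exact: openT| |exact: smooth_on_cst].
  by apply: smooth_on_coord; exact: openT.
have sf' : smooth_on setT f'.
  exact: (smooth_on_comp openT openT (sshift x) (fun _ _ => I) sf).
exists (fun i => hint 0 (partial i f') \o shift (- x)); split=> [i|i|y].
- apply: (smooth_on_comp openT openT (sshift (- x)) (fun _ _ => I)).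
  by apply: smooth_hint; exact: smooth_on_partial.
- rewrite /= subrr hint_at0.
  have d : derivable f (0 + x) (delta_mx 0 i) by exact: (smooth_on_derivable sf I).
  by have [_] := derivable_shift d; rewrite add0r.
have := hadamard0 (y - x) sf'; rewrite /f' /= subrK add0r => ->.
by apply: eq_bigr => i _; rewrite !mxE.
Qed.

End Hadamard.

(** * Functions, frames and diffeomorphisms of manifolds *)

Section SmoothMaps.
Variable R : realType.

Definition smooth_for (T : topologicalType) m (A : set (chart R T m)) (f : T -> R) :=
  forall c, A c -> smooth_on (chart_cod c) (f \o chart_inv c).

Lemma open_chart_preimage (T : topologicalType) m (c : chart R T m) (D : set T) :
  open D -> open [set y | chart_cod c y /\ D (chart_inv c y)].
Proof.
move=> oD; rewrite openE => y [cy Dy]; apply: filterI.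
  exact: (open_nbhs_nbhs (conj (chart_cod_open c) cy)).
have /= := chart_inv_cont cy; apply.
exact: (open_nbhs_nbhs (conj oD Dy)).
Qed.

Lemma open_chart_ball (T : topologicalType) m (c : chart R T m) (V : set 'rV[R]_m) :
  open V -> open [set z | chart_dom c z /\ V (c z)].
Proof.
move=> oV; rewrite openE => z [cz Vz]; apply: filterI.
  exact: (open_nbhs_nbhs (conj (chart_dom_open c) cz)).
have /= := chart_map_cont cz; apply.
exact: (open_nbhs_nbhs (conj oV Vz)).
Qed.

Lemma smooth_for_comp (T N : topologicalType) m k (A : set (chart R T m))
    (B : set (chart R N k)) (phi : T -> N) (f : N -> R) :
  (forall x, exists2 c, B c & chart_dom c x) ->
  smooth_map_for A B phi -> smooth_for B f -> smooth_for A (f \o phi).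
Proof.
move=> Bcov [cphi sphi] sf c Ac; apply: smooth_on_local => y cy.
have [c' Bc' c'y] := Bcov (phi (chart_inv c y)).
have oV : open [set y | chart_cod c y /\ chart_dom c' (phi (chart_inv c y))].
  apply: (@open_chart_preimage _ _ c (phi @^-1` chart_dom c')).
  exact: ((continuousP _).1 cphi _ (chart_dom_open c')).
exists [set y | chart_cod c y /\ chart_dom c' (phi (chart_inv c y))].
exists ((f \o chart_inv c') \o (c' \o phi \o chart_inv c)); split=> //.
- apply: (smooth_on_comp (V := chart_cod c')) => //.
  + exact: chart_cod_open.
  + exact: sphi.
  + by move=> z [_ c'z]; exact: chart_mapP.
  + exact: sf.
- by move=> z [_ c'z]; rewrite /= chart_mapK.
Qed.

End SmoothMaps.

Section ManifoldFunctions.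
Variables (R : realType) (m : nat) (M : manifoldType R m).
Implicit Types (x z : M) (c : chart R M m).

Lemma Cinf_smooth (f : Cinf M) : smooth_for (atlas M) f.
Proof. by case: f => f /= /asboolP. Qed.

Definition to_Cinf (f : M -> R) (sf : smooth_for (atlas M) f) : Cinf M :=
  MkCinf (asboolT sf : f \in @smooth_fun R m M).

Lemma to_CinfE (f : M -> R) (sf : smooth_for (atlas M) f) x : to_Cinf sf x = f x.
Proof. by []. Qed.

Definition zext c (v : 'rV[R]_m -> R) (z : M) : R :=
  if `[< chart_dom c z >] then v (c z) else 0.

Lemma zextE c v z : chart_dom c z -> zext c v z = v (c z).
Proof. by rewrite /zext => cz; case: asboolP. Qed.

Definition supported_in (c : chart R M m) (y0 : 'rV[R]_m) (r : R) (v : 'rV[R]_m -> R) :=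
  (forall y, `|y - y0| <= r -> chart_cod c y) /\ (forall y, r < `|y - y0| -> v y = 0).

Lemma closed_ball_compact (y0 : 'rV[R]_m) (r : R) :
  compact [set y : 'rV[R]_m | `|y - y0| <= r].
Proof.
have cn : continuous (fun y : 'rV[R]_m => `|y - y0|).
  move=> y; apply: (@continuous_comp _ _ _ (fun y : 'rV[R]_m => y - y0) Num.norm).
    by apply: continuousB; [exact: cvg_id|exact: cst_continuous].
  exact: norm_continuous.
apply: bounded_closed_compact.
  exists (r + `|y0|); split; first exact: num_real.
  move=> t rt y /= yr; rewrite -[y](subrK y0).
  apply: le_trans (ler_normD _ _) _; apply: le_trans (ltW rt).
  by rewrite lerD2r.
exact: (preimage_closed (fun y _ => cn y) (@closed_le R r)).
Qed.

(** At a point outside the chart domain the extension vanishes nearby: its support lies in the image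
    of a closed ball, which is compact and hence closed in the Hausdorff space M. *)
Lemma smooth_zext c y0 r v : atlas M c -> supported_in c y0 r v ->
  smooth_on (chart_cod c) v -> smooth_for (atlas M) (zext c v).
Proof.
move=> Ac [Kc v0] sv c' Ac'; apply: smooth_on_local => y c'y.
have [cx|cx] := pselect (chart_dom c (chart_inv c' y)).
  exists [set y | chart_cod c' y /\ chart_dom c (chart_inv c' y)].
  have oV := @open_chart_preimage _ _ _ c' _ (chart_dom_open c).
  exists (v \o (c \o chart_inv c')); split=> //.
  - apply: (smooth_on_comp (V := chart_cod c)) => //.
    + exact: chart_cod_open.
    + exact: atlas_compatible.
    + by move=> z [_ cz]; exact: chart_mapP.
  - by move=> z [_ cz]; rewrite /= zextE.
pose K := chart_inv c @` [set y | `|y - y0| <= r].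
have clK : closed K.
  apply: compact_closed; first exact: manifold_hausdorff.
  apply: continuous_compact; last exact: closed_ball_compact.
  by apply: continuous_in_subspaceT => z; rewrite inE => /Kc; exact: chart_inv_cont.
have oV := @open_chart_preimage _ _ _ c' (~` K) (closed_openC clK).
exists [set y | chart_cod c' y /\ (~` K) (chart_inv c' y)], (cst 0); split=> //.
- split=> // -[z zr zy]; apply: cx; rewrite -zy; apply: chart_invP; exact: Kc.
- exact: smooth_on_cst.
- move=> z [c'z Kz]; rewrite /= /zext; case: asboolP => // cz.
  rewrite v0 // ltNge; apply/negP => zr; apply: Kz.
  by exists (c (chart_inv c' z)) => //; rewrite chart_mapK.
Qed.

Lemma chart_ball c x (U : set M) : chart_dom c x -> open U -> U x ->
  exists2 r, 0 < r & forall y, `|y - c x| <= r -> chart_cod c y /\ U (chart_inv c y).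
Proof.
move=> cx oU Ux; have oV := @open_chart_preimage _ _ _ c _ oU.
have /nbhs_ballP[r /= r0 rV] : nbhs (c x) [set y | chart_cod c y /\ U (chart_inv c y)].
  apply: open_nbhs_nbhs; split=> //; split; first exact: chart_mapP.
  by rewrite chart_mapK.
exists (r / 2); first by rewrite divr_gt0.
move=> y yr; apply: rV; rewrite -ball_normE /= distrC.
by apply: le_lt_trans yr _; rewrite ltr_pdivrMr // ltr_pMr // ltr1n.
Qed.

Definition chart_bump c (y0 : 'rV[R]_m) (r e : R) (chi : 'rV[R]_m -> R) :=
  [/\ smooth_on setT chi, 0 < e,
      forall y, `|y - y0| < e -> chi y = 1,
      forall y, r <= `|y - y0| -> chi y = 0 &
      forall y, `|y - y0| <= r -> chart_cod c y].

Lemma chart_bump_exists c x (U : set M) : chart_dom c x -> open U -> U x ->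
  exists r e chi, chart_bump c (c x) r e chi /\
    forall y, `|y - c x| <= r -> U (chart_inv c y).
Proof.
move=> cx oU Ux; have [r r0 hr] := chart_ball cx oU Ux.
have [chi [e e0 [s1 s2 s3]]] := bump_exists (c x) r0.
by exists r, e, chi; split=> [|y /hr[]//]; split=> // y /hr[].
Qed.

Section ChartBump.
Variables (c : chart R M m) (y0 : 'rV[R]_m) (r e : R) (chi : 'rV[R]_m -> R).
Hypotheses (Ac : atlas M c) (bc : chart_bump c y0 r e chi).

Lemma bump_supported u : supported_in c y0 r (chi * u).
Proof.
have [_ _ _ h4 h5] := bc; split=> // y ry.
by rewrite -[LHS]/(chi y * u y) h4 ?mul0r // ltW.
Qed.

Lemma smooth_bump_mul u : smooth_on (chart_cod c) u ->
  smooth_for (atlas M) (zext c (chi * u)).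
Proof.
move=> su; apply: (smooth_zext Ac (bump_supported u)).
have [s _ _ _ _] := bc.
apply: smooth_onM => //; first exact: chart_cod_open.
exact: smooth_on_subset s.
Qed.

Definition bump_ext u (su : smooth_on (chart_cod c) u) : Cinf M :=
  to_Cinf (smooth_bump_mul su).

Definition bump_nbhd := [set z | chart_dom c z /\ `|c z - y0| < e].

Lemma open_bump_nbhd : open bump_nbhd.
Proof.
apply: (@open_chart_ball _ _ _ c [set y | `|y - y0| < e]); exact: open_norm_ball.
Qed.

Lemma bump_extE u (su : smooth_on (chart_cod c) u) z : bump_nbhd z ->
  bump_ext su z = u (c z).
Proof.
move=> [cz ze]; have [_ _ h3 _ _] := bc.
by rewrite to_CinfE zextE // -[LHS]/(chi (c z) * u (c z)) h3 // mul1r.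
Qed.

Lemma bump_nbhdP x : chart_dom c x -> c x = y0 -> bump_nbhd x.
Proof.
by move=> cx xy; split=> //; rewrite xy subrr normr0; case: bc.
Qed.

(** [hadamard] concerns functions smooth on all of R^m; the cut-off makes a chart expression
    eligible for it. *)
Lemma smooth_bump_all u : smooth_on (chart_cod c) u -> smooth_on setT (chi * u).
Proof.
move=> su; have [s _ _ h4 h5] := bc; apply: smooth_on_local => y _.
have [cy|cy] := pselect (chart_cod c y).
  exists (chart_cod c), (chi * u); split=> //; first exact: chart_cod_open.
  apply: smooth_onM => //; first exact: chart_cod_open.
  exact: smooth_on_subset s.
exists (~` [set y | `|y - y0| <= r]), (cst 0); split=> //.
- apply: closed_openC; apply: compact_closed; first exact: norm_hausdorff.
  exact: closed_ball_compact.
- by move=> /h5.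
- exact: smooth_on_cst.
- move=> z /negP; rewrite -ltNge => /ltW zr.
  by rewrite -[RHS]/(chi z * u z) h4 // mul0r.
Qed.

End ChartBump.

Lemma bump_at x (U : set M) : open U -> U x -> exists psi : Cinf M,
  psi x = 1 /\ forall z, ~ U z -> psi z = 0.
Proof.
move=> oU Ux; have [c Ac cx] := atlas_cover x.
have [r [e [chi [bc hU]]]] := chart_bump_exists cx oU Ux.
have s1 : smooth_on (chart_cod c) (cst 1 : _ -> R) by exact: smooth_on_cst.
exists (bump_ext Ac bc s1); split; first by rewrite bump_extE //; exact: (bump_nbhdP bc).
move=> z Uz; rewrite to_CinfE /zext; case: asboolP => // cz.
have [_ _ _ h4 _] := bc; rewrite -[LHS]/(chi (c z) * 1) h4 ?mul0r //.
apply: ltW; rewrite ltNge; apply/negP => /hU; rewrite chart_mapK //.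
Qed.

End ManifoldFunctions.

(** * Derivations at a point and local frames *)

Section PointDerivations.
Variables (R : realType) (m : nat) (M : manifoldType R m).
Implicit Types (x z : M) (c : chart R M m) (f g : Cinf M) (D : Cinf M -> R).

Definition point_derivation x D :=
  (forall (a : R) f g, D (a *: f + g) = a * D f + D g) /\
  (forall f g, D (f * g) = D f * g x + f x * D g).

Definition chart_partial c j (f : M -> R) z : R := partial j (f \o chart_inv c) (c z).

Section Basic.
Variables (x : M) (D : Cinf M -> R).
Hypothesis pD : point_derivation x D.

Lemma pderD f g : D (f + g) = D f + D g.
Proof. by have := pD.1 1 f g; rewrite scale1r mul1r. Qed.

Lemma pder0 : D 0 = 0.
Proof. by apply: (addrI (D 0)); rewrite -pderD !addr0. Qed.

Lemma pderZ a f : D (a *: f) = a * D f.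
Proof. by have := pD.1 a f 0; rewrite !addr0 pder0 addr0. Qed.

Lemma pderN f : D (- f) = - D f.
Proof. by rewrite -scaleN1r pderZ mulN1r. Qed.

Lemma pder1 : D 1 = 0.
Proof.
have := pD.2 1 1; rewrite !mulr1 mul1r => h.
by apply: (addrI (D 1)); rewrite addr0 -h.
Qed.

Lemma pder_cst (a : R) : D (a *: (1 : Cinf M)) = 0.
Proof. by rewrite pderZ pder1 mulr0. Qed.

Lemma pder_sum (I : Type) (r : seq I) (F : I -> Cinf M) :
  D (\sum_(i <- r) F i) = \sum_(i <- r) D (F i).
Proof. by elim/big_rec2: _ => [|i a b _ <-]; [exact: pder0|exact: pderD]. Qed.

(** Leibniz' rule at x for psi (f - g) = 0, where psi(x) = 1 and psi vanishes outside U. *)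
Lemma pder_local (U : set M) f g : open U -> U x -> (forall z, U z -> f z = g z) ->
  D f = D g.
Proof.
move=> oU Ux fg; have [psi [psi1 psi0]] := bump_at oU Ux.
apply/eqP; rewrite -subr_eq0 -pderN -pderD; apply/eqP.
have E : psi * (f - g) = 0.
  apply: Cinf_ext => z; rewrite CinfME CinfBE Cinf0E.
  have [Uz|Uz] := pselect (U z); first by rewrite fg // subrr mulr0.
  by rewrite psi0 // mul0r.
have := pD.2 psi (f - g); rewrite E pder0 CinfBE fg // subrr mulr0 add0r psi1 mul1r.
by move<-.
Qed.

End Basic.

Lemma vfield_pder (X : vfield M) x : point_derivation x (fun f => X f x).
Proof.
split=> [a f g|f g]; first by rewrite vfield_lin CinfDE CinfZE.
by rewrite vfieldM CinfDE !CinfME.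
Qed.

Lemma chart_derivable c f z j : atlas M c -> chart_dom c z ->
  derivable (f \o chart_inv c) (c z) (delta_mx 0 j).
Proof.
by move=> Ac cz; exact: (smooth_on_derivable (Cinf_smooth f Ac) (chart_mapP cz)).
Qed.

Lemma chart_pder c j z : atlas M c -> chart_dom c z ->
  point_derivation z (fun f => chart_partial c j f z).
Proof.
move=> Ac cz.
have dC f : derivable (f \o chart_inv c) (c z) (delta_mx 0 j) by exact: chart_derivable.
split=> [a f g|f g]; rewrite /chart_partial /partial.
  have -> : (a *: f + g : Cinf M) \o chart_inv c =
      a \*: (f \o chart_inv c) + (g \o chart_inv c) by [].
  by rewrite (deriveD (derivableZ (dC f)) (dC g)) (deriveZ a (dC f)).
have -> : (f * g : Cinf M) \o chart_inv c =
    (f \o chart_inv c) * (g \o chart_inv c) by [].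
rewrite (deriveM (dC f) (dC g)) /= chart_mapK // addrC.
by rewrite /GRing.scale /= (mulrC (g z)).
Qed.

(** Near x, Hadamard's lemma writes f as f(x) plus the sum of (y_j - x_j) g_j, with g_j(x) the j-th
    partial. As y_j - x_j vanishes at x, Leibniz' rule leaves D(y_j - x_j) g_j(x). *)
Lemma pder_chart x D c : point_derivation x D -> atlas M c -> chart_dom c x ->
  exists v : 'I_m -> R, forall f, D f = \sum_j v j * chart_partial c j f x.
Proof.
move=> pD Ac cx.
have [r [e [chi [bc _]]]] := chart_bump_exists cx openT (I : setT x).
have oc := chart_cod_open c.
have scoord j : smooth_on (chart_cod c) ((fun y => y 0 j) - cst (c x 0 j)).
  by apply: smooth_on_sub => //; [exact: smooth_on_coord|exact: smooth_on_cst].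
pose co j := bump_ext Ac bc (scoord j).
exists (fun j => D (co j)) => f.
have sf := Cinf_smooth f Ac.
have [g [sg gx gE]] := hadamard (c x) (smooth_bump_all bc sf).
have sg' j : smooth_on (chart_cod c) (g j) by apply: smooth_on_subset (sg j).
pose G j := bump_ext Ac bc (sg' j).
have xU : bump_nbhd c (c x) e x by exact: (bump_nbhdP bc).
have [_ e0 chi1 _ _] := bc.
have fE z : bump_nbhd c (c x) e z ->
    f z = (f x *: (1 : Cinf M) + \sum_j co j * G j) z.
  move=> Uz; have [cz ze] := Uz.
  rewrite CinfDE CinfZE Cinf1E mulr1 Cinf_sumE.
  have -> : \sum_j (co j * G j) z = \sum_j (c z 0 j - c x 0 j) * g j (c z).
    by apply: eq_bigr => j _; rewrite CinfME !bump_extE.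
  rewrite -gE -![(chi * _) _]/(chi _ * f (chart_inv c _)).
  rewrite !chi1 ?subrr ?normr0 // !mul1r !chart_mapK //.
  by rewrite addrC subrK.
rewrite (pder_local pD (open_bump_nbhd c (c x) e) xU fE).
rewrite (pderD pD) (pder_cst pD) add0r (pder_sum pD); apply: eq_bigr => j _.
have co0 : co j x = 0 by rewrite bump_extE // -[LHS]/(c x 0 j - c x 0 j) subrr.
rewrite pD.2 co0 mul0r addr0 bump_extE // gx; congr (_ * _).
apply: near_eq_derive.
have : \forall y \near c x, ball (c x) e y by exact: nbhsx_ballx.
apply: filterS => y; rewrite -ball_normE /= distrC => ye.
by rewrite -[LHS]/(chi y * f (chart_inv c y)) chi1 // mul1r.
Qed.

End PointDerivations.

Section Frames.
Variables (R : realType) (m : nat) (M : manifoldType R m).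
Implicit Types (x z : M) (c : chart R M m) (f g : Cinf M) (X Y : vfield M).

Section Frame.
Variables (c : chart R M m) (y0 : 'rV[R]_m) (r e : R) (chi : 'rV[R]_m -> R).
Hypotheses (Ac : atlas M c) (bc : chart_bump c y0 r e chi).

Lemma smooth_chart_coord j : smooth_on (chart_cod c) (fun y => y 0 j).
Proof. by apply: smooth_on_coord; exact: chart_cod_open. Qed.

Definition frame_coord j : Cinf M := bump_ext Ac bc (smooth_chart_coord j).

Lemma smooth_chart_partial f j : smooth_on (chart_cod c) (partial j (f \o chart_inv c)).
Proof. by apply: smooth_on_partial; exact: Cinf_smooth. Qed.

(** The j-th partial, cut off by chi and extended by 0: a globally defined operator that is the
    coordinate field near the centre. *)
Definition frame_fun j f : Cinf M := bump_ext Ac bc (smooth_chart_partial f j).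

Lemma frame_funE j f z : chart_dom c z ->
  frame_fun j f z = chi (c z) * chart_partial c j f z.
Proof. by move=> cz; rewrite to_CinfE zextE. Qed.

Lemma frame_fun0 j f z : ~ chart_dom c z -> frame_fun j f z = 0.
Proof. by move=> cz; rewrite to_CinfE /zext; case: asboolP. Qed.

Lemma frame_derivation j : frame_fun j \in @derivation R m M.
Proof.
apply/asboolP; split=> [a f g|f g]; apply: Cinf_ext => z.
  rewrite CinfDE CinfZE; have [cz|cz] := pselect (chart_dom c z); last first.
    by rewrite !frame_fun0 // mulr0 addr0.
  by rewrite !frame_funE // (chart_pder j Ac cz).1 mulrDr mulrCA.
rewrite CinfDE !CinfME; have [cz|cz] := pselect (chart_dom c z); last first.
  by rewrite !frame_fun0 // mulr0 mul0r addr0.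
by rewrite !frame_funE // (chart_pder j Ac cz).2; ring.
Qed.

Definition frame_field j : vfield M := MkVfield (frame_derivation j).

Lemma frame_decomposition Y f z : bump_nbhd c y0 e z ->
  Y f z = \sum_j Y (frame_coord j) z * frame_field j f z.
Proof.
move=> Uz; have [cz ze] := Uz; have [_ e0 chi1 _ _] := bc.
have [v hv] := pder_chart (vfield_pder Y z) Ac cz.
have nE k : \forall y \near c z, (frame_coord k \o chart_inv c) y = y 0 k.
  have n1 := open_nbhs_nbhs (conj (chart_cod_open c) (chart_mapP cz)).
  have n2 : \forall y \near c z, `|y - y0| < e.
    have : nbhs (c z) (ball y0 e).
      apply: open_nbhs_nbhs; split; first exact: ball_open.
      by rewrite -ball_normE /= distrC.
    by apply: filterS => y; rewrite -ball_normE /= distrC.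
  apply: filterS (filterI n1 n2) => y [cy ye].
  have Uy : bump_nbhd c y0 e (chart_inv c y).
    by split; [exact: chart_invP|rewrite chart_invK].
  by apply: etrans (bump_extE Ac bc (smooth_chart_coord k) Uy) _; rewrite chart_invK.
have pE i k : chart_partial c i (frame_coord k) z = (i == k)%:R.
  rewrite /chart_partial /partial (near_eq_derive _ (nE k)).
  by rewrite (is_deriveE (is_derive_coord _ _ _)) mxE eqxx /= eq_sym.
have vE j : Y (frame_coord j) z = v j.
  rewrite hv (bigD1 j) //= pE eqxx mulr1 big1 ?addr0 // => i ij.
  by rewrite pE (negbTE ij) mulr0.
rewrite hv; apply: eq_bigr => j _; rewrite vE; congr (_ * _).
by rewrite frame_funE // chi1 // mul1r.
Qed.

End Frame.

(** A bump function psi with psi(z) = 1 gives psi Z = 0, and La is linear over functions. *)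
Lemma Cinf_linear_local (La : vfield M -> Cinf M) (U : set M) (Z : vfield M) z :
  Cinf_linear La ->
  open U -> U z -> (forall f x, U x -> Z f x = 0) -> La Z z = 0.
Proof.
move=> lLa oU Uz Z0; have [psi [psi1 psi0]] := bump_at oU Uz.
have E : psi *: Z = 0.
  apply: vfield_ext => f; apply: Cinf_ext => x.
  rewrite vfieldZE CinfME vfield0E Cinf0E.
  by have [Ux|Ux] := pselect (U x); [rewrite Z0 // mulr0|rewrite psi0 // mul0r].
have := Cinf_linear_sum [:: tt] (fun=> psi) (fun=> Z) lLa.
rewrite !big_seq1 E => h; have := congr1 (fun f : Cinf M => f z) h.
rewrite CinfME psi1 mul1r => <-.
by have := Cinf_linear_sum [::] (fun i : unit => psi) (fun=> Z) lLa;
  rewrite !big_nil => ->.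
Qed.

(** Y agrees with sum_j Y(y_j) E_j on U only, not globally, so the expansion is recorded after a
    linear map has been applied and evaluated in U. *)
Lemma frame_exists x : exists (y : 'I_m -> Cinf M) (E : 'I_m -> vfield M) (U : set M),
  [/\ open U, U x & forall La, Cinf_linear La -> forall Y z, U z ->
     La Y z = \sum_j Y (y j) z * La (E j) z].
Proof.
have [c Ac cx] := atlas_cover x.
have [r [e [chi [bc _]]]] := chart_bump_exists cx openT (I : setT x).
exists (frame_coord Ac bc), (frame_field Ac bc), (bump_nbhd c (c x) e).
split; [exact: open_bump_nbhd|exact: (bump_nbhdP bc)|].
move=> La lLa Y z Uz.
pose Z := (-1 : Cinf M) *: (\sum_j Y (frame_coord Ac bc j) *: frame_field Ac bc j) + Y.
have Z0 : La Z z = 0.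
  apply: (Cinf_linear_local lLa (open_bump_nbhd c (c x) e) Uz) => f z' Uz'.
  rewrite /Z vfieldDE CinfDE vfieldZE CinfME vfield_sumE Cinf_sumE.
  rewrite (frame_decomposition Ac bc Y f Uz') CinfNE Cinf1E mulN1r.
  by apply/eqP; rewrite addrC subr_eq0; apply/eqP; apply: eq_bigr.
move: Z0; rewrite /Z lLa Cinf_linear_sum // CinfDE CinfME CinfNE Cinf1E mulN1r.
move/eqP; rewrite addrC subr_eq0 => /eqP ->.
by rewrite Cinf_sumE; apply: eq_bigr.
Qed.

Lemma Cinf_linear_tensor (La : vfield M -> Cinf M) (Z : vfield M) z : Cinf_linear La ->
  (forall f, Z f z = 0) -> La Z z = 0.
Proof.
move=> lLa Z0; have [y [E [U [oU Uz h]]]] := frame_exists z.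
by rewrite (h _ lLa _ _ Uz) big1 // => j _; rewrite Z0 mul0r.
Qed.

End Frames.

(** * Smooth functions on a product *)

Section RowMx.
Variables (R : realType) (k m : nat).

Lemma smooth_row_mxl (b : 'rV[R]_m) (U : set 'rV[R]_k) : open U ->
  smooth_on_rV U (fun y : 'rV[R]_k => row_mx y b).
Proof.
move=> oU j; case: (split_ordP j) => i ->.
  apply: (smooth_on_eq oU _ (smooth_on_coord i oU)) => y _.
  by rewrite row_mxEl.
apply: (smooth_on_eq oU (f := cst (b 0 i))); last exact: smooth_on_cst.
move=> y _.
by rewrite row_mxEr.
Qed.

Lemma smooth_row_mxr (a : 'rV[R]_k) (U : set 'rV[R]_m) : open U ->
  smooth_on_rV U (fun y : 'rV[R]_m => row_mx a y).
Proof.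
move=> oU j; case: (split_ordP j) => i ->.
  apply: (smooth_on_eq oU (f := cst (a 0 i))); last exact: smooth_on_cst.
  move=> y _.
  by rewrite row_mxEl.
apply: (smooth_on_eq oU _ (smooth_on_coord i oU)) => y _.
by rewrite row_mxEr.
Qed.

Lemma delta_lshift i : (delta_mx 0 (lshift m i) : 'rV[R]_(k + m)) = row_mx (delta_mx 0 i) 0.
Proof.
apply/rowP => j; case: (split_ordP j) => j' ->; rewrite ?row_mxEl ?row_mxEr !mxE eqxx /=.
  by rewrite (inj_eq (@lshift_inj _ _)).
by rewrite eq_rlshift.
Qed.

Lemma delta_rshift i : (delta_mx 0 (rshift k i) : 'rV[R]_(k + m)) = row_mx 0 (delta_mx 0 i).
Proof.
apply/rowP => j; case: (split_ordP j) => j' ->; rewrite ?row_mxEl ?row_mxEr !mxE eqxx /=.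
  by rewrite eq_lrshift.
by rewrite (inj_eq (@rshift_inj _ _)).
Qed.

Lemma partial_row_mxl (g : 'rV[R]_(k + m) -> R) (a : 'rV[R]_k) (b : 'rV[R]_m) i :
  partial i (fun y : 'rV[R]_k => g (row_mx y b)) a = partial (lshift m i) g (row_mx a b).
Proof.
have E : (fun h : R => h^-1 *: (((fun y : 'rV[R]_k => g (row_mx y b)) \o shift a)
      (h *: delta_mx 0 i) - g (row_mx a b))) =
    (fun h => h^-1 *: ((g \o shift (row_mx a b)) (h *: delta_mx 0 (lshift m i)) - g (row_mx a b))).
  apply/funext => h /=.
  by rewrite delta_lshift scale_row_mx add_row_mx scaler0 add0r.
by rewrite /partial /derive E.
Qed.

Lemma partial_row_mxr (g : 'rV[R]_(k + m) -> R) (a : 'rV[R]_k) (b : 'rV[R]_m) i :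
  partial i (fun y : 'rV[R]_m => g (row_mx a y)) b = partial (rshift k i) g (row_mx a b).
Proof.
have E : (fun h : R => h^-1 *: (((fun y : 'rV[R]_m => g (row_mx a y)) \o shift b)
      (h *: delta_mx 0 i) - g (row_mx a b))) =
    (fun h => h^-1 *: ((g \o shift (row_mx a b)) (h *: delta_mx 0 (rshift k i)) - g (row_mx a b))).
  apply/funext => h /=.
  by rewrite delta_rshift scale_row_mx add_row_mx scaler0 add0r.
by rewrite /partial /derive E.
Qed.

End RowMx.

Lemma partial_lincomb (R : realType) m (I : Type) (r : seq I) (v : I -> R)
    (g : I -> 'rV[R]_m -> R) (U : set 'rV[R]_m) x i : open U -> U x ->
  (forall j, smooth_on U (g j)) ->
  partial i (fun y => \sum_(j <- r) v j * g j y) x = \sum_(j <- r) v j * partial i (g j) x.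
Proof.
move=> oU Ux sg; elim: r => [|j r IH].
  rewrite big_nil (_ : (fun _ => _) = cst 0); first exact: derive_cst.
  by apply/funext => y; rewrite big_nil.
have sv l : smooth_on U (fun y => v l * g l y).
  by apply: (@smooth_onM R m U (cst (v l)) (g l)) => //; exact: smooth_on_cst.
have d1 : derivable (g j) x (delta_mx 0 i) by exact: (smooth_on_derivable (sg j) Ux).
have d2 : derivable (fun y => \sum_(j <- r) v j * g j y) x (delta_mx 0 i).
  apply: (smooth_on_derivable (U := U)) => //.
  exact: smooth_on_sum.
rewrite big_cons -IH (_ : (fun _ => _) = (v j \*: g j) +
    (fun y => \sum_(j <- r) v j * g j y)).
  by rewrite /partial (deriveD (derivableZ d1) d2) (deriveZ (v j) d1).
by apply/funext => y; rewrite big_cons.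
Qed.

Section Slices.
Variables (R : realType) (k m : nat) (P : manifoldType R k) (Q : manifoldType R m).
Variable F : P * Q -> R.
Hypothesis sF : smooth_for (prod_atlas (atlas P) (atlas Q)) F.

Let Ft c c' : 'rV[R]_(k + m) -> R :=
  fun w => F (chart_inv c (lsubmx w), chart_inv c' (rsubmx w)).

Let sFt c c' : atlas P c -> atlas Q c' -> smooth_on (chart_cod (prod_chart c c')) (Ft c c').
Proof. by move=> Ac Ac'; apply: sF; exists c => //; exists c'. Qed.

Let codP c c' y z : chart_cod c y -> chart_cod c' z ->
  chart_cod (prod_chart (c : chart R P k) (c' : chart R Q m)) (row_mx y z).
Proof. by move=> cy cz; split; rewrite ?row_mxKl ?row_mxKr. Qed.

Let FtE c c' y z : Ft c c' (row_mx y z) = F (chart_inv c y, chart_inv c' z).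
Proof. by rewrite /Ft row_mxKl row_mxKr. Qed.

Lemma slice_left q : smooth_for (atlas P) (fun p => F (p, q)).
Proof.
move=> c Ac; have [c' Ac' cq] := atlas_cover q; have oc := chart_cod_open c.
apply: (smooth_on_eq oc (f := Ft c c' \o (fun y => row_mx y (c' q)))).
  by move=> y cy; rewrite /= FtE chart_mapK.
apply: (smooth_on_comp (V := chart_cod (prod_chart c c'))) => //.
- exact: chart_cod_open.
- exact: smooth_row_mxl.
- by move=> y cy; apply: codP => //; exact: chart_mapP.
- exact: sFt.
Qed.

Lemma slice_right p : smooth_for (atlas Q) (fun q => F (p, q)).
Proof.
move=> c' Ac'; have [c Ac cp] := atlas_cover p; have oc := chart_cod_open c'.
apply: (smooth_on_eq oc (f := Ft c c' \o (fun z => row_mx (c p) z))).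
  by move=> y cy; rewrite /= FtE chart_mapK.
apply: (smooth_on_comp (V := chart_cod (prod_chart c c'))) => //.
- exact: chart_cod_open.
- exact: smooth_row_mxr.
- by move=> y cy; apply: codP => //; exact: chart_mapP.
- exact: sFt.
Qed.

(* h is p |-> D (F (p, .)), and the second clause is L D F = D L F. *)
Lemma mixed_derivation q (D : Cinf Q -> R) : point_derivation q D ->
  exists h : Cinf P,
    (forall p (f : Cinf Q), (forall q', f q' = F (p, q')) -> h p = D f) /\
    (forall p0 (L : Cinf P -> R), point_derivation p0 L -> forall f : Cinf Q,
      (forall q' (g : Cinf P), (forall p, g p = F (p, q')) -> f q' = L g) -> L h = D f).
Proof.
move=> pD; have [c' Ac' c'q] := atlas_cover q.
have [v hv] := pder_chart pD Ac' c'q.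
pose h0 p := D (to_Cinf (slice_right p)).
have h0E c y : atlas P c -> h0 (chart_inv c y) =
    \sum_j v j * partial (rshift k j) (Ft c c') (row_mx y (c' q)).
  move=> Ac; rewrite /h0 hv; apply: eq_bigr => j _; congr (_ * _).
  rewrite -partial_row_mxr /chart_partial; congr (partial j _ _).
  by apply/funext => z; rewrite /= FtE.
have sV c : atlas P c -> forall j, smooth_on (chart_cod c)
    (fun y => partial (rshift k j) (Ft c c') (row_mx y (c' q))).
  move=> Ac j; have oc := chart_cod_open c.
  apply: (smooth_on_comp (V := chart_cod (prod_chart c c'))
    (F := fun y => row_mx y (c' q))) => //.
  - exact: chart_cod_open.
  - exact: smooth_row_mxl.
  - by move=> y cy; apply: codP => //; exact: chart_mapP.
  - by apply: smooth_on_partial; exact: sFt.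
have sh0 : smooth_for (atlas P) h0.
  move=> c Ac; have oc := chart_cod_open c.
  apply: (smooth_on_eq oc (f := fun y =>
    \sum_j v j * partial (rshift k j) (Ft c c') (row_mx y (c' q)))).
    by move=> y _; rewrite /= h0E.
  apply: smooth_on_sum => // j.
  apply: (@smooth_onM R k (chart_cod c) (cst (v j))) => //; first exact: smooth_on_cst.
  exact: sV.
exists (to_Cinf sh0); split=> [p f fE|p0 L pL f fE].
  by rewrite to_CinfE /h0; congr D; apply: Cinf_ext => q'; rewrite fE.
have [c Ac cp0] := atlas_cover p0.
have [u hu] := pder_chart pL Ac cp0.
have oc := chart_cod_open c; have oc' := chart_cod_open c'.
have -> : L (to_Cinf sh0) = \sum_i u i * \sum_j v j *
    partial (lshift m i) (partial (rshift k j) (Ft c c')) (row_mx (c p0) (c' q)).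
  rewrite hu; apply: eq_bigr => i _; congr (_ * _); rewrite /chart_partial.
  have -> : to_Cinf sh0 \o chart_inv c = (fun y =>
    \sum_j v j * partial (rshift k j) (Ft c c') (row_mx y (c' q))).
    by apply/funext => y; rewrite /= h0E.
  rewrite (partial_lincomb _ _ _ oc (chart_mapP cp0) (sV c Ac)).
  by apply: eq_bigr => j _; rewrite -partial_row_mxl.
have -> : D f = \sum_j v j * \sum_i u i *
    partial (rshift k j) (partial (lshift m i) (Ft c c')) (row_mx (c p0) (c' q)).
  rewrite hv; apply: eq_bigr => j _; congr (_ * _); rewrite /chart_partial.
  have E : forall z, (f \o chart_inv c') z =
      \sum_i u i * partial (lshift m i) (Ft c c') (row_mx (c p0) z).
    move=> z; rewrite /= (fE _ (to_Cinf (slice_left (chart_inv c' z)))) // hu.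
    apply: eq_bigr => i _; congr (_ * _).
    rewrite -partial_row_mxl /chart_partial; congr (partial i _ _).
    by apply/funext => y; rewrite /= FtE.
  rewrite (funext E).
  have sW i : smooth_on (chart_cod c')
      (fun z => partial (lshift m i) (Ft c c') (row_mx (c p0) z)).
    apply: (smooth_on_comp (V := chart_cod (prod_chart c c'))
      (F := fun z => row_mx (c p0) z)) => //.
    - exact: chart_cod_open.
    - exact: smooth_row_mxr.
    - by move=> z cz; apply: codP => //; exact: chart_mapP.
    - by apply: smooth_on_partial; exact: sFt.
  rewrite (partial_lincomb _ _ _ oc' (chart_mapP c'q) sW).
  by apply: eq_bigr => i _; rewrite -partial_row_mxr.
(* Both sides are now the same double sum with the two partials in opposite order. *)
under eq_bigr do rewrite mulr_sumr; rewrite exchange_big /=.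
apply: eq_bigr => j _; rewrite mulr_sumr; apply: eq_bigr => i _.
rewrite (@partialC R _ (chart_cod (prod_chart c c'))) //.
- by rewrite mulrCA.
- exact: chart_cod_open.
- exact: sFt.
- by apply: codP; exact: chart_mapP.
Qed.

End Slices.

(** * Push-forwards, and continuity in the topology of Diff(M) *)

Section Diffeomorphisms.
Variables (R : realType) (m : nat) (M : manifoldType R m).
Implicit Types (phi psi : diffeo M) (f g : Cinf M) (X Y : vfield M).

Lemma smooth_pullback (phi : M -> M) (f : Cinf M) :
  smooth_map_for (atlas M) (atlas M) phi ->
  smooth_for (atlas M) (fun x => f (phi x)).
Proof.
move=> sphi; apply: (smooth_for_comp _ sphi (Cinf_smooth f)) => x.
exact: atlas_cover.
Qed.

Definition pullback phi f : Cinf M := to_Cinf (smooth_pullback f (diffeo_smooth phi)).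

Lemma relatedP phi X Y : related phi X Y <->
  forall f x, X (pullback phi f) x = Y f (phi x).
Proof.
split=> [XY f x|XY f h hE x]; first exact: XY.
by rewrite -XY; congr (X _ x); apply: Cinf_ext => z; rewrite hE.
Qed.

Definition push_fun phi X f : Cinf M :=
  to_Cinf (smooth_pullback (X (pullback phi f)) (diffeo_inv_smooth phi)).

Lemma push_derivation phi X : push_fun phi X \in @derivation R m M.
Proof.
apply/asboolP; split=> [a f g|f g]; apply: Cinf_ext => z; rewrite to_CinfE.
  have -> : pullback phi (a *: f + g) = a *: pullback phi f + pullback phi g.
    exact: Cinf_ext.
  by rewrite vfield_lin.
have -> : pullback phi (f * g) = pullback phi f * pullback phi g by exact: Cinf_ext.
by rewrite vfieldM !CinfDE !CinfME !to_CinfE !diffeo_invK.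
Qed.

Definition push phi X : vfield M := MkVfield (push_derivation phi X).

Lemma push_related phi X : related phi X (push phi X).
Proof.
apply/relatedP => f x.
by rewrite -[RHS]/(X (pullback phi f) (diffeo_inv phi (phi x))) diffeo_funK.
Qed.

Lemma open_diffeo_subbase (N : set (diffeo M)) : diffeo_subbase N -> open N.
Proof.
move=> bN; exists [set N]; first by move=> _ ->; exact: finI_from1.
by rewrite bigcup_set1.
Qed.

Section Continuity.
Variables (phi : diffeo M) (x : M) (c c' : chart R M m).
Hypotheses (Ac : atlas M c) (Ac' : atlas M c') (cx : chart_dom c x)
  (c'x : chart_dom c' (phi x)).

(** The set {x} is an admissible compact set, so the topology controls the derivatives at a single
    point. *)
Lemma near_diffeo_near (r : nat) (e : R) : 0 < e ->
  nbhs phi (diffeo_near phi c c' [set x] r e).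
Proof.
move=> e0; apply: open_nbhs_nbhs; split.
  apply: open_diffeo_subbase; exists phi, c, c', [set x], r, e; split=> //.
  split=> //; first exact: compact_set1.
  - by move=> _ ->.
  - by move=> _ [_ -> <-].
split; first by move=> _ [_ -> <-].
by move=> _ -> l j _; rewrite subrr normr0.
Qed.

Lemma near_chart_dom : nbhs phi [set psi : diffeo M | chart_dom c' (psi x)].
Proof. by apply: filterS (near_diffeo_near 0 ltr01) => psi [h _]; apply: h; exists x. Qed.

Lemma cvg_local_expr l j : (size l <= 1)%N ->
  (fun psi : diffeo M => partials l (local_expr c c' psi j) (c x)) @ phi -->
  partials l (local_expr c c' phi j) (c x).
Proof.
move=> l1; apply/(@cvgrPdist_lt _ _ _ (nbhs phi) _) => e e0.
apply: filterS (near_diffeo_near 1 e0) => psi [_ /(_ x erefl l j l1)].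
by rewrite distrC.
Qed.

Lemma cvg_chart_image : (fun psi : diffeo M => c' (psi x)) @ phi --> c' (phi x).
Proof.
apply: (@cvg_rV _ _ _ (nbhs phi) _) => j.
have := @cvg_local_expr [::] j isT.
by rewrite /local_expr /= chart_mapK.
Qed.

Lemma cvg_chart_comp (u : 'rV[R]_m -> R) : {for c' (phi x), continuous u} ->
  (fun psi : diffeo M => u (c' (psi x))) @ phi --> u (c' (phi x)).
Proof.
move=> cu; exact: (cvg_comp (fun psi : diffeo M => c' (psi x)) u cvg_chart_image cu).
Qed.

Lemma cvg_eval f : (fun psi : diffeo M => f (psi x) : R) @ phi --> (f (phi x) : R).
Proof.
have sf := Cinf_smooth f Ac'.
have := cvg_chart_comp (smooth_on_cont sf (chart_mapP c'x)).
rewrite /= chart_mapK // => h; apply: cvg_trans h; apply: (@near_eq_cvg _ _ (nbhs phi) _).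
by apply: filterS near_chart_dom => psi cp; rewrite /= chart_mapK.
Qed.

Lemma chart_partial_pullback psi f i : chart_dom c' (psi x) ->
  chart_partial c i (pullback psi f) x =
  \sum_j partial j (f \o chart_inv c') (c' (psi x)) *
    partial i (local_expr c c' psi j) (c x).
Proof.
move=> cp; pose U := [set y | chart_cod c y /\ chart_dom c' (psi (chart_inv c y))].
have oU : open U.
  apply: (@open_chart_preimage _ _ _ c (psi @^-1` chart_dom c')).
  exact: ((continuousP _).1 (diffeo_smooth psi).1 _ (chart_dom_open c')).
have Ux : U (c x) by split; [exact: chart_mapP|rewrite chart_mapK].
have sF : smooth_on_rV U (c' \o psi \o chart_inv c).
  exact: (diffeo_smooth psi).2.
have [|_] := @partial_comp R m m U (chart_cod c') (c' \o psi \o chart_inv c)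
  (chart_cod_open c') sF _ _ (c x) i (Cinf_smooth f Ac') Ux.
  by move=> y [_ cy]; exact: chart_mapP.
rewrite /= chart_mapK // => <-; apply: near_eq_derive.
apply: filterS (open_nbhs_nbhs (conj oU Ux)) => y [cy c'y].
by rewrite /= chart_mapK.
Qed.

(** By the chain rule psi enters only through the point psi(x) and its first partials at x, and both
    are continuous in psi. *)
Lemma cvg_pullback_derivative (D : Cinf M -> R) f : point_derivation x D ->
  (fun psi : diffeo M => D (pullback psi f)) @ phi --> D (pullback phi f).
Proof.
move=> pD; have [v hv] := pder_chart pD Ac cx.
have sf := Cinf_smooth f Ac'.
have L : (fun psi : diffeo M => \sum_i v i *
    \sum_j partial j (f \o chart_inv c') (c' (psi x)) *
    partial i (local_expr c c' psi j) (c x)) @ phi --> D (pullback phi f).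
  rewrite hv; apply: (cvg_sum_fct (F := nbhs phi)) => i.
  apply: (@cvgM _ _ (nbhs phi) _); first exact: (@cvg_cst _ _ _ (nbhs phi) _).
  rewrite chart_partial_pullback //; apply: (cvg_sum_fct (F := nbhs phi)) => j.
  apply: (@cvgM _ _ (nbhs phi) _).
    apply: cvg_chart_comp.
    exact: (smooth_on_cont (smooth_on_partial j sf) (chart_mapP c'x)).
  exact: (@cvg_local_expr [:: i]).
apply: cvg_trans L; apply: (@near_eq_cvg _ _ (nbhs phi) _).
apply: filterS near_chart_dom => psi cp; rewrite hv; apply: eq_bigr => i _.
by rewrite chart_partial_pullback.
Qed.

End Continuity.

Lemma cvg_diffeo_eval phi x f :
  (fun psi : diffeo M => f (psi x) : R) @ phi --> (f (phi x) : R).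
Proof.
have [c Ac cx] := atlas_cover x; have [c' Ac' c'x] := atlas_cover (phi x).
exact: (cvg_eval Ac Ac' cx c'x).
Qed.

Lemma cvg_diffeo_derivative phi x X f :
  (fun psi : diffeo M => X (pullback psi f) x : R) @ phi --> (X (pullback phi f) x : R).
Proof.
have [c Ac cx] := atlas_cover x; have [c' Ac' c'x] := atlas_cover (phi x).
exact: (@cvg_pullback_derivative phi x c c' Ac Ac' cx c'x (fun h => X h x) f (vfield_pder X x)).
Qed.

Lemma near_diffeo_open phi x (U : set M) : open U -> U (phi x) ->
  nbhs phi [set psi : diffeo M | U (psi x)].
Proof.
move=> oU Ux; have [h [h1 h0]] := bump_at oU Ux.
have : nbhs phi [set psi : diffeo M | 0 < (h (psi x) : R)].
  have /cvgr_gt := @cvg_diffeo_eval phi x h; apply.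
  by rewrite h1 ltr01.
apply: filterS => psi hp; have [//|Up] := pselect (U (psi x)).
by move: hp; rewrite /= h0 ?ltxx.
Qed.

Lemma closure_diffeo_eq (H : set (diffeo M)) phi (F : diffeo M -> R) (a : R) :
  closure H phi -> F @ phi --> F phi -> nbhs phi [set psi : diffeo M | H psi -> F psi = a] ->
  F phi = a.
Proof.
move=> cH cF nF; apply/eqP; rewrite -subr_eq0 -normr_le0 leNgt; apply/negP => e0.
have nd := (@cvgrPdist_lt _ _ _ (nbhs phi) _ F (F phi)).1 cF _ e0.
have [psi [Hp [Fp dp]]] := cH _ (filterI nF (nd (nbhs_filter phi))).
by move: dp => /=; rewrite Fp // ltxx.
Qed.

End Diffeomorphisms.

(** * Invariance under the action *)

Section OneForms.
Variables (R : realType) (m : nat) (M : manifoldType R m).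

Definition form1 (w : cochain M 1) (X : vfield M) : Cinf M := w (fun=> X).

Lemma form1E (w : cochain M 1) T : w T = form1 w (T ord0).
Proof. by congr (w _); apply/funext => i; rewrite ord1. Qed.

Lemma dform_linear (w : cochain M 1) : dform w -> Cinf_linear (form1 w).
Proof.
case=> wl _ f X Y; have := wl (fun=> X) ord0 f X Y.
have E Z : upd (fun=> X) ord0 Z = (fun=> Z) :> ('I_1 -> vfield M).
  by apply/funext => i; rewrite /upd ord1 eqxx.
by rewrite !E.
Qed.

Lemma contract_linear n (w : cochain M n.+1) T : dform w ->
  Cinf_linear (fun Z => contraction Z w T).
Proof. by move=> dw f X Y; rewrite dform_lin. Qed.

End OneForms.

Section Orbits.
Variables (R : realType) (k m s : nat).
Variables (G : lieGroupType R k) (M : manifoldType R m) (rho : G -> diffeo M).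
Variables (L : 'I_s -> vfield G) (xi : 'I_s -> vfield M).
Hypothesis act : lie_action rho.
Hypothesis comm : commutative (fun a b : G => (a * b)%g).
Hypothesis fund : forall i, fundamental rho (L i) (xi i).
Implicit Types (x : M) (X Y : vfield M) (f : Cinf M).

Lemma smooth_orbit f :
  smooth_for (prod_atlas (atlas G) (atlas M)) (fun z : G * M => f (rho z.1 z.2) : R).
Proof.
have [_ _ sr] := act; apply: (smooth_for_comp _ sr (Cinf_smooth f)) => x.
exact: atlas_cover.
Qed.

Definition orbit_fun f x : Cinf G := to_Cinf (slice_left (smooth_orbit f) x).

Lemma fundE i f x : xi i f x = L i (orbit_fun f x) 1%g.
Proof. exact: (fund i). Qed.

(** Commutativity makes the orbit map of rho_a x equal to rho_a after the orbit map of x. *)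
Lemma related_rho_xi i a : related (rho a) (xi i) (xi i).
Proof.
have [_ rM _] := act; apply/relatedP => f x; rewrite !fundE; congr (L i _ _).
by apply: Cinf_ext => b; rewrite !to_CinfE -!rM (comm a b).
Qed.

Lemma related_closure_xi i phi : closure (range rho) phi -> related phi (xi i) (xi i).
Proof.
move=> cphi; apply/relatedP => f x; apply/eqP; rewrite -subr_eq0; apply/eqP.
apply: (closure_diffeo_eq (F := fun psi => xi i (pullback psi f) x - xi i f (psi x)) cphi).
  apply: (@cvgB _ _ _ (nbhs phi) _); first exact: cvg_diffeo_derivative.
  exact: cvg_diffeo_eval.
apply: (@filterS _ (nbhs phi) _ setT); last exact: filterT.
move=> _ _ [a _ <-]; rewrite /= ((relatedP _ _ _).1 (@related_rho_xi i a)); exact: subrr.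
Qed.

Lemma near_orbit (U : set M) x : open U -> U x ->
  nbhs (1%g : G) [set b | U (rho b x)].
Proof.
move=> oU Ux; have [r1 _ sr] := act.
apply: open_nbhs_nbhs; split; last by rewrite /= r1.
have cr : continuous (fun b : G => rho b x).
  move=> b; apply: (@continuous_comp _ _ _ (fun b : G => (b, x)) (fun z : G * M => rho z.1 z.2)).
    by apply: cvg_pair; [exact: cvg_id|exact: cvg_cst].
  exact: sr.1.
exact: ((continuousP _).1 cr).
Qed.

(* The function h is b |-> (rho_b^* w)(X) at x near the identity. It is built by
   expanding the first field in a frame, so that no smooth dependence of
   push-forwards on b has to be stated. *)
Lemma orbit_form n (w : cochain M n) (X : 'I_n -> vfield M) x : dform w ->
  exists h : Cinf G, nbhs (1%g : G) [set b | forall Y : 'I_n -> vfield M,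
      (forall i, related (rho b) (X i) (Y i)) -> h b = w Y (rho b x)] /\
    forall i, L i h 1%g = lie (xi i) w X x.
Proof.
have [r1 _ _] := act.
elim: n w X => [|n IH] w X dw.
  exists (orbit_fun (w X) x); split=> [|i].
    apply: (@filterS _ (nbhs _) _ setT) => [b _ Y _|]; last exact: filterT.
    by rewrite to_CinfE; congr (w _ _); apply/funext => -[].
  by rewrite lie0E fundE.
have [y [E [U [oU Ux UE]]]] := frame_exists x.
have VU := near_orbit oU Ux.
(* [h j] is the j-th frame coordinate, at rho_b x, of the push-forward of the first field;
   interchanging derivations computes its derivative along the group. *)
have /choice[h hP] : forall j, exists h : Cinf G,
    (forall b f, (forall z, f z = y j (rho b z)) -> h b = X ord0 f x) /\
    forall i, L i h 1%g = X ord0 (xi i (y j)) x.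
  move=> j; have [h [h1 h2]] := mixed_derivation (smooth_orbit (y j)) (vfield_pder (X ord0) x).
  exists h; split=> [b f fE|i]; first exact: h1.
  apply: (h2 _ _ (vfield_pder (L i) 1%g)) => z g gE.
  by apply: fund => a; rewrite gE.
(* The frame field [E j] does not depend on b, so the induction hypothesis applies to the
   contraction of w with it. *)
have /choice[H HP] : forall j, exists H : Cinf G,
    nbhs (1%g : G) [set b | forall Y : 'I_n -> vfield M,
      (forall i, related (rho b) (X (lift ord0 i)) (Y i)) ->
      H b = contraction (E j) w Y (rho b x)] /\
    forall i, L i H 1%g = lie (xi i) (contraction (E j) w) (X \o lift ord0) x.
  by move=> j; apply: IH; exact: dform_contract.
have WH := filter_forall (nbhs_filter (1%g : G)) (fun j => (HP j).1).
exists (\sum_j h j * H j); split=> [|i].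
  apply: filterS (filterI VU WH) => b [Vb Wb] Y XY.
  rewrite -(vcons_eta Y) -contractE.
  rewrite (UE (fun Z => contraction Z w (Y \o lift ord0))) //.
      rewrite Cinf_sumE; apply: eq_bigr => j _; rewrite CinfME.
      rewrite (Wb j (Y \o lift ord0) (fun i => XY _)).
      congr (_ * _); have [hE _] := hP j.
      rewrite (hE b (pullback (rho b) (y j))) //.
      by rewrite ((relatedP _ _ _).1 (XY ord0)).
    exact: contract_linear.
have h1 j : h j 1%g = X ord0 (y j) x.
  by have [hE _] := hP j; apply: hE => z; rewrite r1.
have H1 j : H j 1%g = contraction (E j) w (X \o lift ord0) x.
  rewrite ((nbhs_singleton (HP j).1) (X \o lift ord0)) ?r1 // => l.
  by apply/relatedP => f z; rewrite r1; congr (X _ _ _); apply: Cinf_ext => t; rewrite to_CinfE r1.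
rewrite vfield_sum Cinf_sumE.
under eq_bigr => j _ do rewrite vfieldM CinfDE !CinfME h1 H1 (hP j).2 (HP j).2.
pose Wf Z := contraction Z w (X \o lift ord0).
have lW : Cinf_linear Wf by exact: contract_linear.
have WX : w X = Wf (X ord0) by rewrite /Wf contractE vcons_eta.
have -> : lie (xi i) w X = lie (xi i) (contraction (X ord0) w) (X \o lift ord0) -
    Wf (lie_bracket (xi i) (X ord0)).
  by rewrite -{1}(vcons_eta X) -contractE contract_lie cochain_subE.
rewrite /lie -/(Wf _) !CinfBE (UE Wf lW (lie_bracket _ _)) //.
(* Here xi_i differentiates the expansion, which is therefore needed on all of U and not just at
   x. *)
rewrite (pder_local (vfield_pder (xi i) x) (g := \sum_j X ord0 (y j) * Wf (E j)) oU Ux); last first.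
  by move=> z Uz; rewrite UE // Cinf_sumE; apply: eq_bigr => j _; rewrite CinfME.
rewrite vfield_sum !Cinf_sumE.
under [X in _ = _ - X - _]eq_bigr => l _ do
  rewrite (UE (fun Z => contraction Z w _) (contract_linear _ dw) (X ord0)) //.
rewrite exchange_big -!sumrB; apply: eq_bigr => j _.
rewrite CinfBE Cinf_sumE vfieldM CinfDE !CinfME -mulr_sumr bracketE CinfBE.
rewrite -/(Wf (E j)) /Wf; ring.
Qed.

End Orbits.

(** The smooth function that represents h may change with the point, because [orbit_form] supplies
    one only near the identity. In charts h then has zero partials, so it is locally constant and
    its level sets are open and closed. *)
Lemma connected_constant (R : realType) m (M : manifoldType R m) (h : M -> R) :
  connected [set: M] ->
  (forall x, exists K : Cinf M, nbhs x [set z | h z = K z] /\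
     forall D, point_derivation x D -> D K = 0) ->
  forall x y, h x = h y.
Proof.
move=> cM hK.
have lc x : nbhs x [set z | h z = h x].
  have [c Ac cx] := atlas_cover x.
  have [r r0 rc] := chart_ball cx openT I.
  have oB := @open_norm_ball _ _ (c x) r.
  have Bx : [set z | chart_dom c z /\ `|c z - c x| < r] x.
    by split=> //; rewrite subrr normr0.
  apply: filterS (open_nbhs_nbhs (conj (@open_chart_ball _ _ _ c _ oB) Bx)) => z [cz bz].
  rewrite /= -(chart_mapK cz) -[in RHS](chart_mapK cx).
  apply: (@locally_constant _ _ (h \o chart_inv c) _ r _ _ bz) => y /ltW/rc[cy _] i.
  have [K [hKy KD]] := hK (chart_inv c y).
  have nE : {near y, K \o chart_inv c =1 h \o chart_inv c}.
    by have := chart_inv_cont cy hKy; apply: (@filterS _ (nbhs y) _) => t /= ->.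
  have dy := chart_invP cy; have := chart_derivable (f := K) (j := i) Ac dy.
  rewrite chart_invK // => dK; split; first exact: near_eq_derivable nE dK.
  rewrite -(KD _ (chart_pder i Ac dy)) /chart_partial chart_invK //.
  by apply/esym; apply: near_eq_derive; exact: nE.
move=> x y; have : [set z | h z = h y] = setT.
  apply: cM; first by exists y.
    exists [set z | h z = h y]; last by rewrite setTI.
    by rewrite openE => z hz; rewrite /interior -hz; exact: lc.
  exists [set z | h z = h y]; last by rewrite setTI.
  rewrite -openC openE => z hz; apply: filterS (lc z) => t /= ->; exact: hz.
by move=> /(congr1 (fun A : set M => A x)) /= ->.
Qed.

Section Invariance.
Variables (R : realType) (k m s : nat).
Variables (G : lieGroupType R k) (M : manifoldType R m) (rho : G -> diffeo M).
Variables (L : 'I_s -> vfield G) (xi : 'I_s -> vfield M).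
Hypothesis act : lie_action rho.
Hypothesis comm : commutative (fun a b : G => (a * b)%g).
Hypothesis fund : forall i, fundamental rho (L i) (xi i).

Lemma related_push (phi : diffeo M) (X Y : vfield M) : related phi X Y -> Y = push phi X.
Proof.
move=> XY; apply: vfield_ext => f; apply: Cinf_ext => x.
rewrite -(diffeo_invK phi x) -((relatedP _ _ _).1 XY).
by rewrite ((relatedP _ _ _).1 (@push_related _ _ _ phi X)).
Qed.

Lemma lie_invariant n (w : cochain M n) i : dform w ->
  (forall a, invariant_form (rho a) w) -> lie (xi i) w = 0.
Proof.
move=> dw iw; apply/funext => X; apply: Cinf_ext => x.
have [h [hE <-]] := orbit_form act fund X x dw.
move: hE; rewrite nbhsE => -[U [oU U1] UE].
rewrite (pder_local (vfield_pder (L i) 1%g) (g := w X x *: (1 : Cinf G)) oU U1).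
  by rewrite (pder_cst (vfield_pder (L i) 1%g)).
move=> b Ub; rewrite (UE b Ub (fun j => push (rho b) (X j)) (fun j => @push_related _ _ _ _ _)).
by rewrite (iw b X) ?CinfZE ?Cinf1E ?mulr1// => j; exact: push_related.
Qed.

Hypothesis basis : lie_algebra_basis L.

Lemma smooth_translate (f : Cinf G) : smooth_for (prod_atlas (atlas G) (atlas G))
  (fun z : G * G => f (z.1 * z.2)%g : R).
Proof.
apply: (smooth_for_comp _ lie_mul_smooth (Cinf_smooth f)) => x; exact: atlas_cover.
Qed.

Definition translate (f : Cinf G) a : Cinf G := to_Cinf (slice_right (smooth_translate f) a).

(* D extends to a left-invariant field. *)
Lemma point_derivation1 D : point_derivation (1%g : G) D ->
  exists c : 'I_s -> R, forall f, D f = \sum_i c i * L i f 1%g.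
Proof.
move=> pD.
have /choice[h hE] : forall f, exists h : Cinf G, forall a, h a = D (translate f a).
  move=> f; have [h [h1 _]] := mixed_derivation (smooth_translate f) pD.
  by exists h => a; apply: h1 => b; rewrite to_CinfE.
have dh : (h : Cinf G -> (Cinf G)^o) \in @derivation R k G.
  apply/asboolP; split=> [a f g|f g]; apply: Cinf_ext => z.
    rewrite CinfDE CinfZE !hE -pD.1; congr D; exact: Cinf_ext.
  have -> : h (f * g) z = D (translate f z * translate g z).
    by rewrite hE; congr D; exact: Cinf_ext.
  by rewrite CinfDE !CinfME !hE pD.2 !to_CinfE /= !mulg1.
have lh : left_invariant (MkVfield dh).
  move=> a f g gE x; rewrite /= !hE; congr D; apply: Cinf_ext => b.
  by rewrite !to_CinfE gE /= mulgA.
have [c [cE _]] := basis.2 _ lh; exists c => f.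
have -> : D f = h f 1%g.
  by rewrite hE; congr D; apply: Cinf_ext => b; rewrite to_CinfE /= mul1g.
rewrite -[h f]/(MkVfield dh f) cE Cinf_sumE; apply: eq_bigr => i _.
by rewrite CinfZE.
Qed.

Hypothesis conn : connected [set: G].

(** [orbit_form] speaks only about the identity. At b it is applied to the pushed fields at rho_b x,
    and left translation by b^-1 carries its conclusion to a neighbourhood of b. *)
Lemma invariant_lie n (w : cochain M n) : dform w -> (forall i, lie (xi i) w = 0) ->
  forall a, invariant_form (rho a) w.
Proof.
move=> dw lw a X Y XY x; have [r1 rM _] := act.
pose h0 (b : G) : R := w (fun i => push (rho b) (X i)) (rho b x).
have -> : Y = fun i => push (rho a) (X i).
  by apply/funext => i; exact: related_push.
have -> : w X x = h0 1%g.
  rewrite /h0 r1; congr (w _ x); apply/funext => i; apply: related_push.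
  by apply/relatedP => f z; rewrite r1; congr (X i _ _); apply: Cinf_ext => t; rewrite to_CinfE r1.
apply: (@connected_constant _ _ G h0 conn) => b.
have [K [KE KL]] := orbit_form act fund (fun i => push (rho b) (X i)) (rho b x) dw.
exists (translate K b^-1%g); split.
  have cb : {for b, continuous (fun b' : G => (b^-1 * b')%g)}.
    apply: (@continuous_comp _ _ _ (fun b' : G => (b^-1%g, b')) (fun z : G * G => (z.1 * z.2)%g)).
      by apply: cvg_pair; [exact: cvg_cst|exact: cvg_id].
    exact: lie_mul_smooth.1.
  have nb := cb _; rewrite /= mulVg in nb.
  apply: (@filterS _ (nbhs b) _ _ _ _ (nb _ KE)) => b' /= KE'.
  suff : h0 b' = K (b^-1 * b')%g by [].
  have bE z : rho (b^-1 * b')%g (rho b z) = rho b' z.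
    by rewrite -rM (comm _ b) mulgA mulgV mul1g.
  rewrite (KE' (fun i => push (rho b') (X i))) ?bE // => i; apply/relatedP => f z.
  rewrite -(diffeo_invK (rho b) z); move: (diffeo_inv _ z) => {}z.
  rewrite bE -!((relatedP _ _ _).1 (@push_related _ _ _ _ _)).
  by congr (X i _ _); apply: Cinf_ext => t; rewrite !to_CinfE bE.
move=> D pD.
(* Translation turns the derivation at b into one at the identity, hence into a combination of the
   L_i. *)
have pD1 : point_derivation (1%g : G) (fun f => D (translate f b^-1%g)).
  split=> [c f g|f g].
    by rewrite -pD.1; congr D; exact: Cinf_ext.
  have -> : translate (f * g) b^-1%g = translate f b^-1%g * translate g b^-1%g by exact: Cinf_ext.
  by rewrite pD.2 !to_CinfE /= mulVg.
have [c ->] := point_derivation1 pD1.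
by rewrite big1 // => i _; rewrite KL lw Cinf0E mulr0.
Qed.

End Invariance.

Section Closure.
Variables (R : realType) (m : nat) (M : manifoldType R m) (H : set (diffeo M)).

(** The push-forward of X changes with psi, so th of it is expanded in a frame near phi(x): the
    coordinates X(y_j o psi)(x) and the values th(E_j)(psi x) are continuous in psi, and the
    equality passes to the closure. *)
Lemma closure_invariant (th : vfield M -> Cinf M) : Cinf_linear th ->
  (forall phi : diffeo M, H phi -> forall X Y, related phi X Y ->
     forall x, th Y (phi x) = th X x) ->
  forall phi : diffeo M, closure H phi -> forall X Y, related phi X Y ->
    forall x, th Y (phi x) = th X x.
Proof.
move=> lth iH phi cphi X Y XY x.
have [y [E [U [oU Ux UE]]]] := frame_exists (phi x).
pose F (psi : diffeo M) : R := \sum_j X (pullback psi (y j)) x * th (E j) (psi x).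
have FE (psi : diffeo M) Z : U (psi x) -> related psi X Z -> F psi = th Z (psi x).
  move=> Up XZ; rewrite UE //; apply: eq_bigr => j _.
  by rewrite ((relatedP _ _ _).1 XZ).
rewrite -FE //; apply: (closure_diffeo_eq cphi).
  apply: (cvg_sum_fct (F := nbhs phi)) => j; apply: (@cvgM _ _ (nbhs phi) _).
    exact: cvg_diffeo_derivative.
  exact: cvg_diffeo_eval.
apply: (@filterS _ (nbhs phi) _ _ _ _ (near_diffeo_open oU Ux)) => psi Up Hpsi.
by rewrite (FE _ (push psi X)) ?(iH _ Hpsi X) //; exact: push_related.
Qed.

End Closure.

(** * The coframe and the rank of its differentials *)

Section Coframe.
Variables (R : realType) (m s : nat) (M : manifoldType R m) (xi : 'I_s -> vfield M).
Implicit Types (X Y : vfield M).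

Lemma tangent_decomposition (th : 'I_s -> vfield M -> Cinf M) X :
  (forall i, Cinf_linear (th i)) -> (forall i j, th i (xi j) = (i == j)%:R) ->
  tangent_fields xi X -> \sum_i th i X *: xi i = X.
Proof.
move=> lth thxi tX; apply: vfield_ext => f; apply: Cinf_ext => x.
have [c cE] := tX x; rewrite vfield_sumE Cinf_sumE cE.
apply: eq_bigr => i _; rewrite vfieldZE CinfME; congr (_ * _).
(* The coefficients c_j at x are frozen to constants. The difference vanishes at x only, which by
   tensoriality is enough for th_i. *)
have /(Cinf_linear_tensor (lth i)) :
    forall f, (X - \sum_j (c j *: (1 : Cinf M)) *: xi j) f x = 0.
  move=> h; rewrite vfieldBE CinfBE vfield_sumE Cinf_sumE cE -sumrB big1 // => j _.
  by rewrite vfieldZE CinfME CinfZE Cinf1E mulr1 subrr.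
have -> : X - \sum_j (c j *: (1 : Cinf M)) *: xi j =
    (-1) *: (\sum_j (c j *: (1 : Cinf M)) *: xi j) + X.
  by rewrite scaleN1r addrC.
rewrite (lth i) Cinf_linear_sum // CinfDE CinfME CinfNE Cinf1E mulN1r Cinf_sumE.
rewrite (bigD1 i) //= big1 => [|j ji].
  rewrite thxi eqxx mulr1 addr0 => h; have {}h : - (c i * 1) + th i X x = 0 by exact: h.
  by apply/eqP; rewrite -subr_eq0 addrC -[c i]mulr1 h.
by rewrite thxi eq_sym (negbTE ji) mulr0.
Qed.

Lemma basic_lin n (a : R) (u v : cochain M n) : basic xi u -> basic xi v ->
  basic xi (a *: u + v).
Proof.
move=> [du tu tdu] [dv tv tdv].
have tr n' (u' v' : cochain M n') : transverse xi u' -> transverse xi v' ->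
    transverse xi (a *: u' + v').
  case: n' u' v' => [|n'] u' v' hu hv X DX //=.
  have Z : contraction X (a *: u') = a *: contraction X u' by [].
  by rewrite contract_add Z (hu X DX) (hv X DX) scaler0 addr0.
split; first exact: dformD (dformZ a du) dv.
  exact: tr.
by rewrite ext_dD ext_dZ; exact: tr.
Qed.

Lemma basic0 n : basic xi (0 : cochain M n).
Proof.
have tr n' : transverse xi (0 : cochain M n') by case: n' => [|n'] X DX.
by split; [exact: dform_0|exact: tr|rewrite ext_d0; exact: tr].
Qed.

Lemma basic_sum n (I : finType) (c : I -> R) (u : I -> cochain M n) :
  (forall i, basic xi (u i)) -> basic xi (\sum_i c i *: u i).
Proof.
by move=> bu; elim/big_rec: _ => [|i v _ bv]; [exact: basic0|exact: basic_lin].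
Qed.

Lemma closed1_form1 (w : cochain M 1) : dform w -> ext_d w = 0 -> closed1 (form1 w).
Proof.
move=> dw dw0 X Y; have T : 'I_0 -> vfield M by case.
have := congr1 (fun u : cochain M 2 => contraction Y (contraction X u) T) dw0.
rewrite contract_ext_d // contract_add contract_opp contract_lie !cochain_addE.
rewrite !cochain_oppE contract_ext_d0 !lie0E !contractE !form1E !vcons0 => /eqP.
by rewrite addrAC subr_eq0 => /eqP.
Qed.

(** By Cartan's formula L_X w = d (w(X)), the differential of a constant. *)
Lemma lie_closed1 (w : cochain M 1) X a : dform w -> ext_d w = 0 ->
  form1 w X = a *: (1 : Cinf M) -> lie X w = 0.
Proof.
move=> dw dw0 wX; have := contract_ext_d X dw.
have -> : ext_d (contraction X w) = 0.
  apply: cochain_ext => Y; rewrite contract_ext_d0; apply/funext => T.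
  by rewrite lie0E contractE form1E vcons0 wX vfieldZ vfield1 scaler0.
by rewrite dw0 subr0 => <-.
Qed.

End Coframe.

Section CohomologicalRank.
Variables (R : realType) (m s k : nat) (M : manifoldType R m).
Variables (xi : 'I_s -> vfield M) (eta : 'I_s -> cochain M 1).

(** Substituting the two expansions into each other shows that sum_b (EC - 1)_ab w_b is d of a basic
    form, so independence of the classes forces EC = 1. The forms beta_i collect the basic
    primitives of both expansions. *)
Lemma rank_matrices : basic_cohomological_rank xi eta k ->
  exists (C : 'M[R]_(s, k)) (E : 'M[R]_(k, s)) (beta : 'I_s -> cochain M 1),
    [/\ E *m C = 1%:M, forall i, basic xi (beta i) &
      forall i, ext_d (eta i) =
        \sum_b C i b *: \sum_j E b j *: ext_d (eta j) + ext_d (beta i)].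
Proof.
move=> [w [/choice[e eP] /choice[c cP] ind]].
have /choice[u uP] : forall b, exists u : cochain M 1, basic xi u /\
    w b = \sum_j e b j *: ext_d (eta j) + ext_d u.
  by move=> b; have [u bu uE] := eP b; exists u; split=> //; rewrite uE addrC subrK.
have /choice[v vP] : forall i, exists v : cochain M 1, basic xi v /\
    ext_d (eta i) = \sum_b c i b *: w b + ext_d v.
  by move=> i; have [v bv vE] := cP i; exists v; split=> //; rewrite vE addrC subrK.
exists (\matrix_(i, b) c i b), (\matrix_(b, j) e b j), (fun i => \sum_b c i b *: u b + 1 *: v i).
have bu b := (uP b).1; have bv i := (vP i).1.
split=> [|i|i].
- apply/matrixP => a b; apply/eqP; rewrite -subr_eq0; apply/eqP.
  move: b; apply: ind.
  (* w_a and sum_b (EC)_ab w_b differ by d (u_a + sum_j e_aj v_j). The trailing 0 and the factor 1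
     only fit the shape of [basic_lin]. *)
  exists ((-1) *: (1 *: u a + \sum_j e a j *: v j) + 0).
    by apply: basic_lin (basic0 _ _); apply: basic_lin => //; exact: basic_sum.
  rewrite addr0 scale1r scaleN1r ext_dN ext_dD ext_d_sum.
  under [RHS]eq_bigr do rewrite scalerBl.
  rewrite sumrB [X in _ - X](_ : _ = w a); last first.
    rewrite (bigD1 a) //= big1 => [|i ia]; first by rewrite mxE eqxx scale1r addr0.
    by rewrite mxE eq_sym (negbTE ia) scale0r.
  have -> : \sum_i (\matrix_(b, j) e b j *m \matrix_(i0, b) c i0 b) a i *: w i =
      \sum_j e a j *: (ext_d (eta j) - ext_d (v j)).
    under eq_bigr do rewrite mxE scaler_suml.
    rewrite exchange_big; apply: eq_bigr => j _; rewrite (vP j).2 addrK scaler_sumr.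
    by apply: eq_bigr => b _; rewrite !mxE scalerA.
  rewrite (uP a).2; under [in RHS]eq_bigr do rewrite scalerBr.
  rewrite sumrB [in RHS]opprD addrACA subrr add0r -opprD addrC; congr (- (_ + _)).
  by apply: eq_bigr => j _; rewrite ext_dZ.
- rewrite addrC; apply: basic_lin => //; exact: basic_sum.
- rewrite ext_dD ext_d_sum scale1r (vP i).2 addrA -big_split; congr (_ + _).
  apply: eq_bigr => b _; rewrite mxE ext_dZ (uP b).2 scalerDr; congr (_ *: _ + _).
  by apply: eq_bigr => j _; rewrite mxE.
Qed.

End CohomologicalRank.

Theorem theorem1p2 (R : realType) (n s k : nat)
    (M : manifoldType R (n + s)) (G : lieGroupType R s)
    (g : vfield M -> vfield M -> Cinf M) (rho : G -> diffeo M)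
    (L : 'I_s -> vfield G) (xi : 'I_s -> vfield M)
    (eta : 'I_s -> cochain M 1) :
  compact [set: M] ->
  riemannian_metric g ->
  connected [set: G] ->
  commutative (fun a b : G => (a * b)%g) ->
  lie_action rho ->
  (forall a, preserves_metric g (rho a)) ->
  locally_free rho ->
  lie_algebra_basis L ->
  (forall i, fundamental rho (L i) (xi i)) ->
  dual_coframe xi g eta ->
  basic_cohomological_rank xi eta k ->
  degenerates_at (fun r => ('I_r -> vfield M) -> Cinf M)
    (@ext_d R (n + s) M) (fol_filtration xi (closure (range rho))) (k + 2).
Proof.
move=> _ _ conn comm act _ _ basis fund coframe rk.
have [C [E [beta [EC bbeta dE]]]] := rank_matrices rk.
have deta i : dform (eta i) by have [] := coframe i.
have etaxi i j : form1 (eta i) (xi j) = (i == j)%:R by have [_ ex _] := coframe i; exact: ex.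
have dbeta i : dform (beta i) by have [] := bbeta i.
have betaD i X : tangent_fields xi X -> form1 (beta i) X = 0.
  move=> DX; have [_ /(_ X DX) bX _] := bbeta i.
  have T : 'I_0 -> vfield M by case.
  by have := congr1 (fun u : cochain M 0 => u T) bX; rewrite contractE form1E vcons0.
have dsum (I : finType) (a : I -> R) (w : I -> cochain M 1) :
    (forall i, dform (w i)) -> dform (\sum_i a i *: w i).
  move=> dw; elim/big_rec: _ => [|i v _ dv]; first by have [] := basic0 xi 1.
  exact: dformD (dformZ _ (dw i)) dv.
pose T i : cochain M 1 := eta i - \sum_b C i b *: \sum_j E b j *: eta j - beta i.
have dT i : dform (T i).
  by apply: dformB => //; apply: dformB => //; apply: (dsum) => b; exact: dsum.
have TE i : form1 (T i) = (fun X => form1 (eta i) X -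
    \sum_(b < k) C i b *: (1 : Cinf M) * (\sum_(j < s) E b j *: (1 : Cinf M) * form1 (eta j) X)
    - form1 (beta i) X).
  apply/funext => X; rewrite /T /form1 !cochain_subE cochain_sumE; congr (_ - _ - _).
  apply: eq_bigr => b _; rewrite -CinfZAl mul1r cochain_scaleE cochain_sumE; congr (_ *: _).
  by apply: eq_bigr => j _; rewrite -CinfZAl mul1r.
have dT0 i : ext_d (T i) = 0.
  have -> : ext_d (T i) = ext_d (eta i) -
      \sum_b C i b *: \sum_j E b j *: ext_d (eta j) - ext_d (beta i).
    rewrite !ext_dB ext_d_sum; congr (_ - _ - _); apply: eq_bigr => b _.
    by rewrite ext_dZ ext_d_sum; congr (_ *: _); apply: eq_bigr => j _; rewrite ext_dZ.
  by rewrite [X in X - _ - _]dE addrAC addrK subrr.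
have lieT i j : lie (xi j) (T i) = 0.
  (* The value of [T i] on xi_j is the constant delta_ij - (CE)_ij, as beta_i vanishes along the
     orbits. *)
  apply: (lie_closed1 (a := (i == j)%:R - \sum_b C i b * E b j)) => //.
  rewrite TE betaD ?subr0; last exact: tangent_xi.
  rewrite etaxi scalerBl scaler_suml scaler_nat; congr (_ - _); apply: eq_bigr => b _.
  rewrite (bigD1 j) //= etaxi eqxx mulr1 big1 ?addr0 => [|l lj].
    by rewrite -CinfZAl mul1r scalerA.
  by rewrite etaxi (negbTE lj) mulr0.
have invT i phi : closure (range rho) phi -> forall X Y, related phi X Y ->
    forall x, form1 (T i) Y (phi x) = form1 (T i) X x.
  apply: closure_invariant; first exact: dform_linear.
  move=> _ [a _ <-] X Y XY x.
  by apply: (invariant_lie act comm fund basis conn (dT i) (lieT i)).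
apply: (@degeneration _ _ _ _ _ xi _ (fun i => form1 (eta i)) (fun i => form1 (beta i)) C E) => //.
- by move=> i; exact: dform_linear.
- by move=> i; exact: dform_linear.
- move=> X DX; apply: (tangent_decomposition (th := fun i => form1 (eta i))) => // i.
  exact: dform_linear.
- by move=> i; have := closed1_form1 (dT i) (dT0 i); rewrite TE.
- by move=> i; have := invT i; rewrite TE.
- by move=> i phi cphi; apply: (related_closure_xi act comm fund i cphi).
- move=> n' w i [dw iw]; apply: (lie_invariant act fund) => // a; apply: iw.
  by apply: subset_closure; exists a.
Qed.
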